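(* For any $D\ge 2$, $d\in\{1,\dots,D\}$ and $r_0>2$, we have $\lambda^*_{d,r_0} < \lambda^{\mathrm{face}}_d$.
   Context: Let $X$ be a homogeneous Poisson point process on $\mathbb{R}^D$ of intensity $\lambda>0$ under $\mathbb{P}_\lambda$. For a discrete set $\Lambda$ (a.s. in general position), $\mathscr{S}_d(\Lambda)$ is the set of $d$-simplices $\mathrm{ConvexHull}(\{x_1,\dots,x_{d+1}\})$ with $x_i\in\Lambda$ distinct and $|x_i-x_j|\le1$ for all $i,j$. Two $d$-simplices are adjacent if they share a face (convex hull of $d$ of the vertices). $\lambda^{\mathrm{face}}_d$ is the infimum of $\lambda$ for which, with positive probability, $\mathscr{S}_d(X)$ contains an infinite path of adjacent $d$-simplices. Two $d$-simplices of $\mathscr{S}_d(X)$ are $*$-adjacent with range $r_0$ if their Euclidean distance (as subsets of $\mathbb{R}^D$) is at most $r_0$. There is $*$-percolation with range $r_0$ of $d$-simplices if there is an infinite sequence $\sigma_1,\sigma_2,\dots$ of distinct simplices of $\mathscr{S}_d(X)$ with $\sigma_i,\sigma_{i+1}$ $*$-adjacent with range $r_0$ for all $i$; $\lambda^*_{d,r_0}$ is the infimum of $\lambda>0$ for which this has positive probability. *)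

(* Defs.v *)
From HB Require Import structures.
From mathcomp Require Import all_boot all_order all_algebra.
From mathcomp Require Import all_classical all_reals all_analysis.
Set Implicit Arguments.
Unset Strict Implicit.
Unset Printing Implicit Defensive.
Import Order.TTheory GRing.Theory Num.Theory.
Local Open Scope classical_set_scope.
Local Open Scope ring_scope.
Local Open Scope card_scope.

Section Defs.
Variable R : realType.
Variable D : nat.

Notation pt := 'rV[R]_D.

Definition edist (x y : pt) : R :=
  Num.sqrt (\sum_(i < D) (x ord0 i - y ord0 i) ^+ 2).

Definition hull (A : set pt) : set pt :=
  [set x | exists (n : nat) (p : 'I_n -> pt) (w : 'I_n -> R),
      (forall i, A (p i)) /\ (forall i, 0 <= w i) /\
      \sum_(i < n) w i = 1 /\ x = \sum_(i < n) w i *: p i].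

Definition set_dist (A B : set pt) : R :=
  inf [set edist x y | x in A & y in B].

Definition simplex_with (Lambda : set pt) (d : nat) (v : 'I_d.+1 -> pt)
    (sigma : set pt) : Prop :=
  injective v /\ (forall i, Lambda (v i)) /\
  (forall i j, edist (v i) (v j) <= 1) /\ sigma = hull (range v).

Definition is_simplex (Lambda : set pt) (d : nat) (sigma : set pt) : Prop :=
  exists v : 'I_d.+1 -> pt, simplex_with Lambda v sigma.

Definition face_adjacent (Lambda : set pt) (d : nat) (sigma tau : set pt) : Prop :=
  exists (v w : 'I_d.+1 -> pt) (U V : set pt),
    simplex_with Lambda v sigma /\ simplex_with Lambda w tau /\
    U `<=` range v /\ U #= `I_d /\ V `<=` range w /\ V #= `I_d /\
    hull U = hull V.

Definition face_percolates (Lambda : set pt) (d : nat) : Prop :=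
  exists s : nat -> set pt, injective s /\
    (forall n, is_simplex Lambda d (s n)) /\
    (forall n, face_adjacent Lambda d (s n) (s n.+1)).

Definition star_percolates (Lambda : set pt) (d : nat) (r0 : R) : Prop :=
  exists s : nat -> set pt, injective s /\
    (forall n, is_simplex Lambda d (s n)) /\
    (forall n, set_dist (s n) (s n.+1) <= r0).

Definition box (a b : pt) : set pt :=
  [set x | forall i, a ord0 i <= x ord0 i < b ord0 i].
Definition box_vol (a b : pt) : R := \prod_(i < D) (b ord0 i - a ord0 i).

(* homogeneous Poisson point process of intensity lam: for finitely many
   pairwise disjoint nonempty boxes, the numbers of points in them are
   independent Poisson variables with means lam * volume *)
Definition is_PPP (dsp : measure_display) (Omega : measurableType dsp)
    (P : probability Omega R) (X : Omega -> set pt) (lam : R) : Prop :=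
  forall (m : nat) (a b : 'I_m -> pt) (k : 'I_m -> nat),
    (forall j i, a j ord0 i < b j ord0 i) ->
    (forall j j', j != j' -> box (a j) (b j) `&` box (a j') (b j') = set0) ->
    let E := [set om | forall j, (X om `&` box (a j) (b j)) #= `I_(k j)] in
    measurable E /\
    P E = (\prod_(j < m) poisson_pmf (lam * box_vol (a j) (b j)) (k j))%:E.

(* critical intensities (infimum in the extended reals; inf of empty = +oo) *)
Definition lambda_face (dsp : measure_display) (Omega : measurableType dsp)
    (P : probability Omega R) (X : R -> Omega -> set pt) (d : nat) : \bar R :=
  ereal_inf [set lam%:E | lam in
    [set lam : R | 0 < lam /\ (0 < P [set om | face_percolates (X lam om) d])%E]].

Definition lambda_star (dsp : measure_display) (Omega : measurableType dsp)
    (P : probability Omega R) (X : R -> Omega -> set pt) (d : nat) (r0 : R)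
    : \bar R :=
  ereal_inf [set lam%:E | lam in
    [set lam : R | 0 < lam /\
       (0 < P [set om | star_percolates (X lam om) d r0])%E]].

End Defs.

(* Main.v *)
(** Discretise [R^D] at a mesh [h], and group the cells of side [h] into coarse
cells of side [e = h * L], where [e] is fixed and [h] is small.  Put a bit on
every coarse cell; a cell whose bit is on links all simplices having a vertex in
a coarse cell at distance at most 1 from it.  Any two simplices linked in this
way are at distance at most [2 + O(e) <= r0], so with all bits on the linked
simplices percolate only if there is *-percolation, while with all bits off
they percolate as soon as there is face percolation.

Lowering the intensity is compensated by turning bits on, one coarse cell [C]
at a time (an Aizenman-Grimmett argument).  If a long connection uses the points
of [C] and no bit near [C], then the last simplex before and the first one after
the passage through [C] both have a vertex within distance 1 of [C], so emptying
[C] and turning its bit on preserves the connection.  Hence the points of [C]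
cannot matter unless the bits near [C] do, and replacing [lam] by [q * lam] in [C]
while turning on each bit near [C] with probability 1/2 does not decrease
the probability of a long connection.  The choice of [q < 1] depends on [e] but
not on [h], because at most two simplices of a shortest connection meet [C], so
only boundedly many points of [C] are needed.

The cells are transferred to the actual process by shrinking the mesh by
[1 + 2 * D * h], which turns "some points of the two cells are at distance at
most 1" into "all of them are" and costs a factor [(1 + 2 * D * h) ^ D] in the
intensity, negligible for small [h].  It remains to exclude the degenerate
cases: the face threshold is positive by counting paths, and the * threshold is
finite by a renormalisation argument with boxes of side [3 ^ k]. *)

Require Import Defs.
From HB Require Import structures.
From mathcomp Require Import all_boot all_order all_algebra.
From mathcomp Require Import all_classical all_reals all_analysis.
From mathcomp Require Import ring lra zify.
Import Order.TTheory GRing.Theory Num.Theory.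
Local Open Scope classical_set_scope.
Local Open Scope ring_scope.
Set Implicit Arguments.
Unset Strict Implicit.
Unset Printing Implicit Defensive.

(** * Averages over finitely many coordinates *)

(** Percolation is an infinite event, whereas replacing cells one at a time needs finitely many
    coordinates. The comparison is therefore between probabilities of leaving a box of size [n],
    with constants independent of [n]: face percolation gives a positive lower bound for all [n] at
    once, and *-percolation is recovered from such a bound by continuity of the measure and Koenig's
    lemma. Counts are capped at [d.+1], the most points of a cell that one simplex can use. Laws
    then live on a finite set, expectations are iterated finite sums, and the thinned law dominates
    [q ^+ d.+1] times the old one pointwise; a resampling kernel thus replaces the usual derivative
    in the intensity. The measure enters only through the joint law of the counts in disjoint cells.
    The drop in intensity must be fixed before the mesh is: it pays for the mesh and also for
    starting slightly above the face threshold, which need not be attained. Hence no constant of the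
    one-cell comparison may depend on the mesh. *)

Section Averages.
Variables (R : realType) (I : eqType) (m : nat).
Implicit Types (s t : I -> nat) (F G : (I -> nat) -> R) (W U : I -> nat -> R).
Implicit Types (l : seq I) (i j : I).

Definition upd s i k := fun j => if j == i then k else s j.
Definition setl s l k := fun j => if j \in l then k else s j.
Definition cfgle s t := forall i, (s i <= t i)%N.
Definition monoF F := forall s t, cfgle s t -> F s <= F t.

(* [avg w i F] averages out the coordinate [i]; the expectation of [F] when the
   coordinates in [l] are independent with laws [W i], and the others are frozen
   to their values in [s], is the iterated average [avgs W l F s]. *)
Definition avg (w : nat -> R) i F s := \sum_(k < m.+1) w k * F (upd s i k).
Fixpoint avgs W l F : (I -> nat) -> R :=
  if l is i :: l' then avg (W i) i (avgs W l' F) else F.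
Definition is_law (w : nat -> R) :=
  (forall k, 0 <= w k) /\ \sum_(k < m.+1) w k = 1.

Lemma updC s i j a b : i != j -> upd (upd s i a) j b = upd (upd s j b) i a.
Proof.
move=> ij; apply/funext => x; rewrite /upd.
by have [->|_] := eqVneq x j => //; rewrite eq_sym (negbTE ij).
Qed.

Lemma upd_upd s i a b : upd (upd s i a) i b = upd s i b.
Proof. by apply/funext => x; rewrite /upd; case: eqP. Qed.

Lemma setl_upd s l i a b : i \in l -> setl (upd s i a) l b = setl s l b.
Proof.
move=> il; apply/funext => x; rewrite /setl /upd.
by have [->|_] := eqVneq x i => //; rewrite il.
Qed.

Lemma setl_cons s l i a : setl (upd s i a) l a = setl s (i :: l) a.
Proof.
apply/funext => x; rewrite /setl /upd inE.
by case: (x \in l); rewrite ?orbT ?orbF.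
Qed.

Lemma setl_updC s l i a b : i \notin l ->
  setl (upd s i a) l b = upd (setl s l b) i a.
Proof.
move=> il; apply/funext => x; rewrite /setl /upd.
by have [->|_] := eqVneq x i => //; rewrite (negbTE il).
Qed.

Lemma cfgle_refl s : cfgle s s. Proof. by move=> i. Qed.

Lemma cfgle_upd s t i a b : cfgle s t -> (a <= b)%N -> cfgle (upd s i a) (upd t i b).
Proof. by move=> st ab x; rewrite /upd; case: eqP => // _; exact: st. Qed.

Lemma cfgle_upd0 s i : cfgle (upd s i 0%N) s.
Proof. by move=> x; rewrite /upd; case: eqP. Qed.

Lemma cfgle_setl s t l a b : cfgle s t -> (a <= b)%N -> cfgle (setl s l a) (setl t l b).
Proof. by move=> st ab x; rewrite /setl; case: ifP => // _; exact: st. Qed.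

Lemma avg_le w i F G s : (forall k, 0 <= w k) ->
  (forall k, F (upd s i k) <= G (upd s i k)) -> avg w i F s <= avg w i G s.
Proof. by move=> w0 FG; apply: ler_sum => k _; apply: ler_wpM2l. Qed.

Lemma avg_const w i (c : R) s : is_law w -> avg w i (fun=> c) s = c.
Proof. by case=> _ w1; rewrite /avg -mulr_suml w1 mul1r. Qed.

Lemma avg_lin w i (a b : R) F G s :
  avg w i (fun s => a * F s + b * G s) s = a * avg w i F s + b * avg w i G s.
Proof.
rewrite /avg !mulr_sumr -big_split; apply: eq_bigr => k _ /=; ring.
Qed.

Lemma avgC w w' i j F : i != j -> avg w i (avg w' j F) = avg w' j (avg w i F).
Proof.
move=> ij; apply/funext => s; rewrite /avg.
under eq_bigr => k _ do rewrite mulr_sumr.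
rewrite exchange_big /=; apply: eq_bigr => k _; rewrite mulr_sumr.
by apply: eq_bigr => k' _; rewrite updC //; ring.
Qed.

Lemma avgs_le W l F G s : (forall i k, 0 <= W i k) ->
  (forall s, F s <= G s) -> avgs W l F s <= avgs W l G s.
Proof.
move=> W0 FG; elim: l s => [|i l IH] s //=.
by apply: avg_le => // k; exact: IH.
Qed.

Lemma avgs_const W l (c : R) s : (forall i, is_law (W i)) -> avgs W l (fun=> c) s = c.
Proof.
move=> WL; elim: l s => [|i l IH] s //=.
have -> : avgs W l (fun=> c) = fun=> c by apply/funext.
exact: avg_const.
Qed.

Lemma avgs_lin W l (a b : R) F G s :
  avgs W l (fun s => a * F s + b * G s) s = a * avgs W l F s + b * avgs W l G s.
Proof.
elim: l s => [|i l IH] s //=; rewrite -avg_lin; congr (avg _ _ _ s).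
by apply/funext.
Qed.

Lemma avgsB W l F G s :
  avgs W l (fun s => F s - G s) s = avgs W l F s - avgs W l G s.
Proof.
have := avgs_lin W l 1 (-1) F G s; rewrite mul1r mulN1r => <-.
by congr (avgs _ _ _ s); apply/funext => t; rewrite mul1r mulN1r.
Qed.

Lemma avgsZ W l (a : R) F s : avgs W l (fun s => a * F s) s = a * avgs W l F s.
Proof.
have := avgs_lin W l a 0 F F s; rewrite mul0r addr0 => <-.
by congr (avgs _ _ _ s); apply/funext => t; rewrite mul0r addr0.
Qed.

Lemma avgsD W l F G s :
  avgs W l (fun s => F s + G s) s = avgs W l F s + avgs W l G s.
Proof.
have := avgs_lin W l 1 1 F G s; rewrite !mul1r => <-.
by congr (avgs _ _ _ s); apply/funext => t; rewrite !mul1r.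
Qed.

Lemma avgs_sum W l (J : Type) (r : seq J) (F : J -> (I -> nat) -> R) s :
  avgs W l (fun s => \sum_(j <- r) F j s) s = \sum_(j <- r) avgs W l (F j) s.
Proof.
elim: r => [|j r IH].
  rewrite [RHS]big_nil; have := avgsZ W l 0 (fun=> 0) s; rewrite [X in _ = X]mul0r.
  apply: etrans.
  by congr (avgs _ _ _ s); apply/funext => t; rewrite big_nil mul0r.
rewrite big_cons -IH -avgsD; congr (avgs _ _ _ s).
by apply/funext => t; rewrite big_cons.
Qed.

Lemma avgs_cat W l1 l2 F : avgs W (l1 ++ l2) F = avgs W l1 (avgs W l2 F).
Proof. by elim: l1 => //= i l1 ->. Qed.

Lemma avg_avgsC w W l i F : i \notin l ->
  avg w i (avgs W l F) = avgs W l (avg w i F).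
Proof.
elim: l => //= j l IH; rewrite inE negb_or => /andP[ij il].
by rewrite -IH // avgC.
Qed.

(** Two averages over the same coordinate with the same law are one operator, so [i] need not be
    fresh; this makes iterated averages invariant under permutation even when coordinates repeat. *)
Lemma avg_avgsC_same W l i F : avg (W i) i (avgs W l F) = avgs W l (avg (W i) i F).
Proof.
elim: l => //= j l IH; rewrite -IH.
by have [->|ij] := eqVneq i j => //; rewrite avgC.
Qed.

Lemma avgs_catC W l1 l2 F : avgs W (l1 ++ l2) F = avgs W (l2 ++ l1) F.
Proof.
elim: l1 => [|i l1 IH] /=; first by rewrite cats0.
by rewrite IH !avgs_cat /= avg_avgsC_same.
Qed.

Lemma avgs_perm W l1 l2 F : perm_eq l1 l2 -> avgs W l1 F = avgs W l2 F.
Proof.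
move=> p; pose P l := avgs W l F = avgs W l1 F.
suff: P l2 by move=> ->.
apply: (catCA_perm_ind _ p) => // s1 s2 s3; rewrite /P => <-.
by rewrite !catA (avgs_cat _ (s2 ++ s1)) (avgs_cat _ (s1 ++ s2)) avgs_catC.
Qed.

Lemma eq_avgs W W' l F : (forall i k, i \in l -> W i k = W' i k) ->
  avgs W l F = avgs W' l F.
Proof.
elim: l => //= i l IH h; rewrite IH; last by move=> j k jl; apply: h; rewrite inE jl orbT.
by apply/funext => s; apply: eq_bigr => k _; rewrite h // inE eqxx.
Qed.

Lemma avgs_inv W l F s : (forall i, is_law (W i)) ->
  (forall i k t, i \in l -> F (upd t i k) = F t) -> avgs W l F s = F s.
Proof.
move=> WL; elim: l s => //= i l IH s inv.
have -> : avgs W l F = F.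
  by apply/funext => t; apply: IH => j k u jl; apply: inv; rewrite inE jl orbT.
rewrite /avg (eq_bigr (fun k : 'I_m.+1 => W i k * F s)); last first.
  by move=> k _; rewrite inv // inE eqxx.
by rewrite -mulr_suml (WL i).2 mul1r.
Qed.

Lemma avgs_mono W l F : (forall i k, 0 <= W i k) -> monoF F -> monoF (avgs W l F).
Proof.
move=> W0 mF; elim: l => //= i l IH s t st.
by apply: ler_sum => k _; apply: ler_wpM2l => //; apply: IH; apply: cfgle_upd.
Qed.

Lemma avgs_ge_atom W l F (a : nat) s : (a <= m)%N -> (forall i k, 0 <= W i k) ->
  (forall s, 0 <= F s) ->
  (\prod_(i <- l) W i a) * F (setl s l a) <= avgs W l F s.
Proof.
move=> am W0 F0; elim: l s => [|i l IH] s /=.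
  by rewrite big_nil mul1r (_ : setl s [::] a = s) //.
rewrite big_cons -mulrA; have am' : (a < m.+1)%N by [].
have p0 k : 0 <= W i k * avgs W l F (upd s i k).
  apply: mulr_ge0 => //; have := avgs_le l (upd s i k) W0 F0.
  by apply: le_trans; elim: l (upd s i k) {IH} => //= j l IH t; apply: sumr_ge0 => ? _; rewrite mulr_ge0.
rewrite /avg (bigD1 (Ordinal am')) //=; apply: ler_wpDr; first exact: sumr_ge0.
by apply: ler_wpM2l => //; rewrite -setl_cons.
Qed.

Lemma avgs_ge0 W l F s : (forall i k, 0 <= W i k) ->
  (forall s, 0 <= F s) -> 0 <= avgs W l F s.
Proof.
move=> W0 F0; elim: l s => //= i l IH s.
by apply: sumr_ge0 => ? _; rewrite mulr_ge0.
Qed.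

Lemma avgs_le1 W l F s : (forall i, is_law (W i)) ->
  (forall s, F s <= 1) -> avgs W l F s <= 1.
Proof.
move=> WL F1; rewrite -(avgs_const l 1 s WL); apply: avgs_le => // i k.
exact: (WL i).1.
Qed.

(* The Markov kernel that keeps a coordinate with weight [r] and resamples it
   otherwise; it transports [w] to [w'] when [u = w' - r * w]. *)
Definition resample (r : R) (u : nat -> R) i F s := r * F s + avg u i F s.
Fixpoint resamples r U l F : (I -> nat) -> R :=
  if l is i :: l' then resample r (U i) i (resamples r U l' F) else F.

Lemma resample_avgsC r u W l i F : i \notin l ->
  resample r u i (avgs W l F) = avgs W l (resample r u i F).
Proof.
move=> il; apply/funext => s; rewrite /resample avg_avgsC //.
by rewrite avgsD avgsZ.
Qed.

Lemma avg_resample (r : R) (w w' : nat -> R) i F : \sum_(k < m.+1) w k = 1 ->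
  avg w i (resample r (fun k => w' k - r * w k) i F) = avg w' i F.
Proof.
move=> w1; apply/funext => s.
rewrite [LHS](_ : _ = r * avg w i F s + avg (fun k => w' k - r * w k) i F s).
  by rewrite /avg mulr_sumr -big_split; apply: eq_bigr => k _ /=; ring.
rewrite {1}/avg /resample.
rewrite (eq_bigr (fun k : 'I_m.+1 => r * (w k * F (upd s i k)) +
  w k * avg (fun k => w' k - r * w k) i F s)); last first.
  move=> k _; rewrite mulrDr mulrCA; congr (_ + w k * _).
  by apply: eq_bigr => k' _; rewrite upd_upd.
by rewrite big_split /= -mulr_suml w1 mul1r -mulr_sumr.
Qed.

Lemma avgs_resamples r W W' l F : uniq l -> (forall i, is_law (W i)) ->
  avgs W l (resamples r (fun i k => W' i k - r * W i k) l F) = avgs W' l F.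
Proof.
move=> + WL; elim: l => //= i l IH /andP[il ul].
by rewrite -resample_avgsC // avg_resample ?IH //; exact: (WL i).2.
Qed.

Lemma resamples_mono r U l F : 0 <= r -> (forall i k, i \in l -> 0 <= U i k) ->
  monoF F -> monoF (resamples r U l F).
Proof.
move=> r0 + mF; elim: l => //= i l IH U0 s t st.
have mI : monoF (resamples r U l F).
  by apply: IH => j k jl; apply: U0; rewrite inE jl orbT.
apply: lerD; first by apply: ler_wpM2l => //; apply: mI.
apply: ler_sum => k _; apply: ler_wpM2l; first by apply: U0; rewrite inE eqxx.
by apply: mI; apply: cfgle_upd.
Qed.

(** A coordinate of [S] has to be kept, at the price of a factor [r]. Any other one costs nothing:
    kept or resampled, with total weight 1, it does no worse than the value 0, by monotonicity. *)
Lemma resamples_ge_keep r U l F (S : pred I) s : 0 <= r <= 1 ->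
  (forall i k, i \in l -> 0 <= U i k) -> (forall i, i \in l -> \sum_(k < m.+1) U i k = 1 - r) ->
  monoF F -> (forall s, 0 <= F s) ->
  r ^+ count S l * F (setl s [seq i <- l | ~~ S i] 0%N) <= resamples r U l F s.
Proof.
move=> /andP[r0 r1] + + mF F0; elim: l s => [|i l IH] s U0 U1 /=.
  by rewrite expr0 mul1r (_ : setl s [::] 0%N = s).
have U0' j k : j \in l -> 0 <= U j k by move=> jl; apply: U0; rewrite inE jl orbT.
have U1' j : j \in l -> \sum_(k < m.+1) U j k = 1 - r by move=> jl; apply: U1; rewrite inE jl orbT.
have Ui k : 0 <= U i k by apply: U0; rewrite inE eqxx.
have mI : monoF (resamples r U l F) by apply: resamples_mono.
rewrite /resample; case: (boolP (S i)) => Si /=.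
  rewrite exprS -mulrA; apply: ler_wpDr; last by apply: ler_wpM2l => //; apply: IH.
  apply: sumr_ge0 => k _; rewrite mulr_ge0 //.
  apply: le_trans (IH _ U0' U1'); rewrite mulr_ge0 ?exprn_ge0 //.
rewrite add0n -setl_cons; apply: le_trans (IH _ U0' U1') _.
have -> : resamples r U l F (upd s i 0%N) =
    r * resamples r U l F (upd s i 0%N) + (1 - r) * resamples r U l F (upd s i 0%N) by ring.
apply: lerD; first by apply: ler_wpM2l => //; apply: mI; exact: cfgle_upd0.
rewrite -(U1 i) ?inE ?eqxx // mulr_suml; apply: ler_sum => k _.
by apply: ler_wpM2l => //; apply: mI; apply: cfgle_upd => //; exact: cfgle_refl.
Qed.

(** Keeping only the coordinates of a witness costs [r ^+ n] whatever the length of [l]: the number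
    of cells in a block grows as the mesh shrinks, the size of a witness does not. *)
Lemma avgs_thin r n W W' l F : uniq l -> 0 <= r <= 1 -> (forall i, is_law (W i)) ->
  (forall i, is_law (W' i)) -> (forall i k, i \in l -> r * W i k <= W' i k) ->
  monoF F -> (forall s, F s = 0 \/ F s = 1) ->
  (forall s, F s = 1 -> exists S : seq I, (size S <= n)%N /\
     F (setl s [seq i <- l | i \notin S] 0%N) = 1) ->
  forall s, r ^+ n * avgs W l F s <= avgs W' l F s.
Proof.
move=> ul r01 WL WL' rW mF F01 wit s.
have [r0 r1] := andP r01.
have F0 t : 0 <= F t by case: (F01 t) => ->.
rewrite -(avgs_resamples r W' F ul WL) -avgsZ.
apply: avgs_le => [i k|t]; first exact: (WL i).1.
have U0 i k : i \in l -> 0 <= W' i k - r * W i k by move=> il; rewrite subr_ge0 rW.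
have U1 i : i \in l -> \sum_(k < m.+1) (W' i k - r * W i k) = 1 - r.
  by move=> _; rewrite sumrB -mulr_sumr (WL i).2 (WL' i).2 mulr1.
have H P := resamples_ge_keep P t r01 U0 U1 mF F0.
case: (F01 t) => Ft.
  rewrite Ft mulr0; apply: le_trans (H predT); rewrite mulr_ge0 ?exprn_ge0 //.
have [S [Sn FS]] := wit _ Ft.
apply: le_trans (H (mem S)); rewrite Ft FS !mulr1.
apply: ler_wiXn2l => //; rewrite -size_filter; apply: leq_trans Sn.
apply: uniq_leq_size; first exact: filter_uniq.
by move=> x; rewrite mem_filter => /andP[].
Qed.

Lemma setl_ge_iter F l s : (forall s i, i \in l -> F s <= F (upd s i 1%N)) ->
  F s <= F (setl s l 1%N).
Proof.
elim: l s => [|i l IH] s h; first by rewrite (_ : setl s [::] 1%N = s).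
rewrite -setl_cons; apply: le_trans (IH _ _).
  by apply: h; rewrite inE eqxx.
by move=> t j jl; apply: h; rewrite inE jl orbT.
Qed.

(** With probability [d ^+ size l] every coordinate is reset to 1, and no other outcome lowers [F].
    The last hypothesis is not an instance of monotonicity, as a reset to 1 may lower a coordinate;
    it holds for bits because only their positivity matters. *)
Lemma resamples_ge_atom d U l F s : 0 <= d <= 1 -> (0 < m)%N ->
  (forall i k, i \in l -> U i k = d * (k == 1%N)%:R) ->
  (forall s i, i \in l -> F s <= F (upd s i 1%N)) ->
  (1 - d ^+ size l) * F s + d ^+ size l * F (setl s l 1%N) <= resamples (1 - d) U l F s.
Proof.
move=> /andP[d0 d1] m0; elim: l s => [|i l IH] s UE h /=.
  by rewrite expr0 subrr mul0r add0r mul1r (_ : setl s [::] 1%N = s).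
have UE' j k : j \in l -> U j k = d * (k == 1%N)%:R by move=> jl; apply: UE; rewrite inE jl orbT.
have h' t j : j \in l -> F t <= F (upd t j 1%N) by move=> jl; apply: h; rewrite inE jl orbT.
rewrite /resample /avg.
have m1 : (1 < m.+1)%N by [].
rewrite (bigD1 (Ordinal m1)) //= big1 ?addr0; last first.
  move=> k /eqP kn; rewrite UE ?inE ?eqxx // (_ : _ == _ = false) ?mulr0 ?mul0r //.
  by apply/eqP => k1; apply: kn; apply: val_inj.
rewrite UE ?inE ?eqxx // mulr1 exprS.
have H1 := IH s UE' h'; have H2 := IH (upd s i 1%N) UE' h'.
have Fs1 : F s <= F (upd s i 1%N) by apply: h; rewrite inE eqxx.
have Fs2 := setl_ge_iter s h'.
rewrite setl_cons in H2.
set e := d ^+ size l in H1 H2 *.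
have e0 : 0 <= e by rewrite exprn_ge0.
have e1 : e <= 1 by rewrite exprn_ile1.
set X := resamples _ _ _ _ s in H1 *; set Y := resamples _ _ _ _ _ in H2 *.
set F1 := F (setl s l 1%N) in H1 Fs2; set F2 := F (setl s _ 1%N) in H2 *.
set F3 := F (upd _ _ _) in H2 Fs1.
have H3 : F s <= X.
  by apply: le_trans H1; have := ler_wpM2l e0 Fs2; lra.
have H4 : (1 - e) * F s + e * F2 <= Y.
  have e1' : 0 <= 1 - e by rewrite subr_ge0.
  by apply: le_trans H2; have := ler_wpM2l e1' Fs1; lra.
have d1' : 0 <= 1 - d by rewrite subr_ge0.
have := lerD (ler_wpM2l d1' H3) (ler_wpM2l d0 H4).
by apply: le_trans; rewrite le_eqVlt; apply/orP; left; apply/eqP; ring.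
Qed.

Lemma avgs_bits d W W' l F s : uniq l -> 0 <= d <= 1 -> (0 < m)%N ->
  (forall i, is_law (W i)) ->
  (forall i k, i \in l -> W' i k = (1 - d) * W i k + d * (k == 1%N)%:R) ->
  (forall s i, i \in l -> F s <= F (upd s i 1%N)) -> monoF F ->
  avgs W l F s + d ^+ size l * (\prod_(i <- l) W i 0%N) *
    (F (setl s l 1%N) - F (setl s l 0%N)) <= avgs W' l F s.
Proof.
move=> ul d01 m0 WL W'E h mF; have [d0 d1] := andP d01.
have W0 i k : 0 <= W i k by exact: (WL i).1.
rewrite -(avgs_resamples (1 - d) W' F ul WL).
set e := d ^+ size l; have e0 : 0 <= e by rewrite exprn_ge0.
pose G t := F t + e * (F (setl t l 1%N) - F t).
have GE t : G t <= resamples (1 - d) (fun i k => W' i k - (1 - d) * W i k) l F t.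
  apply: le_trans (resamples_ge_atom t d01 m0 _ h).
    by rewrite /G -/e le_eqVlt; apply/orP; left; apply/eqP; ring.
  by move=> i k il; rewrite W'E //; ring.
apply: le_trans (avgs_le l s W0 GE).
rewrite avgsD avgsZ -mulrA; apply: lerD => //; apply: ler_wpM2l => //.
have := @avgs_ge_atom W l (fun t => F (setl t l 1%N) - F t) 0 s (leq0n _) W0.
rewrite (_ : setl (setl s l 0%N) l 1%N = setl s l 1%N); last first.
  by apply/funext => x; rewrite /setl; case: (x \in l).
by apply => t; rewrite subr_ge0; apply: setl_ge_iter.
Qed.
End Averages.

(** * Comparison of two product laws on one block *)

Section OneStep.
Variables (R : realType) (I : eqType) (m : nat).
Implicit Types (s t : I -> nat) (F G : (I -> nat) -> R) (W U : I -> nat -> R).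
Implicit Types (l : seq I) (i j : I).
Local Notation avgs := (avgs m).

(** The condition on [t] says that it agrees with [s] off [l], as every configuration met by the
    iterated average does. *)
Lemma avgs_le_on W l F G s : (forall i k, 0 <= W i k) ->
  (forall t, setl t l 0%N = setl s l 0%N -> F t <= G t) ->
  avgs W l F s <= avgs W l G s.
Proof.
move=> W0; elim: l s => [|i l IH] s h /=; first exact: h.
apply: avg_le => // k; apply: IH => t tE; apply: h.
rewrite -!setl_cons; apply/funext => x.
have := congr1 (fun f => f x) tE; rewrite /setl /upd.
by case: (x \in l) => //; case: eqP.
Qed.

Lemma avgs_upd W l F s i a : i \notin l ->
  avgs W l F (upd s i a) = avgs W l (fun t => F (upd t i a)) s.
Proof.
elim: l s => [|j l IH] s //=; rewrite inE negb_or => /andP[ij il].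
by apply: eq_bigr => k _; rewrite updC // IH.
Qed.

Lemma avgs_setl W l l' F s a : (forall i, i \in l -> i \notin l') ->
  avgs W l F (setl s l' a) = avgs W l (fun t => F (setl t l' a)) s.
Proof.
elim: l s => [|j l IH] s //= d.
have jl : j \notin l' by apply: d; rewrite inE eqxx.
apply: eq_bigr => k _; rewrite -setl_updC // IH // => i il.
by apply: d; rewrite inE il orbT.
Qed.

Lemma avgs_ge_zero W l F s : (forall i, is_law m (W i)) -> monoF F ->
  F (setl s l 0%N) <= avgs W l F s.
Proof.
move=> WL mF; elim: l s => [|i l IH] s /=; first by rewrite (_ : setl s [::] _ = s).
rewrite -[X in X <= _](avg_const i _ s (WL i)); apply: avg_le; first exact: (WL i).1.
move=> k; apply: le_trans (IH _); apply: mF => x.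
by rewrite /setl /upd inE; case: (x == i); case: (x \in l).
Qed.

(* If the event holds with an empty block [lx] and all bits of [lb] off, it is
   certain.  If it holds with an empty block and all bits on, then turning the
   bits on gains a fixed probability, which beats the loss [1 - r ^+ n].
   Otherwise, by the hypothesis relating [setl s lb 0] and [setl s lb 1], some bit
   is needed whatever the block, so that turning the bits on gains a fixed
   proportion of the probability, and the loss is at most a factor [r ^+ n]. *)
Theorem one_step (A : (I -> nat) -> bool) W W' lx lb (n : nat) (r d ka mu0 : R) s :
  (0 < m)%N -> uniq lx -> uniq lb -> (forall i, i \in lx -> i \notin lb) ->
  (forall i, is_law m (W i)) -> (forall i, is_law m (W' i)) ->
  0 <= r <= 1 -> 0 <= d <= 1 ->
  (forall i k, i \in lx -> r * W i k <= W' i k) ->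
  (forall i k, i \in lb -> W' i k = (1 - d) * W i k + d * (k == 1%N)%:R) ->
  (forall s t, cfgle s t -> A s -> A t) ->
  (forall s i, i \in lb -> A s -> A (upd s i 1%N)) ->
  (forall s, A s -> exists S : seq I, (size S <= n)%N /\
     A (setl s [seq i <- lx | i \notin S] 0%N)) ->
  (forall s, A (setl s lb 0%N) -> A (setl (setl s lx 0%N) lb 1%N)) ->
  0 <= ka <= \prod_(i <- lb) W i 0%N -> 0 <= mu0 <= \prod_(i <- lx) W' i 0%N ->
  1 - d ^+ size lb * ka * mu0 / 2 <= r ^+ n ->
  avgs W (lb ++ lx) (fun s => (A s)%:R) s <= avgs W' (lb ++ lx) (fun s => (A s)%:R) s.
Proof.
move=> m0 ux ub dis WL WL' r01 d01 rW W'E mA bA wit PA kaP muP hr.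
rewrite !avgs_cat; set F := fun s => _.
have W0 i k : 0 <= W i k by exact: (WL i).1.
have W0' i k : 0 <= W' i k by exact: (WL' i).1.
have F01 t : 0 <= F t <= 1 by rewrite /F; case: (A t); rewrite ?lexx ?ler01.
have F0 t : 0 <= F t by case/andP: (F01 t).
have F1 t : F t <= 1 by case/andP: (F01 t).
have mF : monoF F.
  move=> t u tu; rewrite /F; have := mA _ _ tu.
  by case: (A t) => [->//|_]; case: (A u).
have bF t i : i \in lb -> F t <= F (upd t i 1%N).
  by move=> il; rewrite /F; have := bA t _ il; case: (A t) => [->//|_]; case: (A _).
have [r0 r1] := andP r01; have [d0 d1] := andP d01.
have thin t : r ^+ n * avgs W lx F t <= avgs W' lx F t.
  apply: avgs_thin => //.
    by move=> u; rewrite /F; case: (A u); [right|left].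
  move=> u; rewrite /F; case Au: (A u) => Fu; last by move/eqP: Fu; rewrite eq_sym oner_eq0.
  by have [S [Sn AS]] := wit _ Au; exists S; rewrite AS.
set G' := avgs W' lx F; set G := avgs W lx F in thin *.
have mG' : monoF G' by apply: avgs_mono.
have bG' t i : i \in lb -> G' t <= G' (upd t i 1%N).
  move=> il; rewrite /G' avgs_upd; last by apply/negP => /dis; rewrite il.
  by apply: avgs_le => // u; exact: bF.
have dis' i : i \in lb -> i \notin lx by move=> il; apply/negP => /dis; rewrite il.
have new := avgs_bits s ub d01 m0 WL W'E bG' mG'.
have G01 a : 0 <= G' (setl s lb a) <= 1.
  by rewrite avgs_ge0 //= avgs_le1.
have X01 : 0 <= avgs W lb G s <= 1.
  rewrite avgs_ge0 //=; last by move=> t; apply: avgs_ge0.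
  by apply: avgs_le1 => // t; apply: avgs_le1.
have XX' : r ^+ n * avgs W lb G s <= avgs W lb G' s.
  by rewrite -avgsZ; apply: avgs_le.
have [ka0 kaW] := andP kaP; have [mu00 muW] := andP muP.
have prod1 (V : I -> nat -> R) l : (forall i, is_law m (V i)) -> 0 <= \prod_(i <- l) V i 0%N <= 1.
  move=> VL; apply/andP; split; first by apply: prodr_ge0 => i _; exact: (VL i).1.
  elim: l => [|i l IH]; first by rewrite big_nil.
  rewrite big_cons -[leRHS]mulr1; apply: ler_pM => //; first exact: (VL i).1.
    by apply: prodr_ge0 => j _; exact: (VL j).1.
  rewrite -(VL i).2 (bigD1 ord0) //=; apply: ler_wpDr => //.
  by apply: sumr_ge0 => k _; exact: (VL i).1.
set e := d ^+ size lb in new hr.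
have e0 : 0 <= e by rewrite exprn_ge0.
have e1 : e <= 1 by rewrite exprn_ile1.
have [k0 k1] := andP (prod1 W lb WL).
have [u0 u1] := andP (prod1 W' lx WL').
have [X0 X1] := andP X01.
set kb := \prod_(i <- lb) _ in new kaW k0 k1.
set mb := \prod_(i <- lx) _ in muW u0 u1.
set X := avgs W lb G s in XX' X0 X1 *; set X' := avgs W lb G' s in new XX'.
have eka : e * ka <= e * kb by apply: ler_wpM2l.
have eka0 : 0 <= e * ka by apply: mulr_ge0.
have eka1 : e * ka <= 1.
  by apply: le_trans eka _; rewrite -[leRHS]mulr1; apply: ler_pM.
have mu01 : mu0 <= 1 by apply: le_trans muW u1.
have [hA|hA] := boolP (A (setl (setl s lx 0%N) lb 0%N)).
  apply: (le_trans X1); apply: le_trans (avgs_ge_zero lb s WL' mG').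
  rewrite /G' avgs_setl //; apply: le_trans (avgs_ge_zero lx s WL' _).
    by rewrite /F hA.
  by move=> t u tu; apply: mF; apply: cfgle_setl.
have [hB|hB] := boolP (A (setl (setl s lx 0%N) lb 1%N)).
  have G1 : 1 <= G' (setl s lb 1%N).
    rewrite /G' avgs_setl //; apply: le_trans (avgs_ge_zero lx s WL' _).
      by rewrite /F hB.
    by move=> t u tu; apply: mF; apply: cfgle_setl.
  have G0 : G' (setl s lb 0%N) <= 1 - mb.
    rewrite /G' avgs_setl //.
    have := @avgs_ge_atom R I m W' lx (fun t => 1 - F (setl t lb 0%N)) 0 s (leq0n _) W0'.
    rewrite avgsB avgs_const // {2}/F (negbTE hA) subr0 mulr1.
    move=> H; have : mb <= 1 - avgs W' lx (fun t => F (setl t lb 0%N)) s.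
      by apply: H => t; rewrite subr_ge0.
    by lra.
  apply: le_trans new.
  have h1 : e * ka * mu0 <= e * kb * (G' (setl s lb 1%N) - G' (setl s lb 0%N)).
    by apply: ler_pM => //; lra.
  have h2 : (1 - r ^+ n) * X <= e * ka * mu0 / 2.
    apply: (@le_trans _ _ ((e * ka * mu0 / 2) * 1)); last by rewrite mulr1.
    apply: ler_pM => //; last by lra.
    by rewrite subr_ge0 exprn_ile1.
  have h3 : 0 <= e * ka * mu0 by apply: mulr_ge0.
  by lra.
(* Last case: by [PA], no filling of the block makes [A] hold with the bits off. *)
have G0 : G' (setl s lb 0%N) <= 0.
  rewrite /G' avgs_setl //.
  rewrite -(avgs_const lx 0 s WL'); apply: avgs_le_on => // t tE.
  rewrite /F; case: (boolP (A _)) => // /PA; rewrite tE => hB'.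
  by rewrite hB' in hB.
have G1 : X' <= G' (setl s lb 1%N).
  apply: (@le_trans _ _ (avgs W lb (fun t => G' (setl t lb 1%N)) s)).
    by apply: avgs_le => // t; apply: setl_ge_iter.
  rewrite avgs_inv // => i k t il /=; by rewrite setl_upd.
apply: le_trans new.
have X'0 : 0 <= X' by apply: avgs_ge0 => // t; apply: avgs_ge0.
have h1 : e * ka * X' <= e * kb * (G' (setl s lb 1%N) - G' (setl s lb 0%N)).
  by apply: ler_pM => //; lra.
have h2 : (1 - e * ka * mu0 / 2) * X <= X'.
  by apply: le_trans XX'; apply: ler_wpM2r.
set b := e * ka in eka eka0 eka1 h1 h2.
have h3 : b * mu0 <= b by rewrite -[leRHS]mulr1; apply: ler_wpM2l.
have h4 : (1 - b / 2) * X <= X'.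
  by apply: le_trans h2; apply: ler_wpM2r => //; lra.
(* [(1 + b) * (1 - b / 2) = 1 + b * (1 - b) / 2], which is at least 1 since [b <= 1]. The division
   by 2 in the hypothesis on [r] leaves this room. *)
have h5 : X <= (1 + b) * X'.
  apply: (@le_trans _ _ ((1 + b) * ((1 - b / 2) * X))); last by apply: ler_wpM2l => //; lra.
  rewrite mulrA -[leLHS]mul1r; apply: ler_wpM2r => //.
  by have := mulr_ge0 eka0 (_ : 0 <= 1 - b); rewrite subr_ge0 => /(_ eka1); lra.
by lra.
Qed.

End OneStep.

(** * Linked tuples of cells *)

Section Perc.
Variables (T K : eqType) (d : nat) (coarse : T -> K).
Variables (nr : T -> T -> Prop) (NR : K -> K -> Prop).
Local Notation I := (T + K)%type.
Implicit Types (s t : I -> nat) (c : 'I_d.+1 -> T) (C : K).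

(* A configuration [s] gives the number [s (inl z)] of points of a cell [z],
   truncated at [d.+1], and the bit [s (inr C)] of a coarse cell [C].  Cells are
   related by [nr], and coarse cells by [NR], when they contain points at distance
   at most 1.  A simplex is represented by the cells of its vertices. *)
Definition valid s c := (forall i j, nr (c i) (c j)) /\
  forall z, (#|[set i | c i == z]%SET| <= s (inl z))%N.
Definition touch c C := exists i, coarse (c i) = C.
Definition near c C := exists i, NR (coarse (c i)) C.
(** Sharing a vertex is relaxed to sharing a coarse cell, which allows shortcuts inside a coarse
    cell and still keeps linked simplices close. *)
Definition link s c c' := (exists C, touch c C /\ touch c' C) \/
  exists C, (0 < s (inr C))%N /\ near c C /\ near c' C.

Inductive reach s (z0 : K) : ('I_d.+1 -> T) -> Prop :=
| reach_start c : valid s c -> touch c z0 -> reach s z0 c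
| reach_step c c' : reach s z0 c -> valid s c' -> link s c c' -> reach s z0 c'.

Definition perc (far : T -> Prop) z0 s := exists c, reach s z0 c /\ exists i, far (c i).

Lemma valid_mono s t c : cfgle s t -> valid s c -> valid t c.
Proof. by move=> st [h1 h2]; split=> // z; apply: leq_trans (h2 z) (st _). Qed.

Lemma link_mono s t c c' : cfgle s t -> link s c c' -> link t c c'.
Proof.
move=> st [h|[C [h1 h2]]]; [by left|right; exists C; split => //].
exact: leq_trans h1 (st _).
Qed.

Lemma reach_mono s t z0 c : cfgle s t -> reach s z0 c -> reach t z0 c.
Proof.
move=> st; elim=> [c' v h|c1 c2 _ IH v h]; first by apply: reach_start => //; exact: valid_mono v.
by apply: reach_step IH _ _; [exact: valid_mono v|exact: link_mono h].
Qed.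

Lemma reach_valid s z0 c : reach s z0 c -> valid s c.
Proof. by case. Qed.

Lemma perc_mono far z0 s t : cfgle s t -> perc far z0 s -> perc far z0 t.
Proof. by move=> st [c [rc h]]; exists c; split => //; exact: reach_mono rc. Qed.

Variable subcells : K -> seq T.
Hypothesis subcellsP : forall z C, (z \in subcells C) = (coarse z == C).

Definition keep s C (S : seq I) := setl s [seq i <- map inl (subcells C) | i \notin S] 0%N.
Definition cells_of c : seq I := [seq inl (c i) | i <- enum 'I_d.+1].

Lemma keepE s C S i : keep s C S i =
  if [&& i \notin S, i \in [seq inl z | z <- subcells C] & true] then 0%N else s i.
Proof. by rewrite /keep /setl mem_filter andbT. Qed.

Lemma keep_inr s C S b : keep s C S (inr b) = s (inr b).
Proof. by rewrite keepE; case: ifP => // /and3P[_ /mapP[z _ //]]. Qed.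

Lemma inl_inj : injective (@inl T K). Proof. by move=> x y []. Qed.

Lemma keep_valid s C S c : valid s c ->
  (forall i, coarse (c i) = C -> inl (c i) \in S) -> valid (keep s C S) c.
Proof.
move=> [h1 h2] hS; split => // z; rewrite keepE; case: ifP => //.
case/and3P => zS; rewrite (mem_map inl_inj) subcellsP => /eqP zC _.
rewrite leqn0 cards_eq0; apply/eqP/setP => i; rewrite !inE.
by apply/eqP => cz; move: zS; rewrite -cz hS // cz.
Qed.

Lemma keep_mono s C S S' : {subset S <= S'} -> cfgle (keep s C S) (keep s C S').
Proof.
move=> SS i; rewrite !keepE; case: (boolP (i \in S)) => [/SS ->|_] //=.
by case: (i \in S'); case: (i \in _).
Qed.

Lemma keep_link s C S c c' : link s c c' -> link (keep s C S) c c'.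
Proof. by case=> [|[b h]]; [left|right; exists b; rewrite keep_inr]. Qed.

Lemma cells_ofP c i : inl (c i) \in cells_of c.
Proof. by apply/mapP; exists i; rewrite ?mem_enum. Qed.

Lemma size_cells_of c : size (cells_of c) = d.+1.
Proof. by rewrite size_map size_enum_ord. Qed.

(* Along a chain of linked tuples, the first and the last tuple touching [C]
   are linked directly because they share [C]; hence at most two tuples
   touching [C] are needed. *)
Lemma reach_keep s z0 C c : reach s z0 c ->
  (~ touch c C /\ reach (keep s C [::]) z0 c) \/
  exists u, [/\ valid s u, touch u C, reach (keep s C (cells_of u)) z0 u &
    touch c C \/ exists w, reach (keep s C (cells_of u ++ cells_of w)) z0 c].
Proof.
have kv u : valid s u -> valid (keep s C (cells_of u)) u.
  by move=> vu; apply: keep_valid => // i _; exact: cells_ofP.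
have nv S u : valid s u -> ~ touch u C -> valid (keep s C S) u.
  by move=> vu nt; apply: keep_valid => // i ci; case: nt; exists i.
elim=> {c} [c vc tc|c c' rc IH vc' lk].
  have [tC|nC] := pselect (touch c C).
    by right; exists c; split => //; [apply: reach_start => //; exact: kv|left].
  by left; split => //; apply: reach_start => //; apply: nv.
(* A return to [C] forgets the exit [w] recorded so far: only the last exit counts. *)
have [tC'|nC'] := pselect (touch c' C).
  right; case: IH => [[nC r]|[u [vu tu ru _]]]; last by exists u; split => //; left.
  exists c'; split => //; last by left.
  apply: (@reach_step _ _ c); [|exact: kv|exact: keep_link].
  by apply: reach_mono r; apply: keep_mono.
case: IH => [[nC r]|[u [vu tu ru h]]].
  left; split => //; apply: (@reach_step _ _ c) => //; [exact: nv|exact: keep_link].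
right; exists u; split => //; right.
case: h => [tC|[w rw]]; last first.
  by exists w; apply: (@reach_step _ _ c) => //; [exact: nv|exact: keep_link].
exists c; apply: (@reach_step _ _ c); [|exact: nv|exact: keep_link].
apply: (@reach_step _ _ u).
- by apply: reach_mono ru; apply: keep_mono => x xu; rewrite mem_cat xu.
- apply: keep_valid => [|i _]; first exact: reach_valid rc.
  by rewrite mem_cat cells_ofP orbT.
- by left; exists C.
Qed.

(** The witness consists of the cells of at most two tuples, each with [d.+1] entries. *)
Lemma perc_keep far z0 s C : perc far z0 s ->
  exists S : seq I, (size S <= 2 * d.+1)%N /\ perc far z0 (keep s C S).
Proof.
move=> [c [rc fc]]; have vc := reach_valid rc.
case: (reach_keep C rc) => [[_ r]|[u [vu tu ru [tc|[w r]]]]].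
- by exists [::]; split => //; exists c.
- exists (cells_of u ++ cells_of c); split.
    by rewrite size_cat !size_cells_of addnn mul2n.
  exists c; split => //; apply: (@reach_step _ _ u).
  + by apply: reach_mono ru; apply: keep_mono => x xu; rewrite mem_cat xu.
  + by apply: keep_valid => // i _; rewrite mem_cat cells_ofP orbT.
  + by left; exists C.
- exists (cells_of u ++ cells_of w); split; last by exists c.
  by rewrite size_cat !size_cells_of addnn mul2n.
Qed.

Hypothesis nrNR : forall z z', nr z z' -> NR (coarse z) (coarse z').
Variable ball : K -> seq K.
Hypothesis ballP : forall C Z C', NR C Z -> NR Z C' -> C' \in ball C.

Lemma touch_near s c C C' : valid s c -> touch c C -> touch c C' -> NR C C'.
Proof. by move=> [v _] [i <-] [j <-]; apply: nrNR. Qed.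

(** If [c] and [c'] share [Z], then [c'] touches both [Z] and [C], so [Z] is near [C]. A link
    through a bit [b] is impossible: [c'] is near [b], so [b] is two steps from [C], where all bits
    are off. *)
Lemma link_touch_near s c c' C : valid s c' -> (forall b, b \in ball C -> s (inr b) = 0%N) ->
  touch c' C -> link s c c' -> near c C.
Proof.
move=> vc' b0 tc' [[Z [[i iZ] tc'Z]]|[b [sb [_ [j jb]]]]].
  by exists i; rewrite iZ; apply: touch_near vc' tc'Z tc'.
have cb : b \in ball C.
  by apply: ballP jb; apply: touch_near vc' tc' _; exists j.
by rewrite b0 in sb.
Qed.

Lemma link_sym s c c' : link s c c' -> link s c' c.
Proof.
by case=> [[C [h1 h2]]|[C [h1 [h2 h3]]]]; [left; exists C|right; exists C].
Qed.

(* If [C] is emptied and turned into an active link, the last tuple before and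
   the first tuple after the passage through [C] become linked. *)
Lemma perc_bypass far z0 s s' C : ~ NR z0 C -> (forall z, far z -> ~ NR (coarse z) C) ->
  (forall b, b \in ball C -> s (inr b) = 0%N) -> (0 < s' (inr C))%N ->
  (forall b, (s (inr b) <= s' (inr b))%N) ->
  (forall z, coarse z <> C -> s' (inl z) = s (inl z)) ->
  perc far z0 s -> perc far z0 s'.
Proof.
move=> nz0 nfar b0 sC sb sT [c [rc [k fk]]].
have nv u : valid s u -> ~ touch u C -> valid s' u.
  move=> [h1 h2] nt; split => // z; have [/eqP zC|/eqP zC] := boolP (coarse z == C); last by rewrite sT.
  rewrite (_ : [set i | u i == z]%SET = finset.set0) ?cards0 //; apply/setP => i; rewrite !inE.
  by apply/eqP => uz; apply: nt; exists i; rewrite uz.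
have lk u v : link s u v -> link s' u v.
  by case=> [|[b [h1 h2]]]; [left|right; exists b; split => //; exact: leq_trans h1 (sb _)].
(* Invariant along the chain: while it is inside [C], all that is remembered is some tuple near [C]
   that is reached in [s']. *)
suff: (~ touch c C /\ reach s' z0 c) \/ (touch c C /\ exists u, reach s' z0 u /\ near u C).
  case=> [[_ r]|[tc _]]; first by exists c; split => //; exists k.
  case: (nfar _ fk); apply: (@touch_near s c) => //; first exact: reach_valid rc.
  by exists k.
elim: rc => {c fk} [c vc tc|c c' rc IH vc' l].
  have [tC|nC] := pselect (touch c C); first by case: nz0; apply: touch_near vc tc tC.
  by left; split => //; apply: reach_start => //; exact: nv.
have [tC|nC] := pselect (touch c' C).
  right; split => //; case: IH => [[nC r]|[_ //]].
  by exists c; split => //; apply: link_touch_near l.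
left; split => //; case: IH => [[nC' r]|[tC [u [ru nu]]]].
  by apply: reach_step r _ _; [exact: nv|exact: lk].
apply: reach_step ru _ _; first exact: nv.
right; exists C; split => //; split => //.
by apply: link_touch_near (link_sym l) => //; exact: reach_valid rc.
Qed.

Lemma perc_ext far z0 s s' : (forall z, s (inl z) = s' (inl z)) ->
  (forall b, (0 < s (inr b))%N -> (0 < s' (inr b))%N) -> perc far z0 s -> perc far z0 s'.
Proof.
move=> hT hb [c [rc fc]]; exists c; split => //; elim: rc => {c fc} [c [v1 v2] tc|c c' rc IH [v1 v2] l].
  by apply: reach_start => //; split => // z; rewrite -hT.
apply: reach_step IH _ _; first by split => // z; rewrite -hT.
by case: l => [|[b [h1 h2]]]; [left|right; exists b; split => //; exact: hb].
Qed.

Variable R : realType.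
Variables (m M : nat) (p p' : nat -> R) (mu0 r : R).
Hypothesis m0 : (0 < m)%N.
Hypothesis subcellsU : forall C, uniq (subcells C).
Hypothesis ballU : forall C, uniq (ball C).
Hypothesis ballC : forall C b, (b \in ball C) = (C \in ball b).
Hypothesis ballM : forall C, (size (ball C) <= M)%N.
Hypothesis ballN : forall C, C \in ball C.
Hypothesis pL : is_law m p.
Hypothesis p'L : is_law m p'.
Hypothesis rp : forall k, r * p k <= p' k.
Hypothesis r01 : 0 <= r <= 1.
Hypothesis mu0P : forall C, 0 <= mu0 <= p' 0%N ^+ size (subcells C).
Hypothesis hr : 1 - (1 / 2) ^+ M * (1 / 2) ^+ (M * M) * mu0 / 2 <= r ^+ (2 * d.+1).

Definition bit_law (q : R) (k : nat) : R :=
  match k with 0 => q | 1 => 1 - q | _ => 0 end.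

Lemma bit_law_law q : 0 <= q <= 1 -> is_law m (bit_law q).
Proof.
move=> /andP[q0 q1]; split; first by move=> [|[|k]] //=; lra.
move: m0; case: m => // n _; rewrite !big_ord_recl big1 => [|i _] //=; ring.
Qed.

(* The laws after the coarse cells of [Q] have been treated: the bit of [b] is
   turned on with probability 1/2 for every [C] in [Q] having [b] in its ball. *)
Definition stage (Q : seq K) (i : I) : nat -> R := match i with
  | inl z => if coarse z \in Q then p' else p
  | inr b => bit_law ((1 / 2) ^+ count (fun C => b \in ball C) Q) end.

Lemma half01 n : 0 <= (1 / 2 : R) ^+ n <= 1.
Proof. by rewrite exprn_ge0 //= exprn_ile1 //; lra. Qed.

Lemma stage_law Q i : is_law m (stage Q i).
Proof. by case: i => [z|b] /=; [case: ifP|apply: bit_law_law; exact: half01]. Qed.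

Definition coords (Q : seq K) : seq I -> Prop := fun l =>
  forall C, C \in Q -> {subset map inl (subcells C) <= l} /\ {subset map inr (ball C) <= l}.

(** Each induction step is [one_step] for the cells of [C] against the bits of its ball, the other
    coordinates being frozen. Coarse cells near [z0] or near a far cell are excluded, since a
    connection through them need not have a tuple both before and after the passage. *)
Theorem replace_law far z0 (Q : seq K) (l : seq I) s : uniq Q -> uniq l -> coords Q l ->
  (forall C, C \in Q -> ~ NR z0 C /\ forall z, far z -> ~ NR (coarse z) C) ->
  avgs m (stage [::]) l (fun s => `[< perc far z0 s >]%:R) s <=
  avgs m (stage Q) l (fun s => `[< perc far z0 s >]%:R) s.
Proof.
move=> + ul; elim: Q => // C Q IH /= /andP[CQ uQ] co good.
apply: le_trans (IH uQ _ _) _.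
- by move=> b bQ; apply: co; rewrite inE bQ orbT.
- by move=> b bQ; apply: good; rewrite inE bQ orbT.
have [co1 co2] := co C (mem_head _ _).
have [gz0 gfar] := good C (mem_head _ _).
pose lx : seq I := map inl (subcells C); pose lb : seq I := map inr (ball C).
have inr_inj : injective (@inr T K) by move=> x y [].
have ux : uniq lx by rewrite (map_inj_uniq inl_inj).
have ub : uniq lb by rewrite (map_inj_uniq inr_inj).
have dis i : i \in lx -> i \notin lb.
  by move=> /mapP[z _ ->]; apply/negP => /mapP[b].
have pl : perm_eq l ([seq i <- l | i \notin lb ++ lx] ++ (lb ++ lx)).
  apply: uniq_perm => //.
    rewrite cat_uniq filter_uniq //= cat_uniq ub ux /= andbT; apply/andP; split.
      by apply/hasPn => i il; rewrite mem_filter il.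
    by apply/hasPn => i /dis.
  move=> i; rewrite mem_cat mem_filter.
  case: (boolP (i \in lb ++ lx)) => //= [|_]; last by rewrite orbF.
  by rewrite mem_cat => /orP[/co2|/co1].
rewrite !(avgs_perm m _ _ pl) !(avgs_cat m _ [seq i <- l | _]).
set lo := [seq i <- l | _].
have -> : forall F, avgs m (stage Q) lo F = avgs m (stage (C :: Q)) lo F.
  move=> F; apply: eq_avgs => i k; rewrite mem_filter mem_cat negb_or => /andP[/andP[ib ix] _].
  case: i ib ix => [z|b] /= ib ix.
    rewrite inE; case: eqP => //= zC; case/negP: ix; apply/mapP; exists z => //.
    by rewrite subcellsP zC.
  rewrite (_ : b \in ball C = false) //; apply/negP => bC; case/negP: ib.
  by apply/mapP; exists b.
apply: avgs_le => [i k|t]; first exact: (stage_law _ _).1.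
have sz : size lb = size (ball C) by rewrite size_map.
(* The ball of [C] has at most [M] bits, and each of them lies in at most [M] balls, so it is off
   with probability at least [(1 / 2) ^+ M]. *)
pose ka : R := (1 / 2) ^+ (M * M).
apply: (@one_step R I m (fun s => `[< perc far z0 s >]) (stage Q) (stage (C :: Q))
  lx lb (2 * d.+1) r (1 / 2) ka mu0) => //.
- by move=> i; apply: stage_law.
- by move=> i; apply: stage_law.
- by lra.
- move=> i k /mapP[z]; rewrite subcellsP => /eqP zC -> /=.
  by rewrite zC (negbTE CQ) inE eqxx.
- move=> i k /mapP[b bC -> /=]; rewrite bC add1n exprS.
  by case: k => [|[|k]] /=; lra.
- by move=> u v uv /asboolP h; apply/asboolP; apply: perc_mono h.
- move=> u i /mapP[b _ ->] /asboolP h; apply/asboolP; apply: perc_ext h.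
    by move=> z; rewrite /upd.
  by move=> b' hb'; rewrite /upd; case: eqP.
- move=> u /asboolP /(@perc_keep _ _ _ C)[S [hS hp]]; exists S; split => //.
  exact/asboolP.
- move=> u /asboolP h; apply/asboolP; apply: (perc_bypass (C := C)) h => //.
  + by move=> b bC; rewrite /setl; case: ifPn => // /negP[]; apply/mapP; exists b.
  + by rewrite /setl; case: ifPn => // /negP[]; apply/mapP; exists C.
  + by move=> b; rewrite /setl; case: ifP => // _; case: ifP => // /mapP[].
  + move=> z zC; rewrite /setl.
    have -> : inl z \in lb = false by apply/negP => /mapP[].
    case: ifP => // /mapP[z']; rewrite subcellsP => /eqP z'C [zz]; by rewrite zz in zC.
- apply/andP; split; first by rewrite exprn_ge0 //; lra.
  rewrite big_map; apply: (@le_trans _ _ (\prod_(b <- ball C) (1 / 2) ^+ M)); last first.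
    apply: ler_prod => b _; rewrite exprn_ge0 /=; last by lra.
    apply: ler_wiXn2l; [by lra|by lra|].
    rewrite -size_filter; apply: leq_trans (ballM b); apply: uniq_leq_size.
      by rewrite filter_uniq.
    by move=> x; rewrite mem_filter -ballC => /andP[].
  rewrite big_const_seq iter_mulr_1 count_predT -exprM.
  apply: ler_wiXn2l; [by lra|by lra|].
  by rewrite leq_mul2l ballM orbT.
- rewrite big_map (eq_big_seq (fun=> p' 0%N)).
    by rewrite big_const_seq iter_mulr_1 count_predT; exact: mu0P.
  by move=> z; rewrite subcellsP => /eqP zC /=; rewrite zC inE eqxx.
- apply: le_trans hr; rewrite sz lerD2l lerN2 -!(mulrA (_ ^+ _ * _)) -!(mulrA (_ ^+ _)).
  apply: ler_wpM2r; last by apply: ler_wiXn2l; [lra|lra|exact: ballM].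
  have /andP[mu00 _] := mu0P C.
  have /andP[ka0 _] := half01 (M * M).
  by rewrite /ka !mulr_ge0 // invr_ge0.
Qed.

End Perc.

(** * Poisson counts *)

Section TruncatedCounts.
Local Open Scope card_scope.
Variables (T : Type) (m : nat).

(** Cardinality capped at [m]; the default value [m] also covers infinite sets. *)
Definition tcount (A : set T) : nat :=
  if [pick k : 'I_m | `[< A #= `I_k >]] is Some k then k else m.

Lemma tcount_le A : (tcount A <= m)%N.
Proof. by rewrite /tcount; case: pickP => // k _; exact: ltnW. Qed.

Lemma card_II_uniq (A : set T) j k : A #= `I_j -> A #= `I_k -> j = k.
Proof.
move=> Aj Ak; apply/card_eq_II.
by apply: card_eq_trans Ak; rewrite card_eq_sym.
Qed.

Lemma tcountP A k : (k < m)%N -> (tcount A = k) <-> (A #= `I_k).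
Proof.
move=> km; rewrite /tcount; case: pickP => [j /asboolP Aj|none].
  by split=> [<-//|Ak]; exact: card_II_uniq Aj Ak.
split=> [mk|Ak]; first by rewrite mk ltnn in km.
by have := none (Ordinal km); rewrite /= => /asboolP[].
Qed.
End TruncatedCounts.

Section JointLaw.
Variables (R : realType) (dsp : measure_display) (Omega : measurableType dsp).
Variables (P : probability Omega R) (Z I : eqType) (e : Z -> I) (m : nat).
Variables (N : Z -> Omega -> nat -> Prop) (cnt : Z -> Omega -> nat) (pr : nat -> R).
Hypothesis cntN : forall z om k, (k < m)%N -> cnt z om = k <-> N z om k.
Hypothesis cnt_le : forall z om, (cnt z om <= m)%N.
Hypothesis NP : forall (l : seq Z) (f : Z -> nat), uniq l ->
  measurable [set om | forall z, z \in l -> N z om (f z)] /\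
  P [set om | forall z, z \in l -> N z om (f z)] = (\prod_(z <- l) pr (f z))%:E.

Fixpoint observe (l : seq Z) om (s : I -> nat) : I -> nat :=
  if l is z :: l' then observe l' om (upd s (e z) (cnt z om)) else s.

Definition trunc_law k : R :=
  if (k < m)%N then pr k else if k == m then 1 - \sum_(j < m) pr j else 0.

(** Only events prescribing exact counts have a given probability. The induction therefore carries a
    list [l1] of cells with prescribed counts and moves the cells of [l] into it one by one; the
    capped value [m], which is no such event, is treated by complement. *)
Lemma joint_law (W : I -> nat -> R) (l1 l : seq Z) f s (B : (I -> nat) -> bool) :
  (forall z k, W (e z) k = trunc_law k) -> uniq (l1 ++ l) ->
  let E := [set om | (forall z, z \in l1 -> N z om (f z)) /\ B (observe l om s)] in
  measurable E /\ P E = (\prod_(z <- l1) pr (f z) *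
    avgs m W (map e l) (fun s => (B s)%:R) s)%:E.
Proof.
move=> WE; elim: l l1 f s => [|z l IH] l1 f s /=.
  rewrite cats0 => u1; have [mE PE] := NP f u1.
  case: (B s); last first.
    rewrite (_ : mkset _ = set0) ?mulr0 ?measure0 //; apply/seteqP; split => om //= [_ //].
  rewrite mulr1 (_ : [set om | _ /\ true] = [set om | forall z, z \in l1 -> N z om (f z)]) //.
  by apply/seteqP; split => om /=; [case|].
move=> ul.
have ulz : uniq ((z :: l1) ++ l) by have := ul; rewrite (uniq_catCA l1 [:: z] l).
have [zl1 ul1] : z \notin l1 /\ uniq (l1 ++ l).
  by move: ulz; rewrite /= mem_cat negb_or => /andP[/andP[-> _] ->].
pose fk k := upd f z k.
pose Ex k := [set om | forall y, y \in z :: l1 -> N y om (fk k y)].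
pose E k := [set om | (forall y, y \in z :: l1 -> N y om (fk k y)) /\
  B (observe l om (upd s (e z) k))].
pose F k := [set om | (forall y, y \in z :: l1 -> N y om (fk k y)) /\
  B (observe l om (upd s (e z) m))].
pose F0 := [set om | (forall y, y \in l1 -> N y om (f y)) /\
  B (observe l om (upd s (e z) m))].
have prod k : \prod_(y <- z :: l1) pr (fk k y) = pr k * \prod_(y <- l1) pr (f y).
  rewrite big_cons /fk {1}/upd eqxx; congr (_ * _); apply: eq_big_seq => y yl.
  by rewrite /upd; case: eqP => // yz; rewrite -yz yl in zl1.
have hE k : measurable (E k) /\ P (E k) = _ := IH (z :: l1) (fk k) (upd s (e z) k) ulz.
have hF k : measurable (F k) /\ P (F k) = _ := IH (z :: l1) (fk k) (upd s (e z) m) ulz.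
have [mF0 PF0] : measurable F0 /\ P F0 = _ := IH l1 f (upd s (e z) m) ul1.
have exk k om : (k < m)%N -> (forall y, y \in z :: l1 -> N y om (fk k y)) <->
    cnt z om = k /\ (forall y, y \in l1 -> N y om (f y)).
  move=> km; split=> [h|[/cntN -/(_ km) h1 h2] y].
    split; first by apply/cntN => //; have := h z (mem_head _ _); rewrite /fk /upd eqxx.
    move=> y yl; have := h y; rewrite inE yl orbT /fk /upd => /(_ isT).
    by case: eqP => // yz; rewrite -yz yl in zl1.
  rewrite inE /fk /upd; case: eqP => [->|_] //=; exact: h2.
have -> : [set om | (forall y, y \in l1 -> N y om (f y)) /\
    B (observe l om (upd s (e z) (cnt z om)))] =
    \big[setU/set0]_(k < m) E k `|` (F0 `\` \big[setU/set0]_(k < m) F k).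
  rewrite -!(bigcup_mkord m); apply/seteqP; split => om /=.
    move=> [h1 h2]; have [cm|cm] := ltnP (cnt z om) m.
      by left; exists (cnt z om) => //; split => //; apply/exk.
    have cE : cnt z om = m by apply/eqP; rewrite eqn_leq cnt_le cm.
    right; rewrite cE in h2; split => // -[k /= km [/exk -/(_ km)[ck _] _]].
    by rewrite cE in ck; rewrite ck ltnn in km.
  case=> [[k /= km [/exk -/(_ km)[ck h1] h2]]|[[h1 h2] h3]]; first by rewrite ck.
  split => //; have [cm|cm] := ltnP (cnt z om) m.
    by case: h3; exists (cnt z om) => //; split => //; apply/exk.
  by have -> : cnt z om = m by apply/eqP; rewrite eqn_leq cnt_le cm.
have mE : measurable (\big[setU/set0]_(k < m) E k).
  by apply: bigsetU_measurable => k _; exact: (hE k).1.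
have mF : measurable (\big[setU/set0]_(k < m) F k).
  by apply: bigsetU_measurable => k _; exact: (hF k).1.
split; first by apply: measurableU => //; exact: measurableD.
rewrite measureU //; [|exact: measurableD|]; last first.
  rewrite -!(bigcup_mkord m); apply/seteqP; split => om //= -[[k /= km [/exk -/(_ km)[ck h1] h2]] [h3 h4]].
  apply: h4; exists k => //; split; first exact/exk.
  by case: h3.
rewrite measureD //; last by rewrite (le_lt_trans (probability_le1 _ _)) // ltry.
rewrite (_ : F0 `&` _ = \big[setU/set0]_(k < m) F k); last first.
  rewrite setIC; apply/setIidl; rewrite -(bigcup_mkord m) => om /= [k /= km [/exk -/(_ km)[ck h1] h2]].
  by split.
have tr (G : nat -> set Omega) : (forall k om, (k < m)%N -> G k om -> cnt z om = k) -> trivIset `I_m G.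
  by move=> h j k /= jm km [om [Gj Gk]]; rewrite -(h _ _ jm Gj) -(h _ _ km Gk).
pose Q0 := \prod_(y <- l1) pr (f y); pose G k := avgs m W (map e l) (fun s => (B s)%:R) (upd s (e z) k).
have PEs : P (\big[setU/set0]_(k < m) E k) = (\sum_(k < m) pr k * Q0 * G k)%:E.
  transitivity (\sum_(k < m) P (E k))%E; last by rewrite -sumEFin; apply: eq_bigr => k _; rewrite (hE k).2 prod.
  apply: measure_semi_additive_ord_I => //; first by move=> k _; exact: (hE k).1.
  by apply: tr => k om km [/exk -/(_ km)[]].
have PFs : P (\big[setU/set0]_(k < m) F k) = (\sum_(k < m) pr k * Q0 * G m)%:E.
  transitivity (\sum_(k < m) P (F k))%E; last by rewrite -sumEFin; apply: eq_bigr => k _; rewrite (hF k).2 prod.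
  apply: measure_semi_additive_ord_I => //; first by move=> k _; exact: (hF k).1.
  by apply: tr => k om km [/exk -/(_ km)[]].
transitivity ((\sum_(k < m) pr k * Q0 * G k)%:E +
    ((Q0 * G m)%:E - (\sum_(k < m) pr k * Q0 * G m)%:E))%E.
  by congr (_ + (_ - _))%E.
rewrite -EFinB -EFinD; congr (_%:E).
rewrite /avg big_ord_recr /= WE /trunc_law ltnn eqxx -/Q0 -/(G m).
under [in RHS]eq_bigr => k _ do rewrite WE /trunc_law ltn_ord.
rewrite mulrDr mulrBl mulrBr mul1r mulr_sumr; congr (_ + (_ - _)).
  by apply: eq_bigr => k _; rewrite -/(G k); ring.
by rewrite mulr_suml mulr_sumr; apply: eq_bigr => k _; ring.
Qed.

Lemma law_observe (W : I -> nat -> R) (l : seq Z) s (B : (I -> nat) -> bool) :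
  (forall z k, W (e z) k = trunc_law k) -> uniq l ->
  measurable [set om | B (observe l om s)] /\
  P [set om | B (observe l om s)] = (avgs m W (map e l) (fun s => (B s)%:R) s)%:E.
Proof.
move=> WE ul; have := @joint_law W [::] l (fun=> 0%N) s B WE ul.
rewrite big_nil mul1r /= (_ : mkset _ = [set om | B (observe l om s)]) //.
by apply/seteqP; split => om /=; [case|].
Qed.

Hypothesis eI : injective e.

Lemma observe_in l om s z : z \in l -> uniq l -> observe l om s (e z) = cnt z om.
Proof.
elim: l s => //= y l IH s; rewrite inE => /orP[/eqP <-|zl] /andP[yl ul]; last exact: IH.
have : z \notin l by [].
elim: l s {IH ul yl} => /= [|x l IH] s; first by rewrite /upd eqxx.
rewrite inE negb_or => /andP[zx zl].
by rewrite updC ?IH //; apply: contra_neq zx => /eI.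
Qed.

Lemma observe_out l om s i : (forall z, z \in l -> i <> e z) -> observe l om s i = s i.
Proof.
elim: l s => //= z l IH s h; rewrite IH.
  by rewrite /upd; case: eqP => // /h; rewrite mem_head => /(_ isT).
by move=> y yl; apply: h; rewrite inE yl orbT.
Qed.
End JointLaw.

(** * Poisson masses, tails and thinning *)

Section Poisson.
Variable R : realType.
Implicit Types (t q : R) (m k : nat).
Import numFieldNormedType.Exports.

Definition pois t k : R := t ^+ k / k`!%:R * expR (- t).
Definition ptail m t : R := 1 - \sum_(j < m) pois t j.

Lemma poisE t k : 0 < t -> poisson_pmf t k = pois t k.
Proof. by rewrite /poisson_pmf => ->. Qed.

Lemma pois_ge0 t k : 0 <= t -> 0 <= pois t k.
Proof. by move=> t0; rewrite /pois mulr_ge0 ?expR_ge0 ?divr_ge0 ?exprn_ge0. Qed.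

Lemma le_from_derive (f df : R -> R) t : (forall x : R, is_derive x 1 f (df x)) ->
  (forall x, 0 <= x -> 0 <= df x) -> 0 <= t -> f 0 <= f t.
Proof.
move=> fd df0 t0.
have cf : {within `[0, t], continuous f}.
  apply: derivable_within_continuous => x _; exact: (@ex_derive _ _ _ _ _ _ _ (fd x)).
have [c /andP[c0 _] fE] := MVT_segment t0 (fun x _ => fd x) cf.
by rewrite -subr_ge0 fE mulr_ge0 ?df0 // subr0.
Qed.

Lemma is_derive_pois0 (x : R) : is_derive x 1 (fun t => pois t 0) (- pois x 0).
Proof.
have -> : (fun t => pois t 0) = expR \o -%R.
  by apply/funext => t; rewrite /pois /= expr0 fact0 divr1 mul1r.
by apply: is_derive_eq; rewrite /pois expr0 fact0 divr1 mul1r mulrN1.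
Qed.

Lemma is_derive_poisS (x : R) k :
  is_derive x 1 (fun t => pois t k.+1) (pois x k - pois x k.+1).
Proof.
have -> : (fun t => pois t k.+1) =
    ((k.+1)`!%:R^-1 : R) *: ((@id R) ^+ k.+1 * (expR \o -%R)).
  by apply/funext => t; rewrite /pois !fctE /= /GRing.scale /=; ring.
apply: is_derive_eq.
rewrite /GRing.scale /= /pois factS natrM invfM /=.
have f0 : (k`!%:R : R) != 0 by rewrite pnatr_eq0 -lt0n fact_gt0.
have k0 : (k.+1%:R : R) != 0 by rewrite pnatr_eq0.
rewrite !fctE exprS; move: (k.+1%:R : R) (k`!%:R : R) k0 f0 => a b a0 b0.
by field; rewrite a0 b0.
Qed.

(** The derivatives of the masses telescope. In other words, the tail is the distribution function
    of the arrival time of point [m.+1], with its Gamma density. *)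
Lemma is_derive_ptail (x : R) m : is_derive x 1 (ptail m.+1) (pois x m).
Proof.
elim: m => [|m IH].
  have -> : ptail 1 = cst (1 : R) - (fun t => pois t 0).
    by apply/funext => t; rewrite /ptail !fctE big_ord_recl big_ord0 addr0.
  have := is_derive_pois0 x => H; apply: is_derive_eq; by rewrite sub0r opprK.
have -> : ptail m.+2 = ptail m.+1 - (fun t => pois t m.+1).
  by apply/funext => t; rewrite /ptail !fctE big_ord_recr /= opprD addrA.
have := is_derive_poisS x m => H; apply: is_derive_eq; by rewrite opprB addrC subrK.
Qed.

Lemma ptail0 m : ptail m.+1 0 = 0.
Proof.
rewrite /ptail big_ord_recl big1 => [|i _]; last by rewrite /pois expr0n /= mul0r mul0r.
by rewrite /pois expr0 fact0 divr1 mul1r oppr0 expR0 addr0 subrr.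
Qed.

Lemma ptail_ge0 m t : 0 <= t -> 0 <= ptail m t.
Proof.
case: m => [|m] t0; first by rewrite /ptail big_ord0 subr0 ler01.
rewrite -(ptail0 m); apply: (@le_from_derive (ptail m.+1) (fun x => pois x m) t) => // x.
  exact: is_derive_ptail.
exact: pois_ge0.
Qed.

Lemma ptail_le m t : 0 <= t -> ptail m t <= t ^+ m / m`!%:R.
Proof.
case: m => [|m] t0.
  by rewrite /ptail big_ord0 subr0 expr0 fact0 divr1.
pose f : R -> R := ((m.+1)`!%:R^-1 : R) *: (@id R) ^+ m.+1 - ptail m.+1.
have : f 0 <= f t.
  apply: (@le_from_derive f (fun x => x ^+ m / m`!%:R - pois x m) t _ _ t0) => x.
    have := is_derive_ptail x m => H; apply: is_derive_eq.
    congr (_ - _); rewrite /GRing.scale /= mulr1 factS natrM invfM.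
    have f0 : (m`!%:R : R) != 0 by rewrite pnatr_eq0 -lt0n fact_gt0.
    have k0 : (m.+1%:R : R) != 0 by rewrite pnatr_eq0.
    move: (m.+1%:R : R) (m`!%:R : R) k0 f0 => a b a0 b0.
    by field; rewrite a0 b0.
  move=> x0; rewrite /pois -[X in X - _]mulr1 -mulrBr mulr_ge0 //.
    by rewrite divr_ge0 // exprn_ge0.
  by rewrite subr_ge0 -expR0 ler_expR oppr_le0.
rewrite /f !fctE ptail0 expr0n /= scaler0 subr0 subr_ge0 => /le_trans; apply.
by rewrite /GRing.scale /= mulrC.
Qed.

(** Thinning keeps [m] given points with probability [q ^+ m]. For [m > 0] both sides vanish at 0,
    and the derivatives compare because [expR (- x) <= expR (- (q * x))]. *)
Lemma ptail_thin m t q : 0 <= q <= 1 -> 0 <= t -> q ^+ m * ptail m t <= ptail m (q * t).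
Proof.
move=> /andP[q0 q1] t0; case: m => [|m].
  by rewrite /ptail !big_ord0 expr0 mul1r.
pose f : R -> R := (ptail m.+1 \o (fun y => q * y)) - (q ^+ m.+1) *: ptail m.+1.
have : f 0 <= f t.
  apply: (@le_from_derive f (fun x => q * pois (q * x) m - q ^+ m.+1 * pois x m) t _ _ t0) => x.
    have H1 := is_derive_ptail x m; have H2 := is_derive_ptail (q * x) m.
    have H3 : is_derive x 1 (fun y : R => q * y) q.
      have -> : (fun y : R => q * y) = q *: (@id R) by apply/funext.
      by apply: is_derive_eq; rewrite /GRing.scale /= mulr1.
    have H5 : is_derive x 1 (ptail m.+1 \o (fun y : R => q * y)) (pois (q * x) m * q) by exact: is_derive1_comp.
    by apply: is_derive_eq; rewrite /GRing.scale /= [_ * q]mulrC.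
  move=> x0; rewrite /pois exprMn.
  have -> : q * (q ^+ m * x ^+ m / m`!%:R * expR (- (q * x))) -
    q ^+ m.+1 * (x ^+ m / m`!%:R * expR (- x)) =
    q ^+ m.+1 * (x ^+ m / m`!%:R) * (expR (- (q * x)) - expR (- x)) by rewrite exprS; ring.
  rewrite mulr_ge0 //; first by rewrite mulr_ge0 ?exprn_ge0 // divr_ge0 // exprn_ge0.
  by rewrite subr_ge0 ler_expR lerN2 ler_piMl.
by rewrite /f !fctE /= mulr0 ptail0 scaler0 subr0 subr_ge0.
Qed.

Lemma pois_thin k t q : 0 <= q <= 1 -> 0 <= t -> q ^+ k * pois t k <= pois (q * t) k.
Proof.
move=> /andP[q0 q1] t0; rewrite /pois exprMn !mulrA -!mulrA.
rewrite ler_wpM2l ?exprn_ge0 // ler_wpM2l ?exprn_ge0 // ler_wpM2l ?invr_ge0 //.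
by rewrite ler_expR lerN2 ler_piMl.
Qed.

Lemma trunc_law_law m t : 0 <= t -> is_law m (trunc_law m (pois t)).
Proof.
move=> t0; split=> [k|].
  rewrite /trunc_law; case: ifP => _; first exact: pois_ge0.
  by case: ifP => _ //; exact: ptail_ge0.
rewrite big_ord_recr /= /trunc_law ltnn eqxx.
under eq_bigr => k _ do rewrite ltn_ord.
by rewrite addrC subrK.
Qed.

(** A count [k] costs only [q ^+ k], so the cap at [m] lets the single factor [q ^+ m] serve all
    counts. *)
Lemma trunc_law_thin m t q k : 0 <= q <= 1 -> 0 <= t ->
  q ^+ m * trunc_law m (pois t) k <= trunc_law m (pois (q * t)) k.
Proof.
move=> q01 t0; have [q0 q1] := andP q01; rewrite /trunc_law; case: ifPn => km.
  apply: le_trans (pois_thin k q01 t0); apply: ler_wpM2r; first exact: pois_ge0.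
  by apply: ler_wiXn2l => //; exact: ltnW.
by case: ifPn => _; [exact: ptail_thin|rewrite mulr0].
Qed.

Lemma pois_lt_eps m (eps : R) : 0 < eps -> exists2 t, 0 < t & \sum_(j < m) pois t j <= eps.
Proof.
(* As [pois t m <= 1] and [t >= 1], each term with [j < m] is at most the factorial of [m] divided
   by [t]; this [t] brings the sum of the [m] bounds below [eps]. *)
move=> e0; pose t : R := 1 + m%:R * m`!%:R / eps.
have a0 : 0 <= m%:R * m`!%:R / eps by rewrite divr_ge0 ?mulr_ge0 // ltW.
have t1 : 1 <= t by rewrite lerDl.
have t0 : 0 < t by apply: lt_le_trans t1.
exists t => //.
have f0 : (0 : R) < m`!%:R by rewrite ltr0n fact_gt0.
have e1 : t ^+ m / m`!%:R * expR (- t) <= 1.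
  have := ptail_ge0 m.+1 (ltW t0); rewrite /ptail big_ord_recr /= subr_ge0.
  apply: le_trans; apply: ler_wpDl => //; apply: sumr_ge0 => j _.
  by apply: pois_ge0; exact: ltW.
have key j : (j < m)%N -> pois t j <= m`!%:R / t.
  move=> jm; rewrite ler_pdivlMr // /pois.
  have h : t ^+ j.+1 <= t ^+ m by apply: ler_weXn2l.
  apply: (@le_trans _ _ (m`!%:R * (t ^+ m / m`!%:R * expR (- t)))); last first.
    by rewrite -[leRHS]mulr1; apply: ler_wpM2l => //; exact: ltW.
  rewrite [leRHS](_ : _ = t ^+ m * expR (- t)); last by field; exact: lt0r_neq0.
  rewrite [leLHS](_ : _ = t ^+ j.+1 / j`!%:R * expR (- t)); last by rewrite exprS; ring.
  apply: ler_wpM2r; first exact: expR_ge0.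
  apply: le_trans h; rewrite ler_pdivrMr ?ltr0n ?fact_gt0 // ler_peMr ?exprn_ge0 //; first exact: ltW.
  by rewrite ler1n fact_gt0.
apply: (@le_trans _ _ (\sum_(j < m) (m`!%:R / t))); first by apply: ler_sum => j _; exact: key.
rewrite sumr_const card_ord -[_ *+ m]mulr_natl mulrA ler_pdivrMr //.
rewrite /t mulrDr mulr1 mulrCA divff ?lt0r_neq0 // mulr1; apply: ler_wpDl => //; exact: ltW.
Qed.

Lemma ptail_cvg t : 0 <= t -> (fun m => ptail m t) @ \oo --> (0 : R).
Proof.
move=> t0; apply: (@squeeze_cvgr _ _ _ _ (fun=> 0) (exp_coeff t)).
- by near=> m; rewrite ptail_ge0 //= ptail_le.
- exact: cvg_cst.
- exact: cvg_exp_coeff.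
Unshelve. all: by end_near. Qed.
End Poisson.

(** * Geometry of cells *)

Section Euclid.
Variables (R : realType) (D : nat).
Implicit Types (x y z : 'rV[R]_D).
Local Notation edist := (@Defs.edist R D).

Definition sqd x y : R := \sum_(i < D) (x ord0 i - y ord0 i) ^+ 2.

Lemma sqd_ge0 x y : 0 <= sqd x y.
Proof. by apply: sumr_ge0 => i _; exact: sqr_ge0. Qed.

Lemma euclid_ge0 x y : 0 <= edist x y. Proof. exact: sqrtr_ge0. Qed.

Lemma euclidC x y : edist x y = edist y x.
Proof.
by congr (Num.sqrt _); apply: eq_bigr => i _; rewrite -sqrrN opprB.
Qed.

Lemma edist_le x y (c : R) : 0 <= c -> (edist x y <= c) = (sqd x y <= c ^+ 2).
Proof.
move=> c0; rewrite /Defs.edist -[in LHS](ger0_norm c0) -sqrtr_sqr ler_sqrt //.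
exact: sqr_ge0.
Qed.

Lemma cauchy_schwarz (a b : 'I_D -> R) :
  (\sum_i a i * b i) ^+ 2 <= (\sum_i a i ^+ 2) * (\sum_i b i ^+ 2).
Proof.
set A := \sum_i a i ^+ 2; set B := \sum_i b i ^+ 2; set C := \sum_i a i * b i.
have A0 : 0 <= A by apply: sumr_ge0 => i _; exact: sqr_ge0.
have B0 : 0 <= B by apply: sumr_ge0 => i _; exact: sqr_ge0.
have key u v : 0 <= u ^+ 2 * A - 2 * (u * v) * C + v ^+ 2 * B.
  rewrite (_ : _ + _ = \sum_i (u * a i - v * b i) ^+ 2).
    by apply: sumr_ge0 => i _; exact: sqr_ge0.
  rewrite /A /B /C !mulr_sumr -sumrB -big_split; apply: eq_bigr => i _ /=; ring.
have [A_gt0|] := ltP 0 A; last first.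
  move=> Ale0; have AE : A = 0 by apply/eqP; rewrite eq_le Ale0.
  have a0 i : a i = 0.
    move/eqP: AE; rewrite psumr_eq0 => [|j _]; last exact: sqr_ge0.
    by move=> /allP/(_ i (mem_index_enum _)); rewrite sqrf_eq0 => /eqP.
  rewrite /C big1 ?expr0n ?mulr_ge0 // => i _; by rewrite a0 mul0r.
have := key C A; rewrite [X in 0 <= X](_ : _ = A * (A * B - C ^+ 2)); last by ring.
by rewrite pmulr_rge0 // subr_ge0.
Qed.

Lemma euclid_triangle y x z : edist x z <= edist x y + edist y z.
Proof.
rewrite edist_le ?addr_ge0 ?euclid_ge0 //.
have cs := cauchy_schwarz (fun i => x ord0 i - y ord0 i) (fun i => y ord0 i - z ord0 i).
rewrite sqrrD !sqr_sqrtr ?sqd_ge0 // -!/(sqd _ _).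
set C := \sum_i _ in cs; have -> : sqd x z = sqd x y + C *+ 2 + sqd y z.
  rewrite /sqd /C -sumrMnl -!big_split; apply: eq_bigr => i _ /=; ring.
rewrite lerD2r lerD2l lerMn2r /=; apply: le_trans (ler_norm _) _.
rewrite -sqrtr_sqr -sqrtrM ?sqd_ge0 // ler_sqrt //.
by rewrite mulr_ge0 ?sqd_ge0.
Qed.

Lemma edist_scale (g : R) x y : 0 <= g -> edist (g *: x) (g *: y) = g * edist x y.
Proof.
move=> g0; rewrite -[in RHS](ger0_norm g0) -sqrtr_sqr -sqrtrM ?sqr_ge0 //.
by congr (Num.sqrt _); rewrite mulr_sumr; apply: eq_bigr => i _; rewrite !mxE; ring.
Qed.

Lemma edist_sup (c : R) x y : 0 <= c -> (forall i, `|x ord0 i - y ord0 i| <= c) ->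
  edist x y <= D%:R * c.
Proof.
move=> c0 h; rewrite edist_le ?mulr_ge0 //.
apply: (@le_trans _ _ (\sum_(i < D) c ^+ 2)).
  by apply: ler_sum => i _; rewrite -real_normK ?num_real // ler_sqr ?nnegrE.
rewrite sumr_const card_ord exprMn -[_ *+ D]mulr_natl; apply: ler_wpM2r; first exact: sqr_ge0.
by rewrite -natrX ler_nat; case: (D) => // n; rewrite expnS expn1 leq_pmulr.
Qed.

Lemma coord_le_edist x y i : `|x ord0 i - y ord0 i| <= edist x y.
Proof.
rewrite -sqrtr_sqr ler_sqrt ?sqd_ge0 // (bigD1 i) //=; apply: ler_wpDr => //.
by apply: sumr_ge0 => j _; exact: sqr_ge0.
Qed.

(* The point of largest norm in a finite set is an extreme point of its hull,
   so two finite sets with the same hull have a common point. *)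
Lemma hull_common (n : nat) (v : 'I_n -> 'rV[R]_D) (U V : set 'rV[R]_D) :
  U !=set0 -> U `<=` range v -> hull U = hull V -> U `&` V !=set0.
Proof.
move=> [u0 Uu0] Uv UV.
have sub (A : set 'rV[R]_D) : A `<=` hull A.
  move=> x Ax; exists 1%N, (fun=> x), (fun=> 1); split => //; split => // ; split.
    by rewrite big_ord1.
  by rewrite big_ord1 scale1r.
pose f x := sqd x 0.
have [i0 _ vi0] := Uv _ Uu0.
have [i Ui imax] : exists2 i, U (v i) & forall j, U (v j) -> f (v j) <= f (v i).
  case: (@arg_maxP _ R 'I_n i0 (fun j => `[< U (v j) >]) (fun j => f (v j))).
    by apply/asboolP; rewrite vi0.
  by move=> i /asboolP Ui h; exists i => // j Uj; apply: h; exact/asboolP.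
(* Variance identity: mean square minus square of the mean is the mean square deviation. *)
have sumsq m (p : 'I_m -> 'rV[R]_D) (w : 'I_m -> R) : \sum_k w k = 1 ->
    \sum_k w k * f (p k) - f (\sum_k w k *: p k) =
    \sum_k w k * sqd (p k) (\sum_k w k *: p k).
  move=> w1; set x := \sum_k w k *: p k.
  have xE j : x ord0 j = \sum_k w k * p k ord0 j.
    by rewrite summxE; apply: eq_bigr => k _; rewrite mxE.
  have E1 : \sum_k w k * f (p k) = \sum_(j < D) \sum_k w k * p k ord0 j ^+ 2.
    rewrite exchange_big /=; apply: eq_bigr => k _; rewrite mulr_sumr.
    by apply: eq_bigr => j _; rewrite mxE subr0.
  have E2 : \sum_k w k * sqd (p k) x = \sum_(j < D) \sum_k w k * (p k ord0 j - x ord0 j) ^+ 2.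
    by rewrite exchange_big /=; apply: eq_bigr => k _; rewrite mulr_sumr.
  rewrite E1 E2 /f /sqd -sumrB; apply: eq_bigr => j _; rewrite mxE subr0.
  rewrite [RHS](eq_bigr (fun k => w k * p k ord0 j ^+ 2 +
    ((- 2 * x ord0 j) * (w k * p k ord0 j) + x ord0 j ^+ 2 * w k))); last by move=> k _; ring.
  by rewrite !big_split /= -!mulr_sumr -xE w1; ring.
have fU x : hull U x -> f x <= f (v i).
  move=> [m [p [w [Up [w0 [w1 ->]]]]]].
  rewrite -subr_ge0 (_ : f (v i) = \sum_k w k * f (v i)); last by rewrite -mulr_suml w1 mul1r.
  have S0 : 0 <= \sum_k w k * f (p k) - f (\sum_k w k *: p k).
    by rewrite sumsq //; apply: sumr_ge0 => k _; rewrite mulr_ge0 ?sqd_ge0.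
  have S1 : \sum_k w k * f (p k) <= \sum_k w k * f (v i).
    apply: ler_sum => k _; apply: ler_wpM2l => //.
    by have [j _ pj] := Uv _ (Up k); rewrite -pj; apply: imax; rewrite pj.
  lra.
have [m [p [w [Vp [w0 [w1 ve]]]]]] : hull V (v i) by rewrite -UV; exact: sub.
have pU k : f (p k) <= f (v i) by apply: fU; rewrite UV; exact: sub.
(* No [p k] is longer than the barycentre [v i], so the variance is 0 and every [p k] of nonzero
   weight equals [v i]. *)
have Z : \sum_k w k * sqd (p k) (v i) = 0.
  apply/eqP; rewrite eq_le; apply/andP; split; last first.
    by apply: sumr_ge0 => k _; rewrite mulr_ge0 ?sqd_ge0.
  rewrite {1}ve -sumsq // -ve subr_le0.
  apply: (@le_trans _ _ (\sum_k w k * f (v i))).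
    by apply: ler_sum => k _; apply: ler_wpM2l.
  by rewrite -mulr_suml w1 mul1r.
have [k wk] : exists k, w k != 0.
  apply/existsP; rewrite -[X in is_true X]negbK negb_exists; apply/negP => /forallP h.
  move: w1; rewrite big1 => [/eqP|k _]; first by rewrite eq_sym oner_eq0.
  by apply/eqP; have := h k; rewrite negbK.
exists (v i); split => //.
suff -> : v i = p k by [].
move/eqP: Z; rewrite psumr_eq0 => [|k' _]; last by rewrite mulr_ge0 ?sqd_ge0.
move=> /allP/(_ k (mem_index_enum _)); rewrite mulf_eq0 (negbTE wk) /= => /eqP.
move=> /eqP; rewrite psumr_eq0 => [/allP h|k' _]; last exact: sqr_ge0.
apply/rowP => j; have := h j (mem_index_enum _); rewrite sqrf_eq0 subr_eq0 => /eqP ->//.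
Qed.
End Euclid.

(** * Lattice cubes and mesh cells *)

Section Lattice.
Variable D : nat.
Local Notation Z := {ffun 'I_D -> int}.
Implicit Types (z C b : Z).

Definition coarse (L : nat) z : Z := [ffun i => (z i %/ L%:Z)%Z].
Definition subcells (L : nat) C : seq Z :=
  [seq [ffun i => C i * L%:Z + (j i : nat)%:Z] | j : {ffun 'I_D -> 'I_L}].
Definition ball (n : nat) C : seq Z :=
  [seq [ffun i => C i + ((j i : nat)%:Z - n%:Z)] | j : {ffun 'I_D -> 'I_(2 * n).+1}].

Lemma subcellsP L z C : (0 < L)%N -> (z \in subcells L C) = (coarse L z == C).
Proof.
move=> L0; apply/mapP/eqP => [[j _ ->]|<-].
  apply/ffunP => i; rewrite !ffunE divzMDl; last by lia.
  rewrite divz_small ?addr0 //; move: (ltn_ord (j i)); move: (nat_of_ord _) => a ha.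
  by apply/andP; split; lia.
have h i : (`|(z i %% L%:Z)%Z|%N < L)%N.
  have := @ltz_pmod (z i) L; have := @modz_ge0 (z i) L; lia.
exists [ffun i => Ordinal (h i)]; rewrite ?mem_enum //; apply/ffunP => i; rewrite !ffunE /=.
rewrite {1}(divz_eq (z i) L%:Z) gez0_abs //; apply: modz_ge0; lia.
Qed.

Lemma subcellsU L C : uniq (subcells L C).
Proof.
rewrite /subcells map_inj_uniq ?enum_uniq // => j k /ffunP h; apply/ffunP => i.
by have := h i; rewrite !ffunE => e; apply: val_inj => /=; lia.
Qed.

Lemma size_subcells L C : size (subcells L C) = (L ^ D)%N.
Proof. by rewrite size_map -cardE card_ffun !card_ord. Qed.

Lemma ballP n C b : reflect (forall i, `|C i - b i| <= n%:Z) (b \in ball n C).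
Proof.
apply: (iffP mapP) => [[j _ ->] i|h].
  by rewrite !ffunE; move: (ltn_ord (j i)); move: (nat_of_ord _) (C i) => a c ha; lia.
have h' i : (absz (b i - C i + n%:Z)%R < (2 * n).+1)%N by have := h i; lia.
exists [ffun i => Ordinal (h' i)]; rewrite ?mem_enum //; apply/ffunP => i; rewrite !ffunE /=.
by have := h i; lia.
Qed.

Lemma ballC n C b : (b \in ball n C) = (C \in ball n b).
Proof. by apply/ballP/ballP => h i; rewrite distrC. Qed.

Lemma ballU n C : uniq (ball n C).
Proof.
rewrite /ball map_inj_uniq ?enum_uniq // => j k /ffunP h; apply/ffunP => i.
by have := h i; rewrite !ffunE => e; apply: val_inj => /=; lia.
Qed.

Lemma size_ball n C : size (ball n C) = ((2 * n).+1 ^ D)%N.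
Proof. by rewrite size_map -cardE card_ffun !card_ord. Qed.

Lemma ball_refl n C : C \in ball n C.
Proof. by apply/ballP => i; rewrite subrr normr0. Qed.

Lemma ball_trans n n' C C' C'' : C' \in ball n C -> C'' \in ball n' C' ->
  C'' \in ball (n + n') C.
Proof.
move=> /ballP h /ballP h'; apply/ballP => i; have := h i; have := h' i; lia.
Qed.

Lemma ball_le n n' C C' : (n <= n')%N -> C' \in ball n C -> C' \in ball n' C.
Proof. by move=> nn /ballP h; apply/ballP => i; apply: le_trans (h i) _; lia. Qed.
End Lattice.

Section Cells.
Variables (R : realType) (D : nat).
Local Notation Z := {ffun 'I_D -> int}.
Local Notation pt := 'rV[R]_D.
Local Notation edist := (@Defs.edist R D).
Implicit Types (x y : pt) (z C : Z) (h g : R).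

Definition corner h z : pt := \row_i (h * (z i)%:~R).
Definition corner1 h z : pt := \row_i (h * (z i + 1)%:~R).
Definition cell h z : set pt := box (corner h z) (corner1 h z).
Definition cell_of h x : Z := [ffun i => Num.floor (x ord0 i / h)].

Lemma cellE h z x : cell h z x <->
  forall i, h * (z i)%:~R <= x ord0 i < h * (z i + 1)%:~R.
Proof. by split=> H i; have := H i; rewrite !mxE. Qed.

Lemma cellP h z x : 0 < h -> cell h z x <-> cell_of h x = z.
Proof.
move=> h0; rewrite cellE; split=> [H|<- i].
  apply/ffunP => i; rewrite ffunE; apply/Num.Theory.floor_def.
  by rewrite ler_pdivlMr // ltr_pdivrMr // mulrC [_ * h]mulrC.
rewrite ffunE mulrC -ler_pdivlMr // [h * _]mulrC -ltr_pdivrMr //.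
exact: floor_itv.
Qed.

Lemma cell_ofP h x : 0 < h -> cell h (cell_of h x) x.
Proof. by move=> h0; apply/cellP. Qed.

Lemma cell_disj h z z' : 0 < h -> z != z' -> cell h z `&` cell h z' = set0.
Proof.
move=> h0 zz; apply/seteqP; split => // x [/(cellP _ _ h0) e /(cellP _ _ h0) e'].
by rewrite -e -e' eqxx in zz.
Qed.

Lemma cell_coarse (L : nat) h z x : (0 < L)%N -> 0 < h -> cell h z x ->
  cell (h * L%:R) (coarse L z) x.
Proof.
move=> L0 h0 /cellE H; apply/cellE => i; rewrite ffunE.
have /andP[h1 h2] := H i; have L0' : (L%:Z != 0)%R by lia.
have := divz_eq (z i) L%:Z; set q := (_ %/ _)%Z; set r := (_ %% _)%Z => zE.
have r0 : 0 <= r by apply: modz_ge0.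
have rL : r < L%:Z by apply: ltz_pmod; lia.
have LE : (L%:R : R) = (L%:Z)%:~R by [].
rewrite LE -!mulrA -!intrM; apply/andP; split.
  by apply: le_trans h1; rewrite ler_pM2l // ler_int; lia.
by apply: lt_le_trans h2 _; rewrite ler_pM2l // ler_int; lia.
Qed.

Lemma cell_scale h g z x : 0 < g -> cell (g * h) z x -> cell h z (g^-1 *: x).
Proof.
move=> g0 /cellE H; apply/cellE => i; rewrite mxE; have := H i.
by rewrite -!mulrA ler_pdivlMl // ltr_pdivrMl.
Qed.

Lemma cell_diam h z x y : 0 <= h -> cell h z x -> cell h z y -> edist x y <= D%:R * h.
Proof.
move=> h0 /cellE H /cellE H'; apply: edist_sup => // i.
have := H i; have := H' i; rewrite !intrD; rewrite ler_norml; lra.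
Qed.

Definition nr h z z' := exists p q, [/\ cell h z p, cell h z' q & edist p q <= 1].

Lemma nr_sym h z z' : nr h z z' -> nr h z' z.
Proof. by move=> [p [q [hp hq pq]]]; exists q, p; rewrite euclidC. Qed.

Lemma edist_xx x : edist x x = 0.
Proof. by rewrite /Defs.edist big1 ?sqrtr0 // => i _; rewrite subrr expr0n. Qed.

Lemma cell_corner h z : 0 < h -> cell h z (corner h z).
Proof.
by move=> h0; apply/cellE => i; rewrite mxE lexx /= ltr_pM2l // ltr_int; lia.
Qed.

Lemma nr_refl h z : 0 < h -> nr h z z.
Proof.
by move=> h0; exists (corner h z), (corner h z); rewrite edist_xx ler01; split => //; exact: cell_corner.
Qed.

Lemma nr_coarse (L : nat) h z z' : (0 < L)%N -> 0 < h -> nr h z z' ->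
  nr (h * L%:R) (coarse L z) (coarse L z').
Proof. by move=> L0 h0 [p [q [hp hq pq]]]; exists p, q; split => //; exact: cell_coarse. Qed.

Lemma nr_ball (n : nat) h z z' : 0 < h -> h^-1 + 1 <= n%:R -> nr h z z' -> z' \in ball n z.
Proof.
move=> h0 hn [p [q [/cellE hp /cellE hq pq]]]; apply/ballP => i.
have := le_trans (coord_le_edist p q i) pq; have /andP[p1 p2] := hp i; have /andP[q1 q2] := hq i.
rewrite ler_norml => /andP[a1 a2].
have key (a b : int) : h * (a%:~R - (b + 1)%:~R) < 1 -> a - b <= n%:Z.
  rewrite -ltr_pdivlMl // mulr1 => H; rewrite -(ler_int R) intrD intrN.
  by apply: ltW; apply: lt_le_trans hn; rewrite -ltrBlDr; move: H; rewrite intrD; lra.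
have k1 := key (z i) (z' i); have k2 := key (z' i) (z i).
rewrite ler_norml; apply/andP; split; last by apply: k1; rewrite mulrBr; lra.
by rewrite lerNl opprB; apply: k2; rewrite mulrBr; lra.
Qed.

Lemma nr_dist h g z z' x y : 0 < h -> 0 < g -> g * (1 + 2 * (D%:R * h)) <= 1 ->
  nr h z z' -> cell (g * h) z x -> cell (g * h) z' y -> edist x y <= 1.
Proof.
move=> h0 g0 gh [p [q [hp hq pq]]] hx hy.
have gi : 0 < g^-1 by rewrite invr_gt0.
have hx' := cell_scale g0 hx; have hy' := cell_scale g0 hy.
have -> : edist x y = g * edist (g^-1 *: x) (g^-1 *: y).
  by rewrite edist_scale ?ltW // mulrA mulfV ?mul1r // lt0r_neq0.
apply: le_trans gh; rewrite ler_pM2l //.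
have := euclid_triangle p (g^-1 *: x) (g^-1 *: y).
have := euclid_triangle q p (g^-1 *: y).
have := cell_diam (ltW h0) hx' hp; have := cell_diam (ltW h0) hq hy'.
lra.
Qed.

(** Two unit steps and the diameters of the three cells [z], [c] and [z']. It is applied to coarse
    cells, where it limits the range of a bit. *)
Lemma nr_dist2 h g z z' c x y : 0 < h -> 0 < g <= 1 ->
  nr h z c -> nr h z' c -> cell (g * h) z x -> cell (g * h) z' y ->
  edist x y <= 2 + 3 * (D%:R * h).
Proof.
move=> h0 /andP[g0 g1] [p [q [hp hq pq]]] [p' [q' [hp' hq' pq']]] hx hy.
have gi : 0 < g^-1 by rewrite invr_gt0.
have hx' := cell_scale g0 hx; have hy' := cell_scale g0 hy.
have -> : edist x y = g * edist (g^-1 *: x) (g^-1 *: y).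
  by rewrite edist_scale ?ltW // mulrA mulfV ?mul1r // lt0r_neq0.
apply: (@le_trans _ _ (edist (g^-1 *: x) (g^-1 *: y))).
  by apply: ler_piMl => //; exact: euclid_ge0.
have := euclid_triangle p (g^-1 *: x) (g^-1 *: y).
have := euclid_triangle q p (g^-1 *: y).
have := euclid_triangle q' q (g^-1 *: y).
have := euclid_triangle p' q' (g^-1 *: y).
have := cell_diam (ltW h0) hx' hp; have := cell_diam (ltW h0) hp' hy'.
have := cell_diam (ltW h0) hq hq'; rewrite [edist q' p']euclidC.
lra.
Qed.
End Cells.

Section PPPCells.
Local Open Scope card_scope.
Variables (R : realType) (D : nat) (dsp : measure_display) (Omega : measurableType dsp).
Variables (P : probability Omega R) (X : Omega -> set 'rV[R]_D) (lam h : R).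
Hypotheses (lam0 : 0 < lam) (h0 : 0 < h) (XP : is_PPP P X lam).
Local Notation Z := {ffun 'I_D -> int}.

Lemma ppp_cells (l : seq Z) (f : Z -> nat) : uniq l ->
  measurable [set om | forall z, z \in l -> (X om `&` cell h z) #= `I_(f z)] /\
  P [set om | forall z, z \in l -> (X om `&` cell h z) #= `I_(f z)] =
    (\prod_(z <- l) pois (lam * h ^+ D) (f z))%:E.
Proof.
move=> ul; pose zz (j : 'I_(size l)) := tnth (in_tuple l) j.
have := @XP (size l) (fun j => corner h (zz j)) (fun j => corner1 h (zz j)) (fun j => f (zz j)).
case.
- by move=> j i; rewrite !mxE ltr_pM2l // ltr_int; lia.
- move=> j j' jj; apply: cell_disj => //; apply: contra_neq jj.
  rewrite /zz !(tnth_nth [ffun=> 0]) /= => /eqP.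
  by rewrite (nth_uniq _ (ltn_ord j) (ltn_ord j') ul) => /eqP/val_inj.
- have -> : [set om | forall j, (X om `&` box (corner h (zz j)) (corner1 h (zz j))) #= `I_(f (zz j))] =
      [set om | forall z, z \in l -> (X om `&` cell h z) #= `I_(f z)].
    apply/seteqP; split => om /= H => [z|j]; last by apply: H; exact: mem_tnth.
    by move=> /(tnthP (in_tuple l))[j ->]; exact: H.
  move=> mE PE; split => //; rewrite PE big_tnth; congr (_%:E).
  apply: eq_bigr => j _; rewrite poisE.
    congr (pois (_ * _) _); rewrite /box_vol (eq_bigr (fun=> h)).
      by rewrite prodr_const card_ord.
    by move=> i _; rewrite !mxE intrD; ring.
  rewrite mulr_gt0 // /box_vol prodr_gt0 // => i _; rewrite !mxE intrD mulrDr mulr1.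
  by rewrite addrAC subrr add0r.
Qed.
End PPPCells.

(** * Comparison of intensities in a finite volume *)

Section MoreAverages.
Variables (R : realType) (I : eqType) (m : nat).

Lemma avgs_morph (W : I -> nat -> R) l F (phi : (I -> nat) -> I -> nat) s :
  (forall s i k, i \in l -> phi (upd s i k) = upd (phi s) i k) ->
  avgs m W l (F \o phi) s = avgs m W l F (phi s).
Proof.
elim: l s => //= i l IH s h; apply: eq_bigr => k _.
rewrite IH; first by rewrite h // inE eqxx.
by move=> t j a jl; apply: h; rewrite inE jl orbT.
Qed.
End MoreAverages.

Section FiniteVolume.
Variables (R : realType) (D d L rho : nat) (h : R).
Local Notation Z := {ffun 'I_D -> int}.
Local Notation I := (Z + Z)%type.
Hypotheses (h0 : 0 < h) (L0 : (0 < L)%N).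
Hypothesis rhoP : (h * L%:R)^-1 + 1 <= rho%:R.
Local Notation m := d.+1.
Implicit Types (z C : Z) (n : nat).

Definition origin : Z := [ffun=> 0].
Definition far n z : Prop := coarse L z \notin ball n origin.
Definition percZ n z0 (s : I -> nat) : Prop :=
  @perc Z Z d (coarse L) (nr h) (nr (h * L%:R)) (far n) z0 s.
Definition full (b : nat) : I -> nat := fun i => if i is inl _ then m else b.
Definition cells_in n : seq Z := undup (flatten [seq subcells L C | C <- ball n origin]).

Lemma cells_inP n z : (z \in cells_in n) = (coarse L z \in ball n origin).
Proof.
rewrite mem_undup; apply/flatten_mapP/idP => [[C Cb]|zb].
  by rewrite subcellsP // => /eqP ->.
by exists (coarse L z) => //; rewrite subcellsP.
Qed.

Let hL0 : 0 < h * L%:R. Proof. by rewrite mulr_gt0 // ltr0n. Qed.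

Lemma percZ_mono n z0 s t : cfgle s t -> percZ n z0 s -> percZ n z0 t.
Proof. exact: perc_mono. Qed.

(* Outside the box all cells are full, so that the event depends on finitely many
   cells and a connection may be cut only inside the box.  Connections may start
   in a cell close to [z0]; these cells are treated separately, at the cost of a
   factor which does not depend on [n]. *)
Lemma finite_volume (p p' : nat -> R) (mu0 r : R) (M : nat) n z0 :
  is_law m p -> is_law m p' -> (forall k, r * p k <= p' k) -> 0 <= r <= 1 ->
  M = ((2 * (2 * rho)).+1 ^ D)%N ->
  0 <= mu0 <= p' 0%N ^+ (L ^ D) ->
  1 - (1 / 2) ^+ M * (1 / 2) ^+ (M * M) * mu0 / 2 <= r ^+ (2 * m) ->
  r ^+ size (flatten [seq subcells L C | C <- ball rho z0]) *
  avgs m (fun=> p) (map inl (cells_in n)) (fun s => `[< percZ (n + rho) z0 s >]%:R) (full 0) <=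
  avgs m (fun=> p') (map inl (cells_in n)) (fun s => `[< percZ (n + rho) z0 s >]%:R) (full 1).
Proof.
move=> pL p'L rp r01 ME mu0P hr; have [r0 r1] := andP r01.
pose A s := `[< percZ (n + rho) z0 s >]; rewrite -/(A _).
pose F (s : I -> nat) : R := (A s)%:R.
(* Coarse cells near [z0] are set aside. Cells are far only beyond [n + rho], so that none of them
   is near a coarse cell of the box. *)
pose Ms := [seq C <- ball n origin | ~~ `[< nr (h * L%:R) z0 C >]].
pose W : seq Z -> I -> nat -> R := stage (coarse L) (ball (2 * rho)) p p'.
pose lx : seq I := map inl (cells_in n).
pose lb : seq I := map inr (undup (flatten [seq ball (2 * rho) C | C <- ball n origin])).
have inl_inj : injective (@inl Z Z) by move=> x y [].
have inr_inj : injective (@inr Z Z) by move=> x y [].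
have F01 s : 0 <= F s <= 1 by rewrite /F; case: (A s); rewrite ?lexx ?ler01.
have Fmono s t : cfgle s t -> F s <= F t.
  move=> st; rewrite /F; case: (boolP (A s)) => [/asboolP /(percZ_mono st)/asboolP|_].
    by rewrite -/(A _) => ->.
  by case: (A t).
have NRb C C' : nr (h * L%:R) C C' -> C' \in ball rho C by apply: nr_ball.
have m0 : (0 < m)%N by [].
have WL Q i : is_law m (W Q i) by apply: stage_law.
have W0 Q i k : 0 <= W Q i k by exact: (WL Q i).1.
(* In [stage [::]] all bits are off, so they can be added as coordinates. *)
have step1 : avgs m (fun=> p) lx F (full 0) <= avgs m (W [::]) (lx ++ lb) F (full 0).
  rewrite avgs_cat -(@eq_avgs R I m (W [::])); last by move=> i k /mapP[z _ ->].
  apply: avgs_le_on => // t tE; apply: le_trans (avgs_ge_zero _ _ (WL [::]) Fmono).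
  rewrite /F; case: (boolP (A t)) => // /asboolP At.
  suff /asboolP : percZ (n + rho) z0 (setl t lb 0%N) by rewrite -/(A _) => ->.
  apply: perc_ext At => [z|b tb].
    by rewrite /setl; case: ifP => // /mapP[].
  have := congr1 (fun f => f (inr b)) tE; rewrite /setl.
  have -> : (inr b \in lx) = false by apply/negP => /mapP[].
  by move=> tb0; rewrite tb0 in tb.
have step2 : avgs m (W [::]) (lx ++ lb) F (full 0) <= avgs m (W Ms) (lx ++ lb) F (full 0).
  have uMs : uniq Ms by rewrite filter_uniq // ballU.
  have ul : uniq (lx ++ lb).
    rewrite cat_uniq (map_inj_uniq inl_inj) (map_inj_uniq inr_inj) !undup_uniq /= andbT.
    by apply/hasPn => _ /mapP[b _ ->]; apply/negP => /mapP[].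
  apply: (@replace_law Z Z d (coarse L) (nr h) (nr (h * L%:R)) (subcells L) _ _
    (ball (2 * rho)) _ R m M p p' mu0 r) => //.
  - by move=> z C; apply: subcellsP.
  - by move=> z z'; apply: nr_coarse.
  - move=> C C1 C2 /NRb h1 /NRb h2; rewrite mul2n -addnn; exact: ball_trans h1 h2.
  - by move=> C; apply: subcellsU.
  - by move=> C; apply: ballU.
  - by move=> C b; apply: ballC.
  - by move=> C; rewrite size_ball ME.
  - by move=> C; apply: ball_refl.
  - by move=> C; rewrite size_subcells.
  - move=> C; rewrite mem_filter => /andP[_ Cb]; split.
      move=> _ /mapP[z zC ->]; rewrite mem_cat; apply/orP; left; apply/mapP; exists z => //.
      by rewrite cells_inP; move: zC; rewrite subcellsP // => /eqP ->.
    move=> _ /mapP[b bC ->]; rewrite mem_cat; apply/orP; right; apply/mapP; exists b => //.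
    by rewrite mem_undup; apply/flatten_mapP; exists C.
  - move=> C; rewrite mem_filter => /andP[/asboolPn nC Cb]; split => // z /negP fz /nr_sym zC.
    by apply: fz; apply: ball_trans Cb _; apply: NRb.
pose phi (s : I -> nat) : I -> nat := fun i => if i is inl _ then s i else 1%N.
(* The bits have served: raising all of them to 1 removes them from the average. *)
have step3 : avgs m (W Ms) (lx ++ lb) F (full 0) <= avgs m (W Ms) lx F (full 1).
  have -> : full 1 = phi (full 0) by apply/funext => -[].
  rewrite -avgs_morph; last first.
    move=> s _ k /mapP[z _ ->]; by apply/funext => -[x|x].
  rewrite avgs_cat; apply: avgs_le => // s.
  apply: (@le_trans _ _ (avgs m (W Ms) lb (F \o phi) s)).
    apply: avgs_le => // t; rewrite /F /=.
    case: (boolP (A t)) => // /asboolP At.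
    suff /asboolP : percZ (n + rho) z0 (phi t) by rewrite -/(A _) => ->.
    by apply: perc_ext At.
  rewrite avgs_inv // => _ k t /mapP[b _ ->] /=; congr F.
  by apply/funext => -[x|x].
apply: (@le_trans _ _ (r ^+ size (flatten [seq subcells L C | C <- ball rho z0]) *
    avgs m (W Ms) lx F (full 1))).
  by apply: ler_wpM2l; [rewrite exprn_ge0|exact: le_trans (le_trans step1 step2) step3].
(* The remaining cells of the box take their new law by resampling, all of them serving as witness:
   they lie near [z0], so their number is bounded independently of [n]. *)
pose inM (i : I) := if i is inl z then coarse L z \in Ms else false.
pose l1 := [seq i <- lx | inM i]; pose l0 := [seq i <- lx | ~~ inM i].
have pl : perm_eq lx (l1 ++ l0) by rewrite perm_sym perm_filterC.
have ulx : uniq lx by rewrite (map_inj_uniq inl_inj) undup_uniq.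
have ul0 : uniq l0 by rewrite filter_uniq.
rewrite !(avgs_perm m _ _ pl) !avgs_cat -avgsZ.
rewrite (@eq_avgs R I m (W Ms) (fun=> p') l1); last first.
  by move=> [z|b] k; rewrite mem_filter => /andP[/= hM _] //; rewrite hM.
apply: avgs_le => [i k|s]; first exact: p'L.1.
apply: avgs_thin => //.
- move=> i k; rewrite mem_filter => /andP[]; case: i => [z|b] //=.
    by move=> /negbTE -> _.
  by move=> _ /mapP[].
- by move=> t; rewrite /F; case: (A t); [right|left].
- move=> t Ft; exists l0; split; last first.
    rewrite (_ : [seq i <- l0 | i \notin l0] = [::]) //.
    by apply/eqP; rewrite -(negbK (_ == _)) -has_filter; apply/hasPn => i ->.
  have -> : size l0 = size [seq z <- cells_in n | coarse L z \notin Ms].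
    by rewrite /l0 /lx filter_map size_map.
  apply: uniq_leq_size; first by rewrite filter_uniq // undup_uniq.
  move=> z; rewrite mem_filter cells_inP mem_filter => /andP[+ zb].
  rewrite zb andbT negbK => /asboolP /NRb zz0.
  by apply/flatten_mapP; exists (coarse L z) => //; rewrite subcellsP.
Qed.
End FiniteVolume.

(** * From points to cells and back *)

Section CountInjections.
Local Open Scope card_scope.
Variables (T : choiceType) (m : nat).
Implicit Types A : set T.

Lemma tcount_card_le A : `I_(tcount m A) #<= A.
Proof.
have := tcount_le m A; rewrite leq_eqVlt => /orP[/eqP tm|tm]; last first.
  by have /(tcountP A tm)/card_eqPle[] := erefl (tcount m A).
rewrite tm; have [[n An]|infA] := pselect (exists n, A #= `I_n).
  have mn : (m <= n)%N.
    rewrite leqNgt; apply/negP => nm; have /(tcountP A nm) := An.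
    by rewrite tm => mn; rewrite mn ltnn in nm.
  have /card_eqPle[_ h] := An; apply: card_le_trans h; by rewrite card_le_II.
have : infinite_set A by move/finite_setP.
by rewrite infiniteP; apply: card_le_trans; apply: subset_card_le.
Qed.

Lemma tcount_enum (x0 : T) A : exists f : nat -> T, (forall j, (j < tcount m A)%N -> A (f j)) /\
  forall j k, (j < tcount m A)%N -> (k < tcount m A)%N -> f j = f k -> j = k.
Proof.
pose T' : pointedType := HB.pack T (isPointed.Build T x0).
have /(@ppcard_leP nat T' _ A)[f] := tcount_card_le A.
exists f; split=> [j jt|j k jt kt]; first exact: (@funS _ _ _ _ f).
by apply: (@inj _ _ _ f); rewrite inE.
Qed.

Lemma tcount_ge A (n : nat) (v : 'I_n -> T) (J : {set 'I_n}) :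
  (#|J| <= m)%N -> injective v -> (forall i, i \in J -> A (v i)) -> (#|J| <= tcount m A)%N.
Proof.
move=> Jm vi vA; have := tcount_le m A; rewrite leq_eqVlt => /orP[/eqP -> //|tm].
have /(tcountP A tm)/card_eqPle[Ak _] := erefl (tcount m A).
rewrite -card_le_II; apply: card_le_trans Ak.
have [->|/set0Pn[i0 _]] := eqVneq J finset.set0.
  by rewrite cards0 (_ : `I_0 = set0) ?card_le0x // -subset0 => x.
pose g (j : nat) : T := v (nth i0 (enum J) j).
have gi : {in `I_#|J| &, injective g}.
  move=> j k; rewrite !inE /= => jJ kJ /vi /eqP.
  by rewrite nth_uniq ?enum_uniq -?cardE // => /eqP.
have /card_eqPle[_ h] := inj_card_eq gi; apply: card_le_trans h _.
apply: subset_card_le => _ [j /= jJ <-]; apply: vA.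
by rewrite -mem_enum mem_nth // -cardE.
Qed.
End CountInjections.

Section Konig.
Variables (X : Type) (T : seq X -> Prop).

(** The tree is a prefix-closed predicate on sequences, finite at each level. The branch runs
    through sequences with extensions of every length: if no child of such a sequence had this
    property, the heights above its finitely many children would be bounded. *)
Lemma konig (B : nat -> set X) : (forall n, finite_set (B n)) ->
  (forall s x, T (rcons s x) -> T s) -> (forall s x, T (rcons s x) -> B (size s) x) ->
  (forall N, exists s, T s /\ size s = N) ->
  exists f : nat -> X, forall n, T (mkseq f n).
Proof.
move=> Bf Tpre TB Tinf.
have Tcat s t : T (s ++ t) -> T s.
  elim/last_ind: t => [|t x IH]; first by rewrite cats0.
  by rewrite -rcons_cat => /Tpre.
pose ext s := forall N, exists t, T (s ++ t) /\ size t = N.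
have step s : ext s -> exists x, ext (rcons s x).
  move=> es; apply: contrapT => /forallNP h.
  have h' x : exists N, forall t, T (rcons s x ++ t) -> size t <> N.
    apply: contrapT => /forallNP h2; apply: (h x) => N.
    have /existsNP[t /not_implyP[Tt /contrapT st]] := h2 N. by exists t.
  have [N NP] := choice h'.
  have [M MP] : exists M, forall x, B (size s) x -> (N x <= M)%N.
    have /finite_seqP[l lE] := finite_image N (Bf (size s)).
    exists (\max_(i <- l) i)%N => x Bx.
    have : N x \in [set` l] by rewrite -lE inE; exists x.
    rewrite inE /= => xl; exact: (@leq_bigmax_seq _ l xpredT id (N x)).
  have [t [Tt st]] := es M.+1.
  case: t Tt st => // x t; rewrite -cat_rcons => Tt [st].
  have Bx : B (size s) x by apply: TB; exact: Tcat Tt.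
  have := NP x (take (N x) t); apply; last by rewrite size_take st; case: ltngtP (MP x Bx).
  by apply: (@Tcat _ (drop (N x) t)); rewrite -catA cat_take_drop.
have e0 : ext [::] by move=> N; have [t ?] := Tinf N; exists t.
have [g gP] := @choice {s | ext s} X (fun s x => ext (rcons (sval s) x))
  (fun s => step _ (proj2_sig s)).
pose S := fix S n : {s | ext s} := if n is k.+1 then
  exist _ (rcons (sval (S k)) (g (S k))) (gP (S k)) else exist _ [::] e0.
exists (fun n => g (S n)) => n.
have -> : mkseq (fun n => g (S n)) n = sval (S n).
  elim: n => //= n IH; by rewrite /mkseq -addn1 iotaD map_cat -/(mkseq _ n) IH cats1.
have := proj2_sig (S n) 0%N => -[t [Tt _]]; exact: Tcat Tt.
Qed.
End Konig.

(** * From face percolation to distant connections of cells *)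

Section FaceToCells.
Variables (R : realType) (D d L : nat) (h : R).
Local Notation Z := {ffun 'I_D -> int}.
Local Notation I := (Z + Z)%type.
Local Notation pt := 'rV[R]_D.
Local Notation m := d.+1.
Hypotheses (h0 : 0 < h) (L0 : (0 < L)%N).
Variable Lam : set pt.

Definition counts (b : nat) : I -> nat :=
  fun i => if i is inl z then tcount m (Lam `&` cell h z) else b.

Local Notation reachZ b := (@reach Z Z d (coarse L) (nr h) (nr (h * L%:R)) (counts b)).

Lemma valid_counts b (v : 'I_d.+1 -> pt) : injective v -> (forall i, Lam (v i)) ->
  (forall i j, Defs.edist (v i) (v j) <= 1) ->
  valid (nr h) (counts b) (fun i => cell_of h (v i)).
Proof.
move=> vi vL v1; split=> [i j|z] /=.
  by exists (v i), (v j); split => //; exact: cell_ofP.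
apply: (@tcount_ge pt m _ _ v) => //.
  by rewrite -[X in (_ <= X)%N](card_ord m) max_card.
by move=> i; rewrite inE => /eqP iz; split => //; apply/cellP.
Qed.

(* The points need not be in general position: consecutive simplices, and two
   representations of the same simplex, share a vertex by [hull_common]. *)
Lemma face_reach : (0 < d)%N -> (forall z, finite_set (Lam `&` cell h z)) ->
  face_percolates Lam d -> exists z0, forall n, percZ d L h n z0 (counts 0).
Proof.
move=> d0 lf [s [si [ss sa]]].
have [v0 [v0i [v0L [v01 v0s]]]] := ss 0%N.
pose z0 := coarse L (cell_of h (v0 ord0)); exists z0.
have rep (v : 'I_d.+1 -> pt) S : simplex_with Lam v S -> valid (nr h) (counts 0) (fun i => cell_of h (v i)).
  by move=> [vi [vL [v1 _]]]; exact: valid_counts.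
have lk (v w : 'I_d.+1 -> pt) (U V : set pt) : U !=set0 -> U `<=` range v -> V `<=` range w ->
    hull U = hull V ->
    link (coarse L) (nr (h * L%:R)) (counts 0) (fun i => cell_of h (v i)) (fun i => cell_of h (w i)).
  move=> U0 Uv Vw UV; have [x [Ux Vx]] := hull_common U0 Uv UV.
  have [i _ vi] := Uv _ Ux; have [j _ wj] := Vw _ Vx.
  left; exists (coarse L (cell_of h x)); split; first by exists i; rewrite vi.
  by exists j; rewrite wj.
have rng (v : 'I_d.+1 -> pt) : range v !=set0 by exists (v ord0), ord0.
have rc k (v : 'I_d.+1 -> pt) : simplex_with Lam v (s k) -> reachZ 0 z0 (fun i => cell_of h (v i)).
  elim: k v => [|k IH] v vs.
    apply: (@reach_step _ _ _ _ _ _ _ _ (fun i => cell_of h (v0 i))).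
    - apply: reach_start; last by exists ord0.
      exact: (rep v0 (s 0%N)).
    - exact: rep vs.
    - apply: (lk v0 v (range v0) (range v)) => //.
      by case: vs => _ [_ [_ <-]].
  have [a [b [U [V [sa' [sb [Ua [cU [Vb [cV UV]]]]]]]]]] := sa k.
  have U0 : U !=set0.
    apply/set0P/eqP => U0; have : (`I_d #= `I_0)%card.
      apply: (card_eq_trans (card_esym cU)); rewrite U0 (_ : `I_0 = set0) //.
      by rewrite -subset0 => x.
    by move/card_eq_II => d00; rewrite d00 in d0.
  have rb : reachZ 0 z0 (fun i => cell_of h (b i)).
    apply: (@reach_step _ _ _ _ _ _ _ _ (fun i => cell_of h (a i))); first exact: IH.
      exact: rep sb.
    exact: lk U0 Ua Vb UV.
  apply: (reach_step rb); first exact: rep vs.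
  apply: (lk b v (range b) (range v)) => //.
  by case: vs => _ [_ [_ <-]]; case: sb => _ [_ [_ <-]].
(* Otherwise all vertices lie in a bounded region, hence in a finite set [l], which spans only
   finitely many simplices. *)
move=> n; apply: contrapT => np.
have inF k (v : 'I_d.+1 -> pt) : simplex_with Lam v (s k) -> forall i, coarse L (cell_of h (v i)) \in ball n (origin D).
  move=> vs i; apply: contrapT => /negP nb; apply: np.
  by exists (fun i => cell_of h (v i)); split; [exact: (rc k)|exists i].
pose F : set pt := \bigcup_(z in [set` cells_in D L n]) (Lam `&` cell h z).
have [l lE] : exists l : seq pt, F = [set` l].
  apply/finite_seqP; apply: bigcup_finite => // z _; exact: lf.
have rl k (v : 'I_d.+1 -> pt) i : simplex_with Lam v (s k) -> v i \in l.
  move=> vs; have : F (v i).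
    exists (cell_of h (v i)).
      by rewrite /= cells_inP // (inF k v vs).
    by split; [case: vs => _ [vL _]; exact: vL|exact: cell_ofP].
  by rewrite lE.
have ex k : exists f : {ffun 'I_d.+1 -> 'I_(size l)},
    s k = hull (range (fun i => nth 0 l (f i))).
  have [v vs] := ss k.
  have il i : (index (v i) l < size l)%N by rewrite index_mem (rl k v i vs).
  exists [ffun i => Ordinal (il i)].
  rewrite (_ : (fun i => _) = v); first by have [_ [_ [_ ->]]] := vs.
  by apply/funext => i; rewrite ffunE /= nth_index // (rl k v i vs).
have [g gP] := choice ex.
have gi : injective g by move=> j k gjk; apply: si; rewrite !gP gjk.
pose N := #|{: {ffun 'I_d.+1 -> 'I_(size l)}}|.
have gi' : injective (fun i : 'I_N.+1 => g i) by move=> i j /gi /val_inj.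
by have := leq_card _ gi'; rewrite card_ord ltnn.
Qed.

Lemma counts_le_full b (i : I) : (counts b i <= full d b i)%N.
Proof. by case: i => [z|z] //=; exact: tcount_le. Qed.

End FaceToCells.

Section SourceProbability.
Local Open Scope card_scope.
Variables (R : realType) (D d L : nat) (h lam : R).
Variables (dsp : measure_display) (Omega : measurableType dsp).
Variables (P : probability Omega R) (X : Omega -> set 'rV[R]_D).
Local Notation Z := {ffun 'I_D -> int}.
Local Notation I := (Z + Z)%type.
Local Notation m := d.+1.
Hypotheses (h0 : 0 < h) (L0 : (0 < L)%N) (lam0 : 0 < lam).
Hypothesis XP : is_PPP P X lam.
Let N z om k := (X om `&` cell h z) #= `I_k.
Let cnt z om := tcount m (X om `&` cell h z).
Let t := lam * h ^+ D.

Lemma t_gt0 : 0 < t. Proof. by rewrite mulr_gt0 // exprn_gt0. Qed.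

Lemma prob_cells (n : nat) (s : I -> nat) (B : (I -> nat) -> bool) :
  let E := [set om | B (observe inl cnt (cells_in D L n) om s)] in
  measurable E /\ P E = (avgs m (fun=> trunc_law m (pois t)) (map inl (cells_in D L n))
    (fun s => (B s)%:R) s)%:E.
Proof.
apply: (@law_observe R dsp Omega P Z I inl m N cnt (pois t)) => //.
- by move=> z om k km; exact: tcountP.
- by move=> z om; exact: tcount_le.
- by move=> l f ul; exact: ppp_cells.
- exact: undup_uniq.
Qed.

Lemma observe_counts n om b z : z \in cells_in D L n ->
  observe inl cnt (cells_in D L n) om (full d b) (inl z) = counts d h (X om) b (inl z).
Proof.
by move=> zn; rewrite observe_in ?undup_uniq // => x y [].
Qed.

Lemma observe_full n om b i : (forall z, z \in cells_in D L n -> i <> inl z) ->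
  observe inl cnt (cells_in D L n) om (full d b) i = full d b i.
Proof. exact: observe_out. Qed.

Lemma counts_le_observe n om b : cfgle (counts d h (X om) b)
  (observe inl cnt (cells_in D L n) om (full d b)).
Proof.
move=> i; have [[z zn ->]|ni] := pselect (exists2 z, z \in cells_in D L n & i = inl z).
  by rewrite observe_counts.
rewrite observe_full; first exact: counts_le_full.
by move=> z zn iz; apply: ni; exists z.
Qed.

(** [is_PPP] speaks of finite counts only; a count is almost surely finite because the Poisson
    masses sum to 1. *)
Lemma locally_finite_as (z : Z) :
  measurable [set om | finite_set (X om `&` cell h z)] /\
  P (~` [set om | finite_set (X om `&` cell h z)]) = 0%E.
Proof.
pose E k := [set om | N z om k].
have EP k : measurable (E k) /\ P (E k) = (pois t k)%:E.
  have [] := @ppp_cells R D dsp Omega P X lam h lam0 h0 XP [:: z] (fun=> k) isT.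
  rewrite big_seq1 (_ : mkset _ = E k) //; apply/seteqP; split => om /=.
    by apply; rewrite inE.
  by move=> H y; rewrite inE => /eqP ->.
have FE : [set om | finite_set (X om `&` cell h z)] = \bigcup_k E k.
  by apply/seteqP; split => om /= => [/finite_setP[k Ek]|[k _ Ek]]; [exists k|apply/finite_setP; exists k].
have mF : measurable [set om | finite_set (X om `&` cell h z)].
  by rewrite FE; apply: bigcup_measurable => k _; exact: (EP k).1.
split => //; apply/eqP; rewrite eq_le measure_ge0 andbT.
apply/lee_addgt0Pr => e e0; rewrite add0e.
have [M Me] : exists M, ptail M t <= e.
  have /cvgrPdist_le/(_ e e0) := ptail_cvg (ltW t_gt0).
  case=> M _ /(_ M (leqnn _)); rewrite sub0r normrN ger0_norm ?ptail_ge0 //; last exact: ltW t_gt0.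
  by exists M.
pose G := \big[setU/set0]_(k < M) E k.
have mG : measurable G by apply: bigsetU_measurable => k _; exact: (EP k).1.
have PG : P G = (\sum_(k < M) pois t k)%:E.
  transitivity (\sum_(k < M) P (E k))%E; last by rewrite -sumEFin; apply: eq_bigr => k _; rewrite (EP k).2.
  apply: measure_semi_additive_ord_I => //; first by move=> k _; exact: (EP k).1.
  by move=> j k _ _ [om [Ej Ek]]; exact: card_II_uniq Ej Ek.
apply: (@le_trans _ _ (P (~` G))).
  apply: le_measure; rewrite ?inE; [exact: measurableC|exact: measurableC|].
  apply: subsetC; rewrite FE /G -bigcup_mkord => om [k kM Ek]; by exists k.
by rewrite probability_setC // PG -EFinB lee_fin.
Qed.

(** The starting cell depends on the outcome, but there are countably many cells, so one of them
    works for all [n] with positive probability, which is [c]. Counts outside the box are replaced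
    by full cells, which only helps. *)
Lemma source_bound (rho : nat) : (0 < d)%N ->
  measurable [set om | face_percolates (X om) d] ->
  (0 < P [set om | face_percolates (X om) d])%E ->
  exists (z0 : Z) (c : R), 0 < c /\ forall n, c <=
    avgs m (fun=> trunc_law m (pois t)) (map inl (cells_in D L n))
      (fun s => `[< percZ d L h (n + rho) z0 s >]%:R) (full d 0).
Proof.
move=> d0 mF PF.
pose A z0 n := [set om | `[< percZ d L h (n + rho) z0
   (observe inl cnt (cells_in D L n) om (full d 0)) >]].
have AP z0 n : measurable (A z0 n) /\ P (A z0 n) = _ :=
  prob_cells n (full d 0) (fun s => `[< percZ d L h (n + rho) z0 s >]).
pose C z0 := \bigcap_n A z0 n.
have mC z0 : measurable (C z0) by apply: bigcapT_measurable => n; exact: (AP z0 n).1.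
pose nf j := if unpickle j is Some z then
  ~` [set om | finite_set (X om `&` cell h (z : Z))] else set0.
pose Cj j := if unpickle j is Some z then C z else set0.
have [z0 Cz] : exists z0, (0 < P (C z0))%E.
  apply: contrapT => /forallNP hn; move: PF; apply/negP; rewrite -leNgt.
  have n1 : P.-negligible (\bigcup_j nf j).
    apply: negligible_bigcup => j; rewrite /nf; case: unpickle => [z|]; last exact: negligible_set0.
    have [mz Pz] := locally_finite_as z.
    by apply/negligibleP => //; exact: measurableC.
  have n2 : P.-negligible (\bigcup_j Cj j).
    apply: negligible_bigcup => j; rewrite /Cj; case: unpickle => [z|]; last exact: negligible_set0.
    apply/negligibleP => //; apply/eqP; rewrite eq_le measure_ge0 andbT leNgt.
    by apply/negP; exact: hn.
  have : P.-negligible [set om | face_percolates (X om) d].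
    apply: negligibleS (negligibleU n1 n2) => om /= Fom.
    have [nfo|lf] := pselect (exists z : Z, ~ finite_set (X om `&` cell h z)).
      left; case: nfo => z nz; exists (pickle z) => //; by rewrite /nf pickleK.
    right; have [|z0 z0P] := @face_reach R D d L h h0 L0 (X om) d0 _ Fom.
      by move=> z; apply: contrapT => nz; apply: lf; exists z.
    exists (pickle z0) => //; rewrite /Cj pickleK => n _; rewrite /A /=; apply/asboolP.
    by apply: percZ_mono (z0P (n + rho)%N); exact: counts_le_observe.
  by move/negligibleP => /(_ mF) ->.
exists z0, (fine (P (C z0))).
have Pfin : P (C z0) \is a fin_num by exact: fin_num_measure.
split; first by rewrite -lte_fin fineK.
move=> n; rewrite -lee_fin fineK // -(AP z0 n).2.
by apply: le_measure; rewrite ?inE //; [exact: (AP z0 n).1|exact: bigcap_inf].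
Qed.
End SourceProbability.

(** * From connections of cells to *-percolation *)

Section CellsToStar.
Variables (R : realType) (D d L rho : nat) (h g r0 : R).
Local Notation Z := {ffun 'I_D -> int}.
Local Notation I := (Z + Z)%type.
Local Notation pt := 'rV[R]_D.
Local Notation m := d.+1.
Hypotheses (h0 : 0 < h) (L0 : (0 < L)%N) (g01 : 0 < g <= 1).
Hypothesis gh : g * (1 + 2 * (D%:R * h)) <= 1.
Hypothesis r0P : 2 + 3 * (D%:R * (h * L%:R)) <= r0.
Hypothesis rhoP : (h * L%:R)^-1 + 1 <= rho%:R.
Variables (Lam : set pt) (z0 : Z).

Let g0 : 0 < g. Proof. by case/andP: g01. Qed.
Let hL0 : 0 < h * L%:R. Proof. by rewrite mulr_gt0 // ltr0n. Qed.
Let gh0 : 0 < g * h. Proof. by rewrite mulr_gt0. Qed.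

Local Notation t1 := (counts d (g * h) Lam 1).
Local Notation validZ := (@valid Z Z d (nr h)).
Local Notation linkZ := (@link Z Z d (coarse L) (nr (h * L%:R))).
Local Notation reachZ := (@reach Z Z d (coarse L) (nr h) (nr (h * L%:R))).
Implicit Types (c : 'I_d.+1 -> Z).

Let NRb (C C' : Z) : nr (h * L%:R) C C' -> C' \in ball rho C.
Proof. exact: nr_ball. Qed.

Let valid_near s c i j : validZ s c -> coarse L (c j) \in ball rho (coarse L (c i)).
Proof. by move=> [v _]; apply: NRb; exact: nr_coarse. Qed.

Let link_near s c c' : linkZ s c c' ->
  exists i j, coarse L (c' j) \in ball (rho + rho) (coarse L (c i)).
Proof.
move=> [[C [[i ci] [j cj]]]|[C [_ [[i ci] [j cj]]]]]; exists i, j.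
  by rewrite ci cj ball_refl.
by apply: ball_trans (NRb ci) _; apply: NRb; exact: nr_sym.
Qed.

(* Simplices are rebuilt from fixed enumerations [pts z] of points of the cells;
   vertices in a common cell are told apart by their [rank]. *)
Let pts : Z -> nat -> pt := projT1 (choice (fun z =>
  tcount_enum m (0 : pt) (Lam `&` cell (g * h) z))).

Let ptsP z : (forall j, (j < t1 (inl z))%N -> (Lam `&` cell (g * h) z) (pts z j)) /\
  forall j k, (j < t1 (inl z))%N -> (k < t1 (inl z))%N -> pts z j = pts z k -> j = k.
Proof. exact: (projT2 (choice (fun z => tcount_enum m (0 : pt) (Lam `&` cell (g * h) z)))). Qed.

Let rank c (i : 'I_d.+1) := #|[set j : 'I_d.+1 | (j < i)%N && (c j == c i)]%SET|.
Let place c (i : 'I_d.+1) : pt := pts (c i) (rank c i).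
Let simp c : set pt := hull (range (place c)).

Let rank_lt c i : validZ t1 c -> (rank c i < t1 (inl (c i)))%N.
Proof.
move=> [_ v2]; apply: leq_trans (v2 (c i)); apply: proper_card; apply/properP; split.
  by apply/fintype.subsetP => j; rewrite !inE => /andP[].
by exists i; rewrite !inE ?eqxx // ltnn.
Qed.

Let place_in c i : validZ t1 c -> (Lam `&` cell (g * h) (c i)) (place c i).
Proof. by move=> v; apply: (ptsP _).1; exact: rank_lt. Qed.

Let place_cell c i : validZ t1 c -> cell_of (g * h) (place c i) = c i.
Proof. by move=> v; apply/cellP => //; have [] := place_in i v. Qed.

Let place_inj c : validZ t1 c -> injective (place c).
Proof.
move=> v; have lt (i j : 'I_d.+1) : (i < j)%N -> c i = c j -> (rank c i < rank c j)%N.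
  move=> ij cij; apply: proper_card; apply/properP; split.
    apply/fintype.subsetP => k; rewrite !inE => /andP[ki /eqP ->]; rewrite cij eqxx andbT.
    exact: ltn_trans ki ij.
  by exists i; rewrite !inE ?ltnn // ij cij eqxx.
move=> i j pij; have cij : c i = c j by rewrite -(place_cell i v) -(place_cell j v) pij.
have rij : rank c i = rank c j.
  apply: (ptsP (c i)).2; [exact: rank_lt|by rewrite cij; exact: rank_lt|].
  by move: pij; rewrite /place cij.
apply: val_inj => /=; case: (ltngtP i j) => // [/lt/(_ cij)|/lt/(_ (esym cij))].
  by rewrite rij ltnn.
by rewrite rij ltnn.
Qed.

Let simp_simplex c : validZ t1 c -> is_simplex Lam d (simp c).
Proof.
move=> v; exists (place c); split; first exact: place_inj.
split; first by move=> i; case: (place_in i v).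
split => // i j; apply: (nr_dist h0 g0 gh (v.1 i j)).
  by case: (place_in i v).
by case: (place_in j v).
Qed.

Let simp_common c c' : validZ t1 c -> validZ t1 c' -> simp c = simp c' ->
  exists i j, c i = c' j.
Proof.
move=> v v' e; have [|x [[i _ ix] [j _ jx]]] :=
  @hull_common R D d.+1 (place c) (range (place c)) (range (place c')) _ (@subset_refl _ _) e.
  by exists (place c ord0), ord0.
by exists i, j; rewrite -(place_cell i v) -(place_cell j v') ix jx.
Qed.

Let link_dist c c' : validZ t1 c -> validZ t1 c' -> linkZ t1 c c' ->
  set_dist (simp c) (simp c') <= r0.
Proof.
move=> v v' lk.
have sub (A : set pt) : A `<=` hull A.
  move=> x Ax; exists 1%N, (fun=> x), (fun=> 1); split => //; split => // ; split.
    by rewrite big_ord1.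
  by rewrite big_ord1 scale1r.
have [i [j ij]] : exists i j, Defs.edist (place c i) (place c' j) <= r0.
  have inC c1 i : validZ t1 c1 -> cell (g * (h * L%:R)) (coarse L (c1 i)) (place c1 i).
    by move=> vc1; rewrite mulrA; apply: cell_coarse => //; case: (place_in i vc1).
  case: lk => [[C [[i ci] [j cj]]]|[C [_ [[i ci] [j cj]]]]]; exists i, j.
    have ghL0 : 0 <= g * (h * L%:R) by rewrite mulr_ge0 // ltW.
    have h1 := inC c i v; have h2 := inC c' j v'.
    rewrite ci in h1; rewrite cj in h2; apply: le_trans (cell_diam ghL0 h1 h2) _.
    apply: le_trans r0P; have D0 : 0 <= D%:R * (h * L%:R) by rewrite mulr_ge0 // ltW.
    have : D%:R * (g * (h * L%:R)) <= D%:R * (h * L%:R).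
      by apply: ler_wpM2l => //; apply: ler_piMl; [exact: ltW|case/andP: g01].
    by lra.
  apply: le_trans r0P; exact: (nr_dist2 hL0 g01 ci cj (inC c i v) (inC c' j v')).
apply: le_trans ij; apply: ge_inf.
  by exists 0 => _ [x _ [y _ <-]]; exact: euclid_ge0.
exists (place c i); first by apply: sub; exists i.
by exists (place c' j) => //; apply: sub; exists j.
Qed.

(* Distinct tuples may span the same set, so Koenig's lemma is applied to the
   graph of the sets themselves; its balls are finite because tuples spanning the
   same set have a cell in common. *)
Let E (S S' : set pt) : bool := `[< exists c c', [/\ validZ t1 c, validZ t1 c', linkZ t1 c c',
  S = simp c & S' = simp c'] >].
Let startS (S : set pt) : Prop := exists c, [/\ validZ t1 c, touch (coarse L) c z0 & S = simp c].

(** Initially [rho] is spent inside [c0] and [rho] inside [c]. A further set costs [2 * rho] for the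
    link, [rho] inside the tuple linked to and [rho] inside another tuple with the same hull;
    [5 * rho] leaves a margin. *)
Let level S p c k : startS S -> path E S p -> validZ t1 c -> simp c = last S p ->
  coarse L (c k) \in ball (2 * rho + 5 * rho * size p) z0.
Proof.
move=> [c0 [v0 [i0 ti0] ->]]; elim/last_ind: p c k => [|p S' IH] c k /=.
  move=> _ vc e; rewrite muln0 addn0 mul2n -addnn.
  have [i [j ij]] := simp_common vc v0 e.
  apply: (ball_trans (C' := coarse L (c i))); last exact: valid_near vc.
  by rewrite ij -ti0; exact: valid_near v0.
rewrite rcons_path last_rcons => /andP[pp /asboolP[c1 [c2 [v1 v2 lk e1 ->]]]] vc e.
have [i [j ij]] := simp_common vc v2 e.
have [a [b ab]] := link_near lk.
have H1 := IH c1 a pp v1 (esym e1).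
have H2 := ball_trans H1 ab.
have H3 := ball_trans H2 (valid_near b j v2).
rewrite -ij in H3.
have H4 := ball_trans H3 (valid_near i k vc).
apply: ball_le H4; rewrite size_rcons mulnS.
move: (5 * rho * size p)%N => X; clear; lia.
Qed.

Let reach_path c : reachZ t1 z0 c -> exists S p, [/\ startS S, path E S p & last S p = simp c].
Proof.
elim=> {c} [c v tc|c c' rc [S [p [sS pp lp]]] v' lk].
  by exists (simp c), [::]; split => //; exists c.
exists S, (rcons p (simp c')); split => //; last by rewrite last_rcons.
rewrite rcons_path pp lp /=; apply/asboolP; exists c, c'; split => //; exact: reach_valid rc.
Qed.

(** The full cells outside the box are artificial. A connection that never leaves the box has true
    counts; the first time it leaves, the tuple before is genuine and already close to the boundary,
    since a link and a tuple together span at most [3 * rho]. *)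
Let genuine n s c : z0 \in ball (n - rho)%N (origin D) -> (4 * rho <= n)%N ->
  (forall z, coarse L z \in ball n (origin D) -> s (inl z) = t1 (inl z)) ->
  (forall b, s (inr b) = 1%N) -> reachZ s z0 c ->
  reachZ t1 z0 c \/ exists u i, reachZ t1 z0 u /\ coarse L (u i) \notin ball (n - 4 * rho)%N (origin D).
Proof.
move=> z0n rn sE sb.
have vt u : validZ s u -> (forall i, coarse L (u i) \in ball n (origin D)) -> validZ t1 u.
  move=> [v1 v2] un; split => // z; case: (boolP [exists i, u i == z]) => [/existsP[i /eqP iz]|].
    by rewrite -sE ?v2 // -iz.
  rewrite negb_exists => /forallP nz; rewrite (_ : [set i | u i == z]%SET = finset.set0) ?cards0 //.
  by apply/setP => i; rewrite !inE (negbTE (nz i)).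
elim=> {c} [c v [i ti]|c c' rc IH v' lk].
  left; apply: reach_start; last by exists i.
  apply: vt => // j; have := ball_trans z0n (_ : coarse L (c j) \in ball rho z0).
  rewrite subnK; last by move: rn; clear; lia.
  by apply; rewrite -ti; exact: valid_near v.
case: IH => [r|[u [i ui]]]; last by right; exists u, i.
have lk1 : linkZ t1 c c'.
  by case: lk => [|[C hC]]; [left|right; exists C; case: hC => _ hC].
have [cn|] := boolP [forall j, coarse L (c' j) \in ball n (origin D)].
  by left; apply: (reach_step r) => //; apply: vt => // j; exact: (forallP cn).
rewrite negb_forall => /existsP[j jn]; right.
have [a [b ab]] := link_near lk1; exists c, a; split => //.
apply: contra jn => an; have H1 := ball_trans (ball_trans an ab) (valid_near b j v').
by apply: ball_le H1; move: rn; clear; lia.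
Qed.

(** Genuine tuples are reached arbitrarily far from [z0], which forces simple paths of sets of every
    length; Koenig's lemma then gives an infinite simple path. *)
Lemma star_of_perc :
  (forall n, exists s, [/\ forall z, coarse L z \in ball n (origin D) -> s (inl z) = t1 (inl z),
     forall b, s (inr b) = 1%N & percZ d L h (n + rho) z0 s]) ->
  star_percolates Lam d r0.
Proof.
move=> H; pose B := (\sum_(i < D) absz (z0 i))%N.
have z0B : z0 \in ball B (origin D).
  apply/ballP => i; rewrite ffunE sub0r normrN.
  by rewrite -abszE lez_nat /B (bigD1 i) //= leq_addr.
have unb N : exists u i, reachZ t1 z0 u /\ coarse L (u i) \notin ball N (origin D).
  pose n := (B + N + 5 * rho)%N; have [s [sE sb [c [rc [i fi]]]]] := H n.
  have [n1 n2 n3 n4] : [/\ (B <= n - rho)%N, (4 * rho <= n)%N, (N <= n + rho)%N & (N <= n - 4 * rho)%N].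
    by rewrite /n; move: (B); clear=> B'; split; lia.
  have z0n : z0 \in ball (n - rho)%N (origin D) by apply: ball_le z0B.
  case: (genuine z0n n2 sE sb rc) => [r|[u [j [ru uj]]]].
    by exists c, i; split => //; apply: contra fi; apply: ball_le.
  by exists u, j; split => //; apply: contra uj; apply: ball_le.
pose T (s : seq (set pt)) : Prop :=
  if s is S0 :: p then [/\ startS S0, path E S0 p & uniq (S0 :: p)] else True.
pose l K := flatten [seq subcells L C | C <- ball K z0].
pose Bd n : set (set pt) := simp @` [set c | forall k, coarse L (c k) \in ball (2 * rho + 5 * rho * n) z0].
have [f fT] : exists f : nat -> set pt, forall n, T (mkseq f n).
  apply: (@konig _ T Bd).
  - move=> n; pose K := (2 * rho + 5 * rho * n)%N.
    pose G (f : {ffun 'I_d.+1 -> 'I_(size (l K))}) := simp (fun i => nth z0 (l K) (f i)).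
    apply: (@sub_finite_set _ _ (G @` setT)); last exact/finite_image/finite_finset.
    move=> _ [c /= cK <-].
    have cl i : c i \in l K by apply/flatten_mapP; exists (coarse L (c i)) => //; rewrite subcellsP.
    have il i : (index (c i) (l K) < size (l K))%N by rewrite index_mem.
    exists [ffun i => Ordinal (il i)] => //; rewrite /G; congr simp.
    by apply/funext => i; rewrite ffunE /= nth_index.
  - move=> [|S p] x //=; rewrite rcons_path mem_rcons inE negb_or rcons_uniq.
    by move=> [sS /andP[-> _] /and3P[/andP[_ ->] _ ->]].
  - move=> s x Ts; have [S [p [sE sS pp]]] : exists S p, [/\ rcons s x = S :: p, startS S & path E S p].
      by case: s Ts => [|S p] /= [sS pp _]; [exists x, [::]|exists S, (rcons p x)].
    have lx : last S p = x by have := congr1 (last S) sE; rewrite last_rcons.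
    have sz : size p = size s by have := congr1 size sE; rewrite size_rcons => -[].
    have [c vc cx] : exists2 c, validZ t1 c & simp c = last S p.
      case/lastP: p pp {sE lx sz} => [_|p y]; first by case: sS => c [vc _ ->]; exists c.
      rewrite rcons_path last_rcons => /andP[_ /asboolP[c1 [c2 [_ v2 _ _ ->]]]]; by exists c2.
    exists c; last by rewrite cx.
    by move=> k /=; rewrite -sz; exact: level sS pp vc cx.
  (* By [level], a path with fewer than [N] steps cannot end outside this radius, even after its
     loops are erased. *)
  - move=> N; have [u [i [ru ui]]] := unb (B + (2 * rho + 5 * rho * N))%N.
    have [S [p [sS pp lp]]] := reach_path ru.
    case: (shortenP pp) lp => p' pp' up' _ lp.
    have Np : (N <= size p')%N.
      rewrite leqNgt; apply/negP => pN; move/negP: ui; apply.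
      have H1 := level i sS pp' (reach_valid ru) (esym lp).
      apply: ball_le (ball_trans z0B H1); rewrite leq_add2l leq_add2l leq_mul2l ltnW ?orbT //.
    case: N Np {ui} => [|N] Np; first by exists [::].
    exists (S :: take N p'); split; last by rewrite /= size_takel // ltnW.
    split=> //; first exact: take_path.
    by have := take_uniq N.+1 up'.
have fE n : E (f n) (f n.+1).
  have [_ /(pathP set0)/(_ n) + _] : T (f 0%N :: map f (iota 1 n.+1)) := fT n.+2.
  rewrite size_map size_iota ltnSn => /(_ isT).
  have fn k : (k <= n)%N -> nth set0 (map f (iota 1 n.+1)) k = f k.+1.
    by move=> kn; rewrite (nth_map 0%N) ?size_iota // nth_iota.
  by case: n fn => [|n] fn; rewrite ?[nth _ (_ :: _) _]fn //= fn.
exists f; split.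
  move=> j k; have : uniq (mkseq f (maxn j k).+1) by case: (fT (maxn j k).+1).
  move=> /mkseq_uniqP; apply.
    by rewrite inE /= ltnS leq_maxl.
  by rewrite inE /= ltnS leq_maxr.
split=> n; have /asboolP[c [c' [v v' lk e e']]] := fE n.
  by rewrite e; exact: simp_simplex.
by rewrite e e'; exact: link_dist.
Qed.

End CellsToStar.

Section TargetProbability.
Variables (R : realType) (D d L rho : nat) (h g r0 lam : R).
Variables (dsp : measure_display) (Omega : measurableType dsp).
Variables (P : probability Omega R) (X : Omega -> set 'rV[R]_D).
Local Notation Z := {ffun 'I_D -> int}.
Local Notation m := d.+1.
Hypotheses (h0 : 0 < h) (L0 : (0 < L)%N) (g01 : 0 < g <= 1) (lam0 : 0 < lam).
Hypothesis gh : g * (1 + 2 * (D%:R * h)) <= 1.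
Hypothesis r0P : 2 + 3 * (D%:R * (h * L%:R)) <= r0.
Hypothesis rhoP : (h * L%:R)^-1 + 1 <= rho%:R.
Hypothesis XP : is_PPP P X lam.

(** As [n] grows, artificially full cells regain their true counts and the target moves away, so the
    events decrease. Their intersection keeps probability at least [c], and on it there is
    *-percolation. *)
Lemma target_bound (z0 : Z) (c : R) : 0 < c ->
  measurable [set om | star_percolates (X om) d r0] ->
  (forall n, c <= avgs m (fun=> trunc_law m (pois (lam * (g * h) ^+ D)))
     (map inl (cells_in D L n)) (fun s => `[< percZ d L h (n + rho) z0 s >]%:R) (full d 1)) ->
  (0 < P [set om | star_percolates (X om) d r0])%E.
Proof.
move=> c0 mS cP; have gh0 : 0 < g * h by case/andP: g01 => g0 _; rewrite mulr_gt0.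
pose cnt z om := tcount m (X om `&` cell (g * h) z).
pose obs n om := observe inl cnt (cells_in D L n) om (full d 1).
pose B n := [set om | `[< percZ d L h (n + rho) z0 (obs n om) >]].
have BP n : measurable (B n) /\ P (B n) = _ :=
  prob_cells d L gh0 lam0 XP n (full d 1) (fun s => `[< percZ d L h (n + rho) z0 s >]).
have mB : measurable (\bigcap_n B n) by apply: bigcapT_measurable => n; exact: (BP n).1.
have obs_in n om z : coarse L z \in ball n (origin D) ->
    obs n om (inl z) = counts d (g * h) (X om) 1 (inl z).
  by move=> zn; rewrite /obs observe_counts // cells_inP.
have Bdec : {homo B : n k / (n <= k)%N >-> (k <= n)%O}.
  move=> n k nk; apply/subsetPset => om /asboolP H; apply/asboolP.
  have : percZ d L h (n + rho) z0 (obs k om).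
    case: H => [u [ru [i fi]]]; exists u; split => //; exists i.
    by apply: contra fi; apply: ball_le; rewrite leq_add2r.
  apply: percZ_mono => -[z|b]; last by rewrite /obs !observe_out.
  have [zn|zn] := boolP (coarse L z \in ball n (origin D)).
    by rewrite !obs_in //; apply: ball_le zn.
  rewrite [leqRHS]/obs observe_full; last first.
    by move=> z'; rewrite cells_inP // => z'n [e]; rewrite e z'n in zn.
  have [zk|zk] := boolP (coarse L z \in ball k (origin D)).
    by rewrite obs_in //; exact: tcount_le.
  by rewrite /obs observe_full // => z'; rewrite cells_inP // => z'n [e]; rewrite e z'n in zk.
have cB : (c%:E <= P (\bigcap_n B n))%E.
  have P0 : (P (B 0%N) < +oo)%E.
    by apply: le_lt_trans (probability_le1 P (BP 0%N).1) _; rewrite ltry.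
  apply: cvge_ge (nonincreasing_cvg_mu P0 (fun n => (BP n).1) mB Bdec).
  by apply: nearW => n /=; rewrite (BP n).2 lee_fin.
apply: lt_le_trans (_ : (c%:E <= _)%E); first by rewrite lte_fin.
apply: le_trans cB _; apply: le_measure; rewrite ?inE //.
move=> om Bom; apply: (star_of_perc h0 L0 g01 gh r0P rhoP (z0 := z0)) => n.
exists (obs n om); split; first by move=> z; exact: obs_in.
  by move=> b; rewrite /obs observe_out.
by apply/asboolP; exact: Bom.
Qed.
End TargetProbability.

(** * Subcritical intensities *)

Section Products.
Variables (R : realType) (I : eqType) (m : nat).
Implicit Types (W : I -> nat -> R) (F G : (I -> nat) -> R).

Lemma avgs_mul_inv W l F G s :
  (forall i k t, i \in l -> F (upd t i k) = F t) ->
  avgs m W l (fun t => F t * G t) s = F s * avgs m W l G s.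
Proof.
elim: l s => //= i l IH s inv; rewrite /avg mulr_sumr; apply: eq_bigr => k _.
rewrite IH; first by rewrite inv ?inE ?eqxx //; ring.
by move=> j a t jl; apply: inv; rewrite inE jl orbT.
Qed.

Lemma avgs_all W l p (Q : nat -> bool) s : (forall i, is_law m (W i)) ->
  uniq p -> uniq l -> {subset p <= l} ->
  avgs m W l (fun t => (all (fun i => Q (t i)) p)%:R) s =
  \prod_(i <- p) \sum_(k < m.+1) W i k * (Q k)%:R.
Proof.
move=> WL up ul pl.
have perm : perm_eq l ([seq i <- l | i \notin p] ++ p).
  apply: uniq_perm => //.
    rewrite cat_uniq filter_uniq // up andbT; apply/hasPn => i ip.
    by rewrite mem_filter ip.
  move=> i; rewrite mem_cat mem_filter; case: (boolP (i \in p)) => /= [/pl -> //|_].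
  by rewrite orbF.
rewrite (avgs_perm m _ _ perm) avgs_cat.
have -> : avgs m W p (fun t => (all (fun i => Q (t i)) p)%:R) =
    fun=> \prod_(i <- p) \sum_(k < m.+1) W i k * (Q k)%:R.
  apply/funext => {}s; elim: p up {pl perm} s => [|i p IH] /= up s; first by rewrite big_nil.
  case/andP: up => ip up; rewrite big_cons -(IH up s).
  have -> : (fun t => (Q (t i) && all (fun i => Q (t i)) p)%:R) =
     (fun t : I -> nat => (Q (t i))%:R * (all (fun i => Q (t i)) p)%:R : R).
    by apply/funext => t; rewrite -natrM mulnb.
  rewrite /avg mulr_suml; apply: eq_bigr => k _.
  rewrite avgs_mul_inv; last first.
    by move=> j a t jp; rewrite /upd; case: eqP => // ij; rewrite ij jp in ip.
  by rewrite {1}/upd eqxx !(IH up) mulrA.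
exact: avgs_const.
Qed.
End Products.

Section Subcritical.
Import numFieldNormedType.Exports.
Variables (R : realType) (D d : nat).
Local Notation Z := {ffun 'I_D -> int}.
Local Notation m := d.+1.
Local Notation nr1 := (@nr R D 1).

Lemma coarse1 (z : Z) : coarse 1 z = z.
Proof. by apply/ffunP => i; rewrite ffunE divz1. Qed.

Let adj (z z' : Z) : bool := `[< nr1 z z' >].
Let occ (s : Z + Z -> nat) (z : Z) : bool := (0 < s (inl z))%N.

Let adj_ball z z' : adj z z' -> z' \in ball 2 z.
Proof. by move/asboolP; apply: nr_ball => //; rewrite invr1; lra. Qed.

Lemma reach_occupied s z0 c : (forall b, s (inr b) = 0%N) ->
  @reach Z Z d (coarse 1) nr1 (@nr R D (1 * 1%:R)) s z0 c -> forall k : 'I_d.+1,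
  exists p, [/\ path adj z0 p, last z0 p = c k & all (occ s) (z0 :: p)].
Proof.
move=> sb; have oc u i : valid nr1 s u -> occ s (u i).
  move=> [_ /(_ (u i))]; apply: leq_trans; apply/card_gt0P; exists i.
  by rewrite inE.
elim=> {c} [c v [i ti] k|c c' rc IH v' [[C [[i ci] [j cj]]]|[C [sC _]]] k]; last by rewrite sb in sC.
  rewrite coarse1 in ti; exists [:: c k]; split => //=.
    by rewrite andbT; apply/asboolP; rewrite -ti; exact: v.1.
  by rewrite -ti !oc.
rewrite coarse1 in ci; rewrite coarse1 in cj.
have [p [pp lp op]] := IH i; exists (rcons p (c' k)); split.
- by rewrite rcons_path pp lp ci -cj; apply/asboolP; exact: v'.1.
- by rewrite last_rcons.
- by rewrite -rcons_cons all_rcons op oc.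
Qed.

Fixpoint walks (N : nat) (z : Z) : seq (seq Z) :=
  if N is N'.+1 then [seq y :: p | y <- ball 2 z, p <- walks N' y] else [:: [::]].

Lemma size_walks N z : size (walks N z) = ((5 ^ D) ^ N)%N.
Proof.
elim: N z => //= N IH z; rewrite size_allpairs_dep.
rewrite (eq_map (g := fun=> ((5 ^ D) ^ N)%N)) //.
by rewrite sumnE big_map big_const_seq iter_addn_0 count_predT size_ball expnS mulnC.
Qed.

Lemma walksP N z p : path adj z p -> size p = N -> p \in walks N z.
Proof.
elim: N z p => [|N IH] z [|y p] //= /andP[zy yp] [sp].
by apply/allpairsPdep; exists y, p; split => //; [exact: adj_ball|exact: IH].
Qed.

Lemma walks_size N z p : p \in walks N z -> size p = N.
Proof.
elim: N z p => [|N IH] z p /=; first by rewrite inE => /eqP ->.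
by move=> /allpairsPdep[x [q [_ qx ->]]] /=; rewrite (IH x).
Qed.

Lemma walks_ball N z p y : p \in walks N z -> y \in p -> y \in ball (2 * N) z.
Proof.
elim: N z p => [|N IH] z p /=; first by rewrite inE => /eqP ->.
move=> /allpairsPdep[x [q [xz qx ->]]]; rewrite inE => /orP[/eqP ->|yq].
  by apply: ball_le xz; rewrite mulnS leq_addr.
by rewrite mulnS; apply: ball_trans xz _; exact: IH yq.
Qed.

(** Cells of side 1 within distance 1 differ by at most 2 in each coordinate, so there are
    [(5 ^ D) ^ N] walks of length [N]. A self-avoiding one is occupied with probability at most
    [t ^+ N], as [1 - expR (- t) <= t]. Below the stated value the expected number of occupied ones
    tends to 0. *)
Lemma subcritical (t : R) (z0 : Z) (c : R) : 0 < c -> 0 < t ->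
  (forall n, c <= avgs m (fun=> trunc_law m (pois t)) (map inl (cells_in D 1 n))
      (fun s => `[< percZ d 1 (1 : R) (n + 2) z0 s >]%:R) (full d 0)) ->
  (2 * (5 ^ D)%:R)^-1 <= t.
Proof.
move=> c0 t0 cP; rewrite leNgt; apply/negP => tM.
set M : R := (5 ^ D)%:R in tM.
have M0 : 0 < M by rewrite ltr0n expn_gt0.
have Mt : M * t <= 1 / 2.
  apply: ltW; move: tM; rewrite -(ltr_pM2l M0) (_ : M * (2 * M)^-1 = 1 / 2) //.
  by field; exact: lt0r_neq0.
pose B := (\sum_(i < D) absz (z0 i))%N.
have z0B : z0 \in ball B (origin D).
  by apply/ballP => i; rewrite ffunE sub0r normrN -abszE lez_nat /B (bigD1 i) //= leq_addr.
have WL : is_law m (trunc_law m (pois t)) by apply: trunc_law_law; exact: ltW.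
have W0 k : 0 <= trunc_law m (pois t) k by exact: WL.1.
have key N : c <= (1 / 2) ^+ N.
  pose n := (B + 2 * N)%N; apply: le_trans (cP n) _.
  pose G (p : seq Z) (s : Z + Z -> nat) : R := (all (occ s) p)%:R.
  pose ps := [seq p <- walks N z0 | uniq p].
  apply: (@le_trans _ _ (avgs m (fun=> trunc_law m (pois t)) (map inl (cells_in D 1 n))
      (fun s => \sum_(p <- ps) G p s) (full d 0))).
    apply: avgs_le_on => // s sE.
    have G0 p : 0 <= G p s by rewrite /G; case: all.
    case: asboolP => [[u [ru [k fk]]]|_]; last exact: sumr_ge0.
    have sb b : s (inr b) = 0%N.
      have := congr1 (fun f => f (inr b)) sE; rewrite /setl.
      by have -> : (inr b \in map (@inl Z Z) (cells_in D 1 n)) = false by apply/negP => /mapP[].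
    have [p [pp lp op]] := reach_occupied sb ru k.
    case: (shortenP pp) lp => p' pp' up' sp lp.
    have Np : (N <= size p')%N.
      rewrite leqNgt; apply/negP => pN; move/negP: fk; apply; rewrite coarse1 -lp.
      have : last z0 p' \in ball (2 * size p') z0.
        elim/last_ind: p' pp' {up' sp lp pN} => [_|q y IH]; first by rewrite /= ball_refl.
        rewrite rcons_path last_rcons size_rcons => /andP[/IH h1 /adj_ball h2].
        by have := ball_trans h1 h2; rewrite mulnS addnC.
      move=> H; apply: ball_le (ball_trans z0B H); rewrite /n -addnA leq_add2l.
      by apply: leq_trans (leq_addr _ _); rewrite leq_mul2l ltnW.
    have tp : take N p' \in ps.
      rewrite mem_filter; apply/andP; split.
        by move: up' => /= /andP[_ up']; exact: take_uniq.
      by apply: walksP; [exact: take_path|exact: size_takel].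
    rewrite (big_rem _ tp) /=; apply: ler_wpDr; first exact: sumr_ge0.
    rewrite /G (_ : all _ _ = true) //; apply/allP => y /mem_take /sp yp.
    by move/allP: op; apply; rewrite inE yp orbT.
  rewrite avgs_sum.
  have tn p : p \in ps -> avgs m (fun=> trunc_law m (pois t)) (map inl (cells_in D 1 n)) (G p) (full d 0) <= t ^+ N.
    rewrite mem_filter => /andP[up pw].
    have sp := walks_size pw.
    have inl_inj : injective (@inl Z Z) by move=> x y [].
    have -> : G p = (fun s => (all (fun i => (0 < s i)%N) (map (@inl Z Z) p))%:R).
      by apply/funext => s; rewrite all_map.
    rewrite (@avgs_all R _ m _ _ _ (fun k => (0 < k)%N)) //.
    - rewrite big_map big_const_seq count_predT sp iter_mulr_1.
      apply: lerXn2r; rewrite ?nnegrE ?(ltW t0) //.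
        by apply: sumr_ge0 => k _; rewrite mulr_ge0.
      have := WL.2; rewrite big_ord_recl => e; rewrite big_ord_recl /= mulr0 add0r.
      rewrite (eq_bigr (fun i : 'I_m => trunc_law m (pois t) (lift ord0 i))); last by move=> i _; rewrite mulr1.
      have -> : \sum_(i < m) trunc_law m (pois t) (lift ord0 i) =
        1 - trunc_law m (pois t) (@ord0 m) by rewrite -e; ring.
      rewrite /trunc_law /= /pois expr0 fact0 divr1 mul1r.
      by have := expR_ge1Dx (- t); lra.
    - by rewrite (map_inj_uniq inl_inj).
    - by rewrite (map_inj_uniq inl_inj) undup_uniq.
    - move=> _ /mapP[z zp ->]; rewrite (mem_map inl_inj) cells_inP // coarse1.
      exact: ball_trans z0B (walks_ball pw zp).
  apply: (@le_trans _ _ (\sum_(p <- ps) t ^+ N)).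
    by rewrite big_seq [leRHS]big_seq; apply: ler_sum => p; exact: tn.
  rewrite big_const_seq count_predT iter_addr_0 -[_ *+ _]mulr_natl.
  apply: (@le_trans _ _ (M ^+ N * t ^+ N)).
    apply: ler_wpM2r; first by rewrite exprn_ge0 // ltW.
    by rewrite /M -natrX ler_nat -(size_walks N z0) size_filter count_size.
  rewrite -exprMn; apply: lerXn2r => //; rewrite ?nnegrE; last by lra.
  by rewrite mulr_ge0 // ltW.
have cv : (fun N => (1 / 2 : R) ^+ N) @ \oo --> (0 : R).
  by apply: cvg_expr; rewrite ger0_norm; lra.
have /cvgrPdist_lt/(_ c c0)[N _ /(_ N (leqnn _))] := cv.
rewrite sub0r normrN ger0_norm ?exprn_ge0 // => h.
by have := key N; rewrite leNgt h.
Qed.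
End Subcritical.

(** * Supercritical intensities *)

Section Renormalization.
Local Open Scope nat_scope.
Variable o : nat * nat -> Prop.
Implicit Types (u v w : nat * nat) (x y : 'I_3 * 'I_3).

Definition sub_box u (i j : nat) : nat * nat := (3 * u.1 + i, 3 * u.2 + j).

(* A box of side [3 ^ k.+1] is good when at most one of its nine sub-boxes of
   side [3 ^ k] is not. *)
Fixpoint good k u : Prop :=
  if k is k'.+1 then forall x y, x != y ->
    good k' (sub_box u x.1 x.2) \/ good k' (sub_box u y.1 y.2)
  else o u.

(** The sites of the box that lie in good sub-boxes at every smaller scale. *)
Fixpoint backbone k u v : Prop :=
  if k is k'.+1 then exists x, good k' (sub_box u x.1 x.2) /\ backbone k' (sub_box u x.1 x.2) v
  else v = u.

Definition nbr u v := v = (u.1.+1, u.2) \/ v = (u.1, u.2.+1).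

(* The equivalence relation generated by adjacency of open sites. *)
Definition conn u v := forall K : nat * nat -> Prop,
  (forall a b, o a -> o b -> nbr a b -> (K a <-> K b)) -> (K u <-> K v).

Lemma conn_sym u v : conn u v -> conn v u.
Proof. by move=> h K HK; split=> /(h K HK). Qed.

Lemma conn_trans u v w : conn u v -> conn v w -> conn u w.
Proof. by move=> h h' K HK; split=> [/(h K HK)/(h' K HK)|/(h' K HK)/(h K HK)]. Qed.

Definition joined k u u' := forall v w, backbone k u v -> backbone k u' w -> conn v w.

Lemma joined_sym k u u' : joined k u u' -> joined k u' u.
Proof. by move=> h v w bv bw; apply: conn_sym; exact: h. Qed.

Lemma joined_trans k u u' u'' : (exists v, backbone k u' v) ->
  joined k u u' -> joined k u' u'' -> joined k u u''.
Proof. by move=> [x bx] h h' v w bv bw; apply: conn_trans (h _ _ bv bx) (h' _ _ bx bw). Qed.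

Lemma good_sub k u (i j i' j' : nat) : good k.+1 u -> i < 3 -> j < 3 -> i' < 3 -> j' < 3 ->
  (i, j) <> (i', j') -> good k (sub_box u i j) \/ good k (sub_box u i' j').
Proof.
move=> g i3 j3 i3' j3' ne; apply: (g (Ordinal i3, Ordinal j3) (Ordinal i3', Ordinal j3')).
by apply/eqP => -[e e']; apply: ne; rewrite e e'.
Qed.

Lemma backbone_sub k u (i j : nat) v : i < 3 -> j < 3 -> good k (sub_box u i j) ->
  backbone k (sub_box u i j) v -> backbone k.+1 u v.
Proof. by move=> i3 j3 g b; exists (Ordinal i3, Ordinal j3). Qed.

(** With at most one bad sub-box there are a full row and a full column, which cross at a hub, and
    every good sub-box lies in a full row or a full column, hence is joined to the hub. Two adjacent
    good boxes have three facing pairs of sub-boxes, of which at most two are spoiled. *)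
Lemma backbone_connected k :
  (forall u, good k u -> (exists v, backbone k u v) /\ joined k u u) /\
  (forall u u', nbr u u' -> good k u -> good k u' -> joined k u u').
Proof.
elim: k => [|k [IHP IHQ]].
  split=> [u gu|u u' n gu gu'].
    by split; [exists u|move=> v w -> -> K].
  by move=> v w -> -> K HK; exact: HK.
have line (g : nat -> nat * nat) : (forall j, j < 2 -> nbr (g j) (g j.+1)) ->
    (forall j, j < 3 -> good k (g j)) -> forall j j', j < 3 -> j' < 3 -> joined k (g j) (g j').
  move=> gn gg; have J j : j < 3 -> joined k (g j) (g j) by move=> /gg/IHP[].
  have J01 : joined k (g 0) (g 1) by apply: IHQ; [exact: gn|exact: gg|exact: gg].
  have J12 : joined k (g 1) (g 2) by apply: IHQ; [exact: gn|exact: gg|exact: gg].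
  have J02 : joined k (g 0) (g 2) by apply: joined_trans J01 J12; apply: (IHP _ _).1; exact: gg.
  move=> [|[|[|j]]] // [|[|[|j']]] // _ _; solve [exact: J | assumption | exact: joined_sym].
pose row u i := forall j, j < 3 -> good k (sub_box u i j).
pose col u j := forall i, i < 3 -> good k (sub_box u i j).
have rowJ u i : row u i -> forall j j', j < 3 -> j' < 3 -> joined k (sub_box u i j) (sub_box u i j').
  move=> r; apply: (line (fun j => sub_box u i j)) r => j _.
  by right; rewrite /sub_box /= addnS.
have colJ u j : col u j -> forall i i', i < 3 -> i' < 3 -> joined k (sub_box u i j) (sub_box u i' j).
  move=> c; apply: (line (fun i => sub_box u i j)) c => i _.
  by left; rewrite /sub_box /= addnS.
have notrow u i : ~ row u i -> exists2 j, j < 3 & ~ good k (sub_box u i j).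
  by move=> /existsNP[j /not_implyP[j3 h]]; exists j.
have notcol u j : ~ col u j -> exists2 i, i < 3 & ~ good k (sub_box u i j).
  by move=> /existsNP[i /not_implyP[i3 h]]; exists i.
have hub u : good k.+1 u -> exists r c, [/\ r < 3, c < 3, row u r & col u c].
  move=> gu; have [r r3 rr] : exists2 r, r < 3 & row u r.
    apply: contrapT => h; have [|j j3 b] := @notrow u 0; first by move=> r0; apply: h; exists 0.
    have [|j' j3' b'] := @notrow u 1; first by move=> r0; apply: h; exists 1.
    by case: (@good_sub k u 0 j 1 j' gu).
  have [c c3 cc] : exists2 c, c < 3 & col u c.
    apply: contrapT => h; have [|j j3 b] := @notcol u 0; first by move=> r0; apply: h; exists 0.
    have [|j' j3' b'] := @notcol u 1; first by move=> r0; apply: h; exists 1.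
    by case: (@good_sub k u j 0 j' 1 gu) => // -[].
  by exists r, c.
have tohub u r c i j : good k.+1 u -> r < 3 -> c < 3 -> row u r -> col u c ->
    i < 3 -> j < 3 -> good k (sub_box u i j) -> joined k (sub_box u i j) (sub_box u r c).
  move=> gu r3 c3 rr cc i3 j3 gij.
  have [ri|/notrow[j' j3' b]] := pselect (row u i).
    apply: (joined_trans (u' := sub_box u i c)); first by apply: (IHP _ _).1; exact: ri.
      exact: rowJ.
    exact: colJ.
  have [cj|/notcol[i' i3' b']] := pselect (col u j).
    apply: (joined_trans (u' := sub_box u r j)); first by apply: (IHP _ _).1; exact: cj.
      exact: colJ.
    exact: rowJ.
  case: (@good_sub k u i j' i' j gu) => // -[e e']; by rewrite e' in b.
have HP u : good k.+1 u -> (exists v, backbone k.+1 u v) /\ joined k.+1 u u.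
  move=> gu; have [r [c [r3 c3 rr cc]]] := hub u gu.
  have grc : good k (sub_box u r c) by exact: rr.
  have [[v bv] _] := IHP _ grc; split; first by exists v; exact: backbone_sub bv.
  move=> v1 v2 [[i j] [g1 b1]] [[i' j'] [g2 b2]].
  apply: (@conn_trans _ v).
    by apply: (tohub u r c i j) b1 bv.
  by apply: conn_sym; apply: (tohub u r c i' j') b2 bv.
split => // u u' n gu gu'.
have [i [j [i' [j' [[i3 j3 i3' j3'] nij g g']]]]] : exists i j i' j',
    [/\ [/\ i < 3, j < 3, i' < 3 & j' < 3], nbr (sub_box u i j) (sub_box u' i' j'),
      good k (sub_box u i j) & good k (sub_box u' i' j')].
  apply: contrapT => h.
  case: n => uE.
    have bad j : j < 3 -> ~ good k (sub_box u 2 j) \/ ~ good k (sub_box u' 0 j).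
      move=> j3; apply/not_andP => -[g g']; apply: h; exists 2, j, 0, j; split => //.
      by left; rewrite uE /sub_box /= mulnS; congr (_, _); lia.
    have L j j' : j < 3 -> j' < 3 -> j != j' -> good k (sub_box u 2 j) \/ good k (sub_box u 2 j').
      by move=> j3 j3' /eqP jj; apply: good_sub => // -[].
    have L' j j' : j < 3 -> j' < 3 -> j != j' -> good k (sub_box u' 0 j) \/ good k (sub_box u' 0 j').
      by move=> j3 j3' /eqP jj; apply: good_sub => // -[].
    by case: (bad 0 isT) => b0; case: (bad 1 isT) => b1; case: (bad 2 isT) => b2;
  first [ by case: (L 0 1 isT isT isT) | by case: (L 0 2 isT isT isT) | by case: (L 1 2 isT isT isT)
        | by case: (L' 0 1 isT isT isT) | by case: (L' 0 2 isT isT isT) | by case: (L' 1 2 isT isT isT)].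
  have bad j : j < 3 -> ~ good k (sub_box u j 2) \/ ~ good k (sub_box u' j 0).
    move=> j3; apply/not_andP => -[g g']; apply: h; exists j, 2, j, 0; split => //.
    by right; rewrite uE /sub_box /= mulnS; congr (_, _); lia.
  have L j j' : j < 3 -> j' < 3 -> j != j' -> good k (sub_box u j 2) \/ good k (sub_box u j' 2).
    by move=> j3 j3' /eqP jj; apply: good_sub => // -[].
  have L' j j' : j < 3 -> j' < 3 -> j != j' -> good k (sub_box u' j 0) \/ good k (sub_box u' j' 0).
    by move=> j3 j3' /eqP jj; apply: good_sub => // -[].
  by case: (bad 0 isT) => b0; case: (bad 1 isT) => b1; case: (bad 2 isT) => b2;
  first [ by case: (L 0 1 isT isT isT) | by case: (L 0 2 isT isT isT) | by case: (L 1 2 isT isT isT)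
        | by case: (L' 0 1 isT isT isT) | by case: (L' 0 2 isT isT isT) | by case: (L' 1 2 isT isT isT)].
have [[a ba] _] := IHP _ g; have [[b bb] _] := IHP _ g'.
move=> v w bv bw; apply: (@conn_trans _ a).
  by apply: (HP u gu).2 bv _; exact: backbone_sub ba.
apply: (@conn_trans _ b); first exact: (IHQ _ _ nij g g') ba bb.
by apply: (HP u' gu').2 _ bw; exact: backbone_sub bb.
Qed.

Lemma backbone_coord k u v : backbone k u v -> u.1 * 3 ^ k <= v.1.
Proof.
elim: k u => [|k IH] u /=; first by move=> ->; rewrite muln1.
move=> [x [_ /IH]]; apply: leq_trans; rewrite expnS mulnA leq_mul2r /= mulnC.
by rewrite leq_addr orbT.
Qed.

(** The corner boxes being good at all scales, the origin is on the backbone. One of two sub-boxes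
    in the last third of the box of level [K.+1] is good, and its sites have first coordinate at
    least [2 * 3 ^ K]. *)
Lemma far_connection K : (forall k, k <= K.+1 -> good k (0, 0)) ->
  exists v, conn (0, 0) v /\ K <= v.1.
Proof.
move=> g; have b0 k : k <= K.+1 -> backbone k (0, 0) (0, 0).
  elim: k => // k IH kK; exists (ord0, ord0); split; first exact: g (ltnW kK).
  exact: IH (ltnW kK).
have gK := g K.+1 (leqnn _).
have [j [j3 gj]] : exists j, j < 3 /\ good K (sub_box (0, 0) 2 j).
  have [h|h] := @good_sub K (0, 0) 2 0 2 1 gK isT isT isT isT (fun e => ltac:(discriminate e)).
    by exists 0.
  by exists 1.
have [HP _] := backbone_connected K; have [[v bv] _] := HP _ gj.
have [HP' _] := backbone_connected K.+1; have [_ J] := HP' _ gK.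
exists v; split.
  by apply: J; [exact: b0|exact: (@backbone_sub K (0, 0) 2 j)].
have := backbone_coord bv; rewrite /sub_box /=; apply: leq_trans.
by apply: leq_trans (ltnW (ltn_expl K (isT : 1 < 3))) _; rewrite leq_pmull.
Qed.

End Renormalization.

Lemma good_ext (o o' : nat * nat -> Prop) k u :
  (forall v, (v.1 %/ 3 ^ k = u.1)%N -> (v.2 %/ 3 ^ k = u.2)%N -> o v <-> o' v) ->
  good o k u <-> good o' k u.
Proof.
elim: k u => [|k IH] u h /=.
  by case: u h => u1 u2 h; apply: h; rewrite divn1.
have E x : good o k (sub_box u (x.1 : 'I_3) (x.2 : 'I_3)) <-> good o' k (sub_box u x.1 x.2).
  apply: IH => v /= h1 h2; apply: h; rewrite expnSr divnMA.
    by rewrite h1 mulnC divnMDl // divn_small ?addn0.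
  by rewrite h2 mulnC divnMDl // divn_small ?addn0.
by split=> H x y xy; have := H x y xy; rewrite !E.
Qed.

Section Independence.
Variables (R : realType) (I : eqType) (m : nat).
Implicit Types (W : I -> nat -> R) (F G : (I -> nat) -> R).

Lemma avgs_indep W l (Q : pred I) F G s : (forall i, is_law m (W i)) -> uniq l ->
  (forall i k t, Q i -> G (upd t i k) = G t) ->
  (forall i k t, ~~ Q i -> F (upd t i k) = F t) ->
  avgs m W l (fun t => F t * G t) s = avgs m W l F s * avgs m W l G s.
Proof.
move=> WL ul GQ FQ; pose lQ := [seq i <- l | Q i]; pose lN := [seq i <- l | ~~ Q i].
have perm : perm_eq l (lQ ++ lN) by rewrite perm_sym perm_filterC.
rewrite !(avgs_perm m _ _ perm) !avgs_cat.
have HN H t : avgs m W lN (fun t => F t * H t) t = F t * avgs m W lN H t.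
  by apply: avgs_mul_inv => i k u; rewrite mem_filter => /andP[/FQ ->].
have -> : avgs m W lN (fun t => F t * G t) = (fun t => F t * avgs m W lN G t).
  by apply/funext => t; exact: HN.
have -> : avgs m W lN F = F.
  by apply/funext => t; apply: avgs_inv => // i k u; rewrite mem_filter => /andP[/FQ ->].
have GI i k t : i \in lQ -> avgs m W lN G (upd t i k) = avgs m W lN G t.
  rewrite mem_filter => /andP[Qi _]; rewrite avgs_upd; last by rewrite mem_filter Qi.
  by congr (avgs _ _ _ _ t); apply/funext => u; rewrite GQ.
rewrite (avgs_inv s WL GI) mulrC.
have -> : (fun t => F t * avgs m W lN G t) = (fun t => avgs m W lN G t * F t).
  by apply/funext => t; rewrite mulrC.
by rewrite avgs_mul_inv.
Qed.
End Independence.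

(** * Good boxes at high intensity *)

Section Supercritical.
Variables (R : realType) (D d rho : nat) (h : R) (i0 i1 : 'I_D).
Local Notation Z := {ffun 'I_D -> int}.
Local Notation I := (Z + Z)%type.
Local Notation m := d.+1.
Hypotheses (i01 : i0 != i1) (h0 : 0 < h) (Dh : D%:R * h <= 1).

Definition plane (u : nat * nat) : Z :=
  [ffun i => if i == i0 then u.1%:Z else if i == i1 then u.2%:Z else 0].

Lemma plane_inj : injective plane.
Proof.
move=> [a b] [a' b'] /ffunP e; have := e i0; have := e i1.
by rewrite !ffunE !eqxx [i1 == i0]eq_sym (negbTE i01) /= => -[->] [->].
Qed.

Lemma plane_nr u v : nbr u v -> nr h (plane u) (plane v).
Proof.
move=> uv; exists (corner h (plane u)), (corner h (plane v)); split; try exact: cell_corner.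
apply: le_trans Dh; apply: edist_sup; first exact: ltW.
move=> i; rewrite !mxE -mulrBr normrM ger0_norm ?(ltW h0) // ler_piMr ?(ltW h0) //.
rewrite -intrB -intr_norm -[1]/(1%:~R) ler_int !ffunE.
by case: uv => ->; case: (i == i0); case: (i == i1) => /=; lia.
Qed.

(** Such a cell holds all [d.+1] vertices of a simplex, represented by a constant tuple. *)
Definition occupied (s : I -> nat) (u : nat * nat) : Prop := (m <= s (inl (plane u)))%N.

Local Notation reach1 := (@reach Z Z d (coarse 1) (nr h) (nr (h * 1%:R))).

Lemma valid_const s u : occupied s u -> valid (nr h) s (fun _ : 'I_d.+1 => plane u).
Proof.
move=> ou; split=> [i j|z]; first exact: nr_refl.
case: (eqVneq (plane u) z) => [<-|ne].
  by apply: leq_trans ou; rewrite -[X in (_ <= X)%N](card_ord m) max_card.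
rewrite [X in (X <= _)%N](_ : _ = 0%N) //; apply/eqP; rewrite cards_eq0.
by apply/eqP/setP => i; rewrite !inE; apply/negbTE.
Qed.

Lemma reach_conn s u v : (forall b, s (inr b) = 1%N) -> occupied s u ->
  conn (occupied s) u v -> reach1 s (plane u) (fun=> plane v).
Proof.
move=> s1 ou c; pose K v := reach1 s (plane u) (fun=> plane v).
have lk a b : nbr a b -> link (coarse 1) (nr (h * 1%:R)) s (fun _ : 'I_d.+1 => plane a) (fun=> plane b).
  move=> ab; right; exists (plane a); rewrite s1; split => //; rewrite mulr1.
  split; exists ord0; rewrite coarse1; first exact: nr_refl.
  by apply: nr_sym; exact: plane_nr.
apply: (c K _).1.
  move=> a b oa ob ab; split=> r.
    by apply: (reach_step r); [exact: valid_const|exact: lk].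
  by apply: (reach_step r); [exact: valid_const|apply: link_sym; exact: lk].
apply: reach_start; first exact: valid_const.
by exists ord0; rewrite coarse1.
Qed.

Lemma perc_of_good n s : (forall b, s (inr b) = 1%N) ->
  (forall k, (k <= n.+2)%N -> good (occupied s) k (0%N, 0%N)) -> percZ d 1 h n (plane (0%N, 0%N)) s.
Proof.
move=> s1 g; have o0 : occupied s (0%N, 0%N) := g 0%N isT.
have [v [c nv]] := far_connection g.
exists (fun=> plane v); split; first exact: reach_conn.
exists ord0; rewrite /far coarse1; apply/negP => /ballP/(_ i0).
by rewrite !ffunE eqxx /= sub0r normrN; lia.
Qed.

Variable p : nat -> R.
Hypothesis pL : is_law m p.
Hypothesis p_small : \sum_(k < m) p k <= 1 / 324.
Let W : I -> nat -> R := fun=> p.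
Let WL i : is_law m (W i). Proof. exact: pL. Qed.
Let bad k u (s : I -> nat) : R := (~~ `[< good (occupied s) k u >])%:R.

Let bad_le1 k u s : 0 <= bad k u s <= 1.
Proof. by rewrite /bad; case: asboolP; rewrite ?lexx ?ler01. Qed.

Let bad_upd k u s (i : I) a :
  (forall v, (v.1 %/ 3 ^ k = u.1)%N -> (v.2 %/ 3 ^ k = u.2)%N -> i <> inl (plane v)) ->
  bad k u (upd s i a) = bad k u s.
Proof.
move=> hi; rewrite /bad; congr ((~~ _)%:R); apply: asbool_equiv_eq.
apply: good_ext => v v1 v2; rewrite /occupied /upd.
by case: eqP => // e; case: (hi v).
Qed.

(** A bad box has two distinct bad sub-boxes, which are independent. With at most 81 pairs, a bound
    [b] at one scale becomes [81 * b ^+ 2] at the next; [1 / 324] is chosen so that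
    [81 * (1 / 324) = 1 / 4]. *)
Lemma bad_bound k u l : uniq l ->
  avgs m W l (bad k u) (full d 1) <= (1 / 324) * (1 / 4) ^+ k.
Proof.
move=> ul; elim: k u => [|k IH] u.
  rewrite expr0 mulr1; set i : I := inl (plane u).
  (* A cell outside [l] keeps its value in [full d 1], so its site is good. *)
  have [il|il] := boolP (i \in l); last first.
    rewrite avgs_inv //; last first.
      move=> j k t jl; apply: bad_upd => v /=; rewrite !divn1 => v1 v2 e.
      by move/negP: il; apply; rewrite /i [u](surjective_pairing) -v1 -v2 -[X in plane X](surjective_pairing) -e.
    rewrite /bad; case: asboolP => [_|ng] /=; first by lra.
    by case: ng; exact: leqnn.
  rewrite (avgs_perm m _ _ (perm_to_rem il)) (@avgs_catC _ _ _ _ [:: i]) avgs_cat /=.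
  rewrite -[leRHS](avgs_const (rem i l) _ (full d 1) WL); apply: avgs_le => [j k|s]; first exact: (WL j).1.
  apply: le_trans p_small; rewrite /avg big_ord_recr /= [X in _ + X](_ : _ = 0) ?addr0.
    apply: ler_sum => k _; rewrite -[leRHS]mulr1; apply: ler_wpM2l; first exact: pL.1.
    by case/andP: (bad_le1 0 u (upd s i k)).
  rewrite /bad (_ : `[< _ >] = true) ?mulr0 //; apply/asboolP.
  by rewrite /= /occupied /upd eqxx.
pose pairs := [seq xy <- enum {: ('I_3 * 'I_3) * ('I_3 * 'I_3)} | xy.1 != xy.2].
pose sb (x : 'I_3 * 'I_3) := sub_box u x.1 x.2.
have le s : bad k.+1 u s <= \sum_(xy <- pairs) bad k (sb xy.1) s * bad k (sb xy.2) s.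
  have b0 v : 0 <= bad k v s by case/andP: (bad_le1 k v s).
  have sum0 (r : seq (('I_3 * 'I_3) * ('I_3 * 'I_3))) : 0 <= \sum_(xy <- r) bad k (sb xy.1) s * bad k (sb xy.2) s.
    by apply: sumr_ge0 => xy _; rewrite mulr_ge0.
  rewrite {1}/bad; case: asboolP => [_|ng] //=.
  have [x [y [xy bx by_]]] : exists x y, [/\ x != y, ~ good (occupied s) k (sb x) & ~ good (occupied s) k (sb y)].
    apply: contrapT => hn; apply: ng => x y xy; apply: contrapT => /not_orP[bx by_].
    by apply: hn; exists x, y.
  have xyp : (x, y) \in pairs by rewrite mem_filter xy mem_enum.
  rewrite (big_rem _ xyp) /=; apply: ler_wpDr; first exact: sum0.
  by rewrite /bad; do 2 case: asboolP => //=; rewrite mulr1.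
apply: (@le_trans _ _ (avgs m W l
  (fun s => \sum_(xy <- pairs) bad k (sb xy.1) s * bad k (sb xy.2) s) (full d 1))).
  by apply: avgs_le => // i a; exact: (WL i).1.
rewrite avgs_sum; apply: (@le_trans _ _ (\sum_(xy <- pairs) ((1 / 324) * (1 / 4) ^+ k) ^+ 2)).
  rewrite big_seq [leRHS]big_seq; apply: ler_sum => -[x y]; rewrite mem_filter /= => /andP[xy _].
  pose Q (i : I) : bool := `[< exists v, [/\ i = inl (plane v), (v.1 %/ 3 ^ k = (sb x).1)%N &
    (v.2 %/ 3 ^ k = (sb x).2)%N] >].
  rewrite (avgs_indep (Q := Q)) //.
  - rewrite expr2; have a0 v : 0 <= avgs m W l (bad k v) (full d 1).
      by apply: avgs_ge0 => [i a|s]; [exact: (WL i).1|case/andP: (bad_le1 k v s)].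
    by apply: ler_pM.
  - move=> i a t /asboolP[v [-> v1 v2]]; apply: bad_upd => w w1 w2 [/plane_inj vw].
    rewrite vw in v1 v2; rewrite w1 in v1; rewrite w2 in v2.
    move: v1 v2; rewrite /sb /sub_box /= => /addnI e1 /addnI e2.
    by move/negP: xy; apply; apply/eqP; case: x y e1 e2 {Q v w w1 w2 vw} => [a1 a2] [b1 b2] /= /val_inj -> /val_inj ->.
  - move=> i a t nQ; apply: bad_upd => v v1 v2 e; move/asboolP: nQ; apply.
    by exists v.
rewrite big_const_seq iter_addr_0 count_predT.
have e0 : 0 <= (1 / 4 : R) ^+ k by rewrite exprn_ge0.
have e1 : (1 / 4 : R) ^+ k <= 1 by rewrite exprn_ile1 //; lra.
have sz : (size pairs <= 81)%N.
  by rewrite size_filter; apply: leq_trans (count_size _ _) _; rewrite -cardE !card_prod !card_ord.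
set e := (1 / 4) ^+ k in e0 e1 *.
apply: (@le_trans _ _ ((1 / 324 * e) ^+ 2 *+ 81)).
  by rewrite -[leLHS]mulr_natr -[leRHS]mulr_natr ler_wpM2l ?sqr_ge0 // ler_nat.
have : e * e <= e * 1 by apply: ler_wpM2l.
have -> : (1 / 324 * e) ^+ 2 *+ 81 = (e * e) / 1296 by field.
by move: (e * e) => E; rewrite [_ ^+ k.+1]exprS -/e; lra.
Qed.

(** Union bound over the [n + rho + 3] scales needed to reach beyond [n + rho]; the geometric series
    stays below [(1 / 324) * (4 / 3)]. *)
Lemma supercritical n :
  1 / 2 <= avgs m W (map inl (cells_in D 1 n))
    (fun s => `[< percZ d 1 h (n + rho) (plane (0%N, 0%N)) s >]%:R) (full d 1).
Proof.
set l := map _ _; set N := (n + rho).+2.+1.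
have ul : uniq l by rewrite map_inj_uniq ?undup_uniq // => x y [].
apply: (@le_trans _ _ (1 - \sum_(k <- iota 0 N) avgs m W l (bad k (0%N, 0%N)) (full d 1))).
  have h1 : \sum_(k <- iota 0 N) avgs m W l (bad k (0%N, 0%N)) (full d 1) <=
      \sum_(k <- iota 0 N) (1 / 324) * (1 / 4) ^+ k.
    by apply: ler_sum => k _; exact: bad_bound.
  have h2 : \sum_(k <- iota 0 N) (1 / 324) * (1 / 4 : R) ^+ k = (1 / 324) * (4 / 3 * (1 - (1 / 4) ^+ N)).
    rewrite -mulr_sumr; congr (_ * _); elim: N {h1} => [|N' IH].
      by rewrite big_nil expr0 subrr mulr0.
    by rewrite -addn1 iotaD big_cat IH /= big_seq1 add0n addn1 exprS; lra.
  have h3 : 0 <= (1 / 4 : R) ^+ N by rewrite exprn_ge0.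
  by lra.
rewrite -avgs_sum -[X in X - _](avgs_const l 1 (full d 1) WL) -avgsB.
apply: avgs_le_on => [i k|s sE]; first exact: (WL i).1.
have b0 k : 0 <= bad k (0%N, 0%N) s by case/andP: (bad_le1 k (0%N, 0%N) s).
have S0 (r : seq nat) : 0 <= \sum_(k <- r) bad k (0%N, 0%N) s by exact: sumr_ge0.
case: asboolP => [_|np]; first by rewrite lerBlDr lerDl.
rewrite subr_le0; apply: contrapT => /negP hn; apply: np; apply: perc_of_good.
  move=> b; have := congr1 (fun f => f (inr b)) sE; rewrite /setl.
  by have -> : (inr b \in l) = false by apply/negP => /mapP[].
move=> k kn; apply: contrapT => ng; move/negP: hn; apply.
have kN : k \in iota 0 N by rewrite mem_iota.
by rewrite (big_rem _ kN) /= {1}/bad; case: asboolP => //= _; rewrite lerDl S0.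
Qed.
End Supercritical.

(** * The strict inequality *)

Lemma nat_above (R : realType) (x : R) : exists n : nat, x <= n%:R.
Proof. by exists (Num.truncn x).+1; exact: ltW (truncnS_gt x). Qed.

Lemma bernoulli_inequality (R : realType) (x : R) n : 0 <= x <= 1 -> 1 - n%:R * x <= (1 - x) ^+ n.
Proof.
move=> /andP[x0 x1]; elim: n => [|n IH]; first by rewrite mul0r subr0 expr0.
rewrite exprS; apply: (@le_trans _ _ ((1 - x) * (1 - n%:R * x))); last first.
  by apply: ler_wpM2l => //; rewrite subr_ge0.
have : 0 <= n%:R * x * x by rewrite !mulr_ge0.
by rewrite -natr1; lra.
Qed.

(* The left-hand side is the factor by which discretising at mesh [e / L]
   increases the intensity. *)
Lemma mesh_exists (R : realType) (D : nat) (e eta : R) : 0 < e -> 0 < eta ->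
  exists L : nat, (0 < L)%N /\ (1 + 2 * (D%:R * (e / L%:R))) ^+ D <= 1 + eta.
Proof.
move=> e0 eta0; pose a := D%:R * (2 * (D%:R * e)).
have a0 : 0 <= a by rewrite !mulr_ge0 // ltW.
have [n nP] := nat_above (a * (1 + eta) / eta + 2 * (D%:R * e)).
have b0 : 0 <= 2 * (D%:R * e) by rewrite !mulr_ge0 // ltW.
have c0 : 0 <= a * (1 + eta) / eta.
  by apply: divr_ge0; [apply: mulr_ge0 => //; lra|exact: ltW].
exists n.+1; split => //; set L : R := n.+1%:R.
have L0 : 0 < L by rewrite ltr0n.
have nL : n%:R <= L by rewrite ler_nat.
pose x := 2 * (D%:R * (e / L)); rewrite -/x.
have xE : x = 2 * (D%:R * e) / L by rewrite /x !mulrA.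
have x0 : 0 <= x by rewrite xE divr_ge0 // ltW.
have x1 : x <= 1 by rewrite xE ler_pdivrMr // mul1r; lra.
have Dx : D%:R * x <= eta / (1 + eta).
  rewrite xE mulrA -/a ler_pdivrMr // mulrAC ler_pdivlMr; last by lra.
  have H : a * (1 + eta) / eta <= L by lra.
  by rewrite ler_pdivrMr // in H; rewrite mulrC [eta * _]mulrC in H *; lra.
have x01 : 0 <= x <= 1 by rewrite x0.
have B := bernoulli_inequality D x01.
have e1 : 0 < 1 + eta by lra.
(* Bernoulli's inequality bounds [(1 - x) ^+ D] from below, and the product with [(1 + x) ^+ D] is
   at most 1. *)
have p1 : (1 + eta)^-1 <= (1 - x) ^+ D.
  apply: le_trans B; have -> : (1 + eta)^-1 = 1 - eta / (1 + eta) by field; exact: lt0r_neq0.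
  by lra.
have i0 : 0 < (1 + eta)^-1 by rewrite invr_gt0.
have p2 : (1 + x) ^+ D * (1 - x) ^+ D <= 1.
  rewrite -exprMn; apply: exprn_ile1; first by rewrite mulr_ge0 //; lra.
  by have := mulr_ge0 x0 x0; lra.
have q0 : 0 <= (1 + x) ^+ D by rewrite exprn_ge0 //; lra.
have : (1 + x) ^+ D * (1 + eta)^-1 <= 1 by apply: le_trans p2; apply: ler_wpM2l.
by rewrite ler_pdivrMr // mul1r.
Qed.

Section Comparison.
Variables (R : realType) (D d : nat) (r0 : R).
Variables (dsp : measure_display) (Omega : measurableType dsp).
Variables (P : probability Omega R) (X : R -> Omega -> set 'rV[R]_D).
Hypotheses (D2 : (2 <= D)%N) (d1 : (0 < d)%N) (r02 : 2 < r0).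
Hypothesis XP : forall lam : R, 0 < lam -> is_PPP P (X lam) lam.
Hypothesis Xm : forall lam : R, 0 < lam ->
  measurable [set om | face_percolates (X lam om) d] /\
  measurable [set om | star_percolates (X lam om) d r0].
Local Notation m := d.+1.

Lemma coarse_mesh : exists e : R, [/\ 0 < e, D%:R * e <= 1 & 2 + 3 * (D%:R * e) <= r0].
Proof.
(* The quotient [y] serves as a closed form below both 1 and [r0 - 2]. *)
have D0 : (0 : R) < D%:R by rewrite ltr0n; apply: leq_trans D2.
pose y := (r0 - 2) / (r0 - 1); have hr := r02.
have r1 : 0 < r0 - 1 by lra.
have y0 : 0 < y by rewrite divr_gt0 //; lra.
have y1 : y <= 1 by rewrite /y ler_pdivrMr //; lra.
have yr : y <= r0 - 2.
  rewrite /y ler_pdivrMr //; have : 0 <= (r0 - 2) * (r0 - 2) by rewrite mulr_ge0 //; lra.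
  by lra.
clearbody y; exists (y / 3 / D%:R).
have -> : D%:R * (y / 3 / D%:R) = y / 3 by field; exact: lt0r_neq0.
by split; [rewrite !divr_gt0|lra|lra].
Qed.

Lemma shrink_factor (h : R) : 0 < h -> let g := (1 + 2 * (D%:R * h))^-1 in
  0 < g <= 1 /\ g * (1 + 2 * (D%:R * h)) <= 1.
Proof.
move=> h0 g; have k1 : 1 <= 1 + 2 * (D%:R * h) by rewrite lerDl !mulr_ge0 // ltW.
have k0 : 0 < 1 + 2 * (D%:R * h) by apply: lt_le_trans k1.
split; last by rewrite /g mulVf // lt0r_neq0.
by rewrite /g invr_gt0 k0 /= invf_le1.
Qed.

Lemma star_possible : exists2 lam : R, 0 < lam & (0 < P [set om | star_percolates (X lam om) d r0])%E.
Proof.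
have [h [h0 Dh hr]] := coarse_mesh.
have [g01 gh] := shrink_factor h0; set g := (1 + _)^-1 in g01 gh.
have g0 : 0 < g by case/andP: g01.
have [rho rhoP] := nat_above ((h * 1%:R)^-1 + 1).
have e0 : (0 : R) < 1 / 324 by lra.
have [t t0 tP] := pois_lt_eps m e0.
have ghD : 0 < (g * h) ^+ D by rewrite exprn_gt0 // mulr_gt0.
have lam0 : 0 < t / (g * h) ^+ D by rewrite divr_gt0.
exists (t / (g * h) ^+ D) => //.
pose i0 : 'I_D := Ordinal (leq_trans (isT : (0 < 2)%N) D2).
pose i1 : 'I_D := Ordinal D2.
apply: (@target_bound R D d 1 rho h g r0 _ dsp Omega P _ h0 isT g01 lam0 gh _ rhoP (XP lam0)
  (plane i0 i1 (0%N, 0%N)) (1 / 2)).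
- by rewrite mulr1.
- by lra.
- exact: (Xm lam0).2.
- move=> n; rewrite divfK ?lt0r_neq0 //; apply: supercritical => //.
    by apply: trunc_law_law; exact: ltW.
  apply: le_trans tP; apply: ler_sum => k _.
  by rewrite /trunc_law ltn_ord.
Qed.

Lemma face_positive (lam : R) : 0 < lam ->
  (0 < P [set om | face_percolates (X lam om) d])%E -> (2 * (5 ^ D)%:R)^-1 <= lam.
Proof.
move=> lam0 Pl.
have [z0 [c [c0 cP]]] := source_bound (ltr01 : (0 : R) < 1) (isT : (0 < 1)%N) lam0 (XP lam0) 2 d1 (Xm lam0).1 Pl.
by apply: (@subcritical R D d lam z0 c c0 lam0) => n; have := cP n; rewrite expr1n mulr1.
Qed.

(** [eta] is chosen from [f] and the coarse mesh alone, because [lam] is only known afterwards, as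
    some intensity within a factor [1 + eta] of the threshold. *)
Lemma strict_gain (f : R) : 0 < f -> exists eta : R, 0 < eta /\
  forall lam : R, 0 < lam -> lam < f * (1 + eta) ->
  (0 < P [set om | face_percolates (X lam om) d])%E ->
  exists lam' : R, [/\ 0 < lam', lam' < f & (0 < P [set om | star_percolates (X lam' om) d r0])%E].
Proof.
move=> f0; have [e [e0 De er]] := coarse_mesh.
have [rho rhoP] := nat_above (e^-1 + 1).
pose M := ((2 * (2 * rho)).+1 ^ D)%N.
(* Lower bound for the probability that a coarse cell, of volume [e ^+ D], is empty at any intensity
   up to [2 * f]. *)
pose mu0 := expR (- (2 * f * e ^+ D)).
pose beta := (1 / 2) ^+ M * (1 / 2) ^+ (M * M) * mu0 / 2.
have half0 n : 0 < (1 / 2 : R) ^+ n by rewrite exprn_gt0 //; lra.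
have half1 n : (1 / 2 : R) ^+ n <= 1 by rewrite exprn_ile1 //; lra.
have fe0 : 0 < f * e ^+ D by rewrite mulr_gt0 // exprn_gt0.
have mu1 : mu0 <= 1 by rewrite -expR0 ler_expR; lra.
have mupos : 0 < mu0 by exact: expR_gt0.
have b0 : 0 < beta by rewrite /beta divr_gt0 // !mulr_gt0.
have b1 : beta <= 1 / 2.
  have h0 n : 0 <= (1 / 2 : R) ^+ n by exact: ltW.
  rewrite /beta ler_wpM2r //; apply: mulr_ile1 => //; try by [apply: ltW|apply: mulr_ge0].
  exact: mulr_ile1.
(* With [r = (1 - 3 * eta) ^+ m], Bernoulli's inequality bounds [r ^+ (2 * m)] below by
   [1 - 6 * m ^ 2 * eta], which is [1 - beta]. *)
pose A : R := (6 * (m * m))%:R; have A6 : 6 <= A by rewrite ler_nat leq_pmulr // muln_gt0.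
pose eta := beta / A.
have A0 : 0 < A by lra.
have eta0 : 0 < eta by rewrite divr_gt0.
have eta6 : eta <= 1 / 12.
  rewrite ler_pdivrMr //; have : 1 / 12 * 6 <= 1 / 12 * A by apply: ler_wpM2l.
  by lra.
exists eta; split => // lam lam0 lamf Pl.
(* Two factors [1 + eta] have to be absorbed, one for [lam] exceeding [f] and one for the mesh; the
   third [eta] makes the result strictly smaller than [f]. *)
pose q := 1 - 3 * eta; have q01 : 0 <= q <= 1 by rewrite /q; lra.
have q0 : 0 < q by rewrite /q; lra.
pose r := q ^+ m; have r01 : 0 <= r <= 1 by rewrite exprn_ge0 ?exprn_ile1 //; case/andP: q01.
have rn : 1 - beta <= r ^+ (2 * m).
  rewrite /r -exprM; apply: le_trans (bernoulli_inequality _ (_ : 0 <= 3 * eta <= 1)); last by lra.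
  have AE : A = 3 * (m * (2 * m))%:R by rewrite /A !natrM; ring.
  have : (m * (2 * m))%:R * (3 * eta) = beta.
    by rewrite /eta mulrCA mulrA -AE mulrC divfK // lt0r_neq0.
  by lra.
have [L [L0 LP]] := mesh_exists D e0 eta0.
have L0' : (0 : R) < L%:R by rewrite ltr0n.
pose h := e / L%:R; have h0 : 0 < h by rewrite divr_gt0.
have hL : h * L%:R = e by rewrite /h divfK // lt0r_neq0.
have rhoP' : (h * L%:R)^-1 + 1 <= rho%:R by rewrite hL.
pose t := lam * h ^+ D; have t0 : 0 < t by rewrite mulr_gt0 // exprn_gt0.
have [z0 [c [c0 cP]]] := source_bound h0 L0 lam0 (XP lam0) rho d1 (Xm lam0).1 Pl.
have qt0 : 0 <= q * t by rewrite mulr_ge0 // ltW.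
have muP : 0 <= mu0 <= trunc_law m (pois (q * t)) 0 ^+ (L ^ D).
  rewrite (ltW mupos) /= /trunc_law /= /pois expr0 fact0 divr1 mul1r -expRM_natl ler_expR.
  rewrite mulrN lerN2.
  have -> : (L ^ D)%:R * (q * t) = q * (lam * e ^+ D).
    have eD : e ^+ D = h ^+ D * L%:R ^+ D by rewrite -exprMn hL.
    rewrite eD natrX /t; move: (h ^+ D) (L%:R ^+ D : R) => a b; ring.
  have lf : lam * e ^+ D <= 2 * f * e ^+ D.
    apply: ler_wpM2r; first by rewrite exprn_ge0 // ltW.
    have : f * eta <= f * 1 by apply: ler_wpM2l; [exact: ltW|lra].
    by rewrite mulrDr in lamf; lra.
  apply: le_trans lf; apply: ler_piMl; last by case/andP: q01.
  by rewrite mulr_ge0 ?exprn_ge0 // ltW.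
have fv n := @finite_volume R D d L rho h h0 L0 rhoP' (trunc_law m (pois t)) (trunc_law m (pois (q * t)))
  mu0 r M n z0 (trunc_law_law _ (ltW t0)) (trunc_law_law _ qt0)
  (fun k => trunc_law_thin _ k q01 (ltW t0)) r01 (erefl _) muP rn.
have [g01 gh] := shrink_factor h0; set g := (1 + _)^-1 in g01 gh.
have g0 : 0 < g by case/andP: g01.
have gD : 0 < g ^+ D by rewrite exprn_gt0.
have lam'0 : 0 < q * lam / g ^+ D by rewrite divr_gt0 // mulr_gt0.
exists (q * lam / g ^+ D); split => //.
  rewrite -exprVn /g invrK; apply: (@le_lt_trans _ _ (q * lam * (1 + eta))).
    by apply: ler_wpM2l => //; rewrite mulr_ge0 // ltW.
  apply: (@lt_le_trans _ _ (q * (f * (1 + eta)) * (1 + eta))).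
    by rewrite ltr_pM2r; [rewrite ltr_pM2l|lra].
  have -> : q * (f * (1 + eta)) * (1 + eta) = f * (1 - (eta + 5 * eta ^+ 2 + 3 * eta ^+ 3)).
    by rewrite /q; ring.
  apply: ler_piMr; first exact: ltW.
  have s2 : 0 <= eta ^+ 2 by rewrite exprn_ge0 // ltW.
  have s3 : 0 <= eta ^+ 3 by rewrite exprn_ge0 // ltW.
  by lra.
set Lz := flatten [seq subcells L C | C <- ball rho z0].
apply: (@target_bound R D d L rho h g r0 _ dsp Omega P _ h0 L0 g01 lam'0 gh _ rhoP' (XP lam'0)
  z0 (r ^+ size Lz * c)).
- by rewrite hL.
- by rewrite mulr_gt0 // exprn_gt0 // exprn_gt0.
- exact: (Xm lam'0).2.
- move=> n; have -> : q * lam / g ^+ D * (g * h) ^+ D = q * t.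
    by rewrite exprMn /t; field; exact: lt0r_neq0.
  apply: le_trans (fv n); apply: ler_wpM2l; last exact: cP.
  by rewrite exprn_ge0 //; case/andP: r01.
Qed.
End Comparison.

Theorem theorem3 (R : realType) (D d : nat) (r0 : R)
    (dsp : measure_display) (Omega : measurableType dsp)
    (P : probability Omega R) (X : R -> Omega -> set 'rV[R]_D) :
  (2 <= D)%N -> (1 <= d <= D)%N -> 2 < r0 ->
  (forall lam : R, 0 < lam -> is_PPP P (X lam) lam) ->
  (forall lam : R, 0 < lam ->
     measurable [set om | face_percolates (X lam om) d] /\
     measurable [set om | star_percolates (X lam om) d r0]) ->
  (lambda_star P X d r0 < lambda_face P X d)%E.
Proof.
move=> D2 /andP[d1 _] r02 XP Xm.
have star_le lam : 0 < lam -> (0 < P [set om | star_percolates (X lam om) d r0])%E ->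
    (lambda_star P X d r0 <= lam%:E)%E.
  by move=> lam0 Pl; apply: ereal_inf_lbound; exists lam.
set F := lambda_face P X d.
have F0 : ((2 * (5 ^ D)%:R)^-1%:E <= F)%E.
  apply: le_ereal_inf_tmp => _ [lam [lam0 Pl] <-]; rewrite lee_fin.
  exact: (face_positive d1 XP Xm lam0 Pl).
(* The positive lower bound excludes [-oo]; if the face threshold is [+oo], a finite * threshold is
   enough. *)
case FE : F F0 => [f| |] F0; last by [].
- have f0 : 0 < f.
    rewrite lee_fin in F0; apply: lt_le_trans F0; rewrite invr_gt0 mulr_gt0 // ltr0n expn_gt0 //.
  have [eta [eta0 gain]] := strict_gain D2 d1 r02 XP Xm f0.
  have : (F < (f * (1 + eta))%:E)%E.
    by rewrite FE lte_fin mulrDr mulr1 ltrDl mulr_gt0.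
  move=> /ereal_inf_lt[_ [lam [lam0 Pl] <-]]; rewrite lte_fin => lamf.
  have [lam' [lam'0 lam'f Pl']] := gain lam lam0 lamf Pl.
  by apply: le_lt_trans (star_le _ lam'0 Pl') _; rewrite lte_fin.
- have [lam lam0 Pl] := star_possible D2 r02 XP Xm.
  by apply: le_lt_trans (star_le _ lam0 Pl) _; rewrite ltry.
Qed.
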